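(* Let $\rho<1/2$ be real. Then the difference operator $$\mathcal L f(s)=\frac{\frac12-\rho-is}{(-2is)(1-2is)}\bigl(f(s+i)-f(s)\bigr)+\frac{\frac12-\rho+is}{(2is)(1+2is)}\bigl(f(s-i)-f(s)\bigr),$$ defined on the domain $\mathcal H[w]$, is essentially self-adjoint in the Hilbert space of even functions on $\mathbb R$ with inner product $$\langle f,g\rangle=\frac1{4\pi}\int_{-\infty}^\infty f(s)\overline{g(s)}\left|\frac{\Gamma(1/2-\rho+is)}{\Gamma(2is)}\right|^2ds.$$
   Context: The domain $\mathcal H[w]$ consists of even functions $f$ holomorphic in the closed strip $|\operatorname{Im}s|\le1$ (i.e. holomorphic in $|\operatorname{Im}s|<1+\delta$ for some $\delta>0$) such that, for some $\varepsilon>0$, $f(s)=O\bigl(|s|^{\rho-2-\varepsilon}e^{-\pi|\operatorname{Re}s|/2}\bigr)$ as $|\operatorname{Re}s|\to\infty$ in this strip. (The weight $|\Gamma(1/2-\rho+is)/\Gamma(2is)|^2$ grows like a constant times $|s|^{1-2\rho}e^{\pi|s|}$.) *)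

(* Defs.v *)
From mathcomp Require Import all_boot all_order all_algebra.
From mathcomp Require Import all_classical all_reals all_analysis.
From mathcomp Require Import complex.
Import Order.TTheory GRing.Theory Num.Theory.
Import numFieldNormedType.Exports.
Import ComplexField.Normc.

Set Implicit Arguments.
Unset Strict Implicit.
Unset Printing Implicit Defensive.

Local Open Scope classical_set_scope.
Local Open Scope ring_scope.
Local Open Scope complex_scope.

(* A Hilbert space is given here by representatives: a linear subspace [H] of
   [V] carrying a positive semidefinite Hermitian form [ip], vectors whose
   difference has norm zero being identified (for an L^2 space: functions that
   agree almost everywhere).  An unbounded operator is given by its graph. *)
Section UnboundedOperators.
Variables (K : numClosedFieldType) (V : lmodType K).
Variables (H : set V) (ip : V -> V -> K).

Definition hnorm (u : V) : K := sqrtC (ip u u).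

(* By linearity the last condition says that the second component is determined
   by the first, up to vectors of norm zero. *)
Definition linear_operator (G : set (V * V)) : Prop :=
  [/\ forall f g, G (f, g) -> H f /\ H g,
      G (0, 0),
      forall (a : K) f1 g1 f2 g2, G (f1, g1) -> G (f2, g2) ->
        G (a *: f1 + f2, a *: g1 + g2)
    & forall f g, G (f, g) -> hnorm f = 0 -> hnorm g = 0].

Definition densely_defined (G : set (V * V)) : Prop :=
  forall u, H u -> forall e : K, 0 < e ->
    exists f g, G (f, g) /\ hnorm (u - f) < e.

Definition symmetric_operator (G : set (V * V)) : Prop :=
  forall f1 g1 f2 g2, G (f1, g1) -> G (f2, g2) -> ip g1 f2 = ip f1 g2.

Definition graph_adjoint (G : set (V * V)) : set (V * V) :=
  [set p | [/\ H p.1, H p.2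
             & forall f g, G (f, g) -> ip g p.1 = ip f p.2]].

Definition graph_closure (G : set (V * V)) : set (V * V) :=
  [set p | [/\ H p.1, H p.2
             & forall e : K, 0 < e -> exists f g,
                 [/\ G (f, g), hnorm (p.1 - f) < e & hnorm (p.2 - g) < e]]].

Definition self_adjoint (G : set (V * V)) : Prop :=
  [/\ linear_operator G, densely_defined G & graph_adjoint G = G].

Definition essentially_self_adjoint (G : set (V * V)) : Prop :=
  [/\ linear_operator G, densely_defined G, symmetric_operator G
    & self_adjoint (graph_closure G)].

End UnboundedOperators.

Section ComplexFunctions.
Variable R : realType.
Local Notation C := R[i].

(* [n ^ z] for a positive integer [n], that is [exp (z * ln n)]. *)
Definition natcpow (n : nat) (z : C) : C :=
  let t := complex.Im z * ln n%:R in
  (expR (complex.Re z * ln n%:R))%:C * (cos t +i* sin t).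

(* Gauss's product; by the convention [x / 0 = 0] the value at a pole is [0]. *)
Definition Gamma (z : C) : C :=
  limn (fun n : nat =>
    (n`!%:R * natcpow n z / \prod_(k < n.+1) (z + k%:R) : C^o)).

Definition holomorphic_on (A : set C) (f : C -> C) : Prop :=
  forall z, A z -> derivable (f : C^o -> C^o) z 1.

Definition strip (a : R) : set C := [set z | `|complex.Im z| < a].

Definition cintegral (h : R -> C) : C :=
  (\int[@lebesgue_measure R]_x complex.Re (h x)) +i*
  (\int[@lebesgue_measure R]_x complex.Im (h x)).

End ComplexFunctions.

Section DifferenceOperator.
Variables (R : realType) (rho : R).
Local Notation C := R[i].

Definition weight (s : R) : R :=
  normc (Gamma ((2^-1 - rho)%:C + 'i%C * s%:C) / Gamma (2 * 'i%C * s%:C)) ^+ 2.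

Definition L2even : set (R -> C^o) :=
  [set f : R -> C^o |
     [/\ measurable_fun setT (fun s : R => complex.Re (f s)),
         measurable_fun setT (fun s : R => complex.Im (f s)),
         forall s : R, f (- s) = f s
       & (\int[@lebesgue_measure R]_s
            (normc (f s) ^+ 2 * weight s)%:E < +oo)%E]].

Definition inner (f g : R -> C^o) : C :=
  ((4 * pi)^-1)%:C *
  cintegral (fun s => (f s : C) * (g s : C)^* * (weight s)%:C).

Definition domainH : set (C -> C) :=
  [set f : C -> C | exists2 delta : R, 0 < delta &
    [/\ forall z, strip (1 + delta) z -> f (- z) = f z,
        holomorphic_on (strip (1 + delta)) f
      & exists2 eps : R, 0 < eps & exists A B : R,
          forall z, `|complex.Im z| <= 1 -> A <= `|complex.Re z| ->
            normc (f z) <= B * normc z `^ (rho - 2 - eps)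
                             * expR (- (pi * `|complex.Re z| / 2))]].

Definition diff_op (f : C -> C) (s : C) : C :=
  ((2^-1 - rho)%:C - 'i%C * s) / ((- 2 * 'i%C * s) * (1 - 2 * 'i%C * s))
    * (f (s + 'i%C) - f s)
  + ((2^-1 - rho)%:C + 'i%C * s) / ((2 * 'i%C * s) * (1 + 2 * 'i%C * s))
    * (f (s - 'i%C) - f s).

(* On the real line the coefficients of [diff_op] are singular only at [0],
   where the value is immaterial in L^2. *)
Definition diff_op_graph : set ((R -> C^o) * (R -> C^o)) :=
  [set p | exists2 f, domainH f &
     p = ((fun s : R => f s%:C), (fun s : R => diff_op f s%:C))].

End DifferenceOperator.

(* Main.v *)
(** Write [a = 1/2 - rho].  Symmetry: the [n]-th Gauss products of the Gamma
    functions in the weight give rational kernels [B_n] with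
    [B_n(t + 1) = B_n(- t)] exactly; moving the line of integration of
    [B_n(i s) f(s + i) conj(g(conj s))] from [Im s = 0] to [Im s = -1] and letting
    [n] tend to infinity by dominated convergence yields [<L f, g> = <f, L g>].

    Essential self-adjointness then follows if [G0] is a subspace of the graph on
    which [<f, L f> >= 0] and for which the [f + L f] are dense.  Put
    [h_n(s) = prod_(k < n) ((k + 1/2)^2 + s^2) / (a + k + 1/2) / cosh (pi s)]; a
    computation gives [L h_(n+1) = h_n], and [G0] is spanned by the pairs
    [(h_(n+1), h_n)].  By symmetry [<h_m, h_n>] depends only on [m + n] and equals
    [(m + n)! c] for [m + n > 0].  Positivity is
    [(m+n+1)! = (m+1)! (n+1)! sum_k C(m,k) C(n,k) / (k+1)].  For the range, modulo
    the [h_(j+1) + h_j] every [h_(j+1)] is [(-1)^j h_1], and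
    [P_K = sum_j (-1)^j C(K,j) / (j+1)! h_(j+1)] has [|P_K|^2 = 2 c] but equals
    [d_K h_1] with [d_K >= 1 + K/2]; hence [h_1], and all [h_n] with [n > 0], lie
    in the closure of the range.  These span a dense subspace: it consists of the
    even polynomials times [h_1], and the measure [h_1^2 w ds] has exponential
    moments. *)
Require Import Defs.
From mathcomp Require Import all_boot all_order all_algebra.
From mathcomp Require Import all_classical all_reals all_analysis.
From mathcomp Require Import complex measurable_realfun.
From mathcomp Require Import ring lra.
Import Order.TTheory GRing.Theory Num.Theory.
Import numFieldNormedType.Exports.
Import ComplexField.Normc.
Import HBSimple HBNNSimple.

Set Implicit Arguments.
Unset Strict Implicit.
Unset Printing Implicit Defensive.

Local Open Scope classical_set_scope.
Local Open Scope ring_scope.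

(** * A criterion for essential self-adjointness *)

(** The factorials point to a model: replacing [h_n] by [x^n] turns [(m + n)! c] into the moments of
    [c e^(-x) dx] on the half-line, and [L] into division by [x]. The identity for [(m+n+1)!] is the
    expansion of powers in the Laguerre polynomials of parameter 1, [P_K] corresponds to
    [x L_K(x) / (K + 1)] for these polynomials, and [d_K] is the value of [L_K(x) / (K + 1)] at
    [x = -1]. The proof keeps only the resulting binomial identities. Two obstacles shape the rest.
    Positivity is computed on the explicit span only, so the criterion works with two graphs:
    symmetry on the large one, positivity and range on the small one. And the weight is available
    only as a limit of Gauss products, so functional equations are used at a finite stage, where
    they hold exactly or up to an explicit factor, and every bound must be uniform in the stage. The
    uniform bound for the weight exceeds its true growth by at most two powers of [|s|]; the
    exponent [rho - 2 - eps] of the domain is just small enough to absorb this. *)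

Section EssentialSelfAdjointness.
Variables (K : numClosedFieldType) (V : lmodType K).
Variables (H : set V) (ip : V -> V -> K).

Hypothesis H0 : H 0.
Hypothesis HP : forall (a : K) u v, H u -> H v -> H (a *: u + v).
Hypothesis ipP : forall (a : K) u v w, H u -> H v -> H w ->
  ip (a *: u + v) w = a * ip u w + ip v w.
Hypothesis ipC : forall u v, H u -> H v -> ip v u = (ip u v)^*.
Hypothesis ip_ge0 : forall u, H u -> 0 <= ip u u.

Local Notation N := (hnorm ip).

Let HD u v : H u -> H v -> H (u + v).
Proof. by move=> hu hv; have := HP 1 hu hv; rewrite scale1r. Qed.
Let HZ (a : K) u : H u -> H (a *: u).
Proof. by move=> hu; have := HP a hu H0; rewrite addr0. Qed.
Let HB u v : H u -> H v -> H (u - v).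
Proof. by move=> hu hv; rewrite -scaleN1r; apply: HD => //; apply: HZ. Qed.

Let ip0 w : H w -> ip 0 w = 0.
Proof.
move=> hw; have := ipP 1 H0 H0 hw; rewrite scale1r addr0 mul1r.
by move/eqP; rewrite -subr_eq subrr => /eqP.
Qed.
Let ipDl u v w : H u -> H v -> H w -> ip (u + v) w = ip u w + ip v w.
Proof. by move=> hu hv hw; rewrite -[u]scale1r ipP ?scale1r ?mul1r. Qed.
Let ipZl (a : K) u w : H u -> H w -> ip (a *: u) w = a * ip u w.
Proof. by move=> hu hw; have := ipP a hu H0 hw; rewrite ip0 // !addr0. Qed.
Let ipBl u v w : H u -> H v -> H w -> ip (u - v) w = ip u w - ip v w.
Proof.
move=> hu hv hw; rewrite -scaleN1r ipDl //; last exact: HZ.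
by rewrite ipZl // mulN1r.
Qed.
Let ipDr u v w : H u -> H v -> H w -> ip w (u + v) = ip w u + ip w v.
Proof.
by move=> hu hv hw; rewrite ipC ?ipDl ?rmorphD //= -?ipC //; exact: HD.
Qed.
Let ipZr (a : K) u w : H u -> H w -> ip w (a *: u) = a^* * ip w u.
Proof. by move=> hu hw; rewrite ipC ?ipZl ?rmorphM //= -?ipC //; exact: HZ. Qed.
Let ipBr u v w : H u -> H v -> H w -> ip w (u - v) = ip w u - ip w v.
Proof. by move=> hu hv hw; rewrite ipC ?ipBl ?rmorphB //= -?ipC //; exact: HB. Qed.

Let N_ge0 u : H u -> 0 <= N u.
Proof. by move=> hu; rewrite /hnorm sqrtC_ge0 ip_ge0. Qed.
Let N2 u : N u ^+ 2 = ip u u.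
Proof. by rewrite /hnorm sqrtCK. Qed.

(** The form is only semidefinite, so the minimizing multiple of [v] exists only if [ip v v] is
    nonzero. When it vanishes, [ip u v] vanishes too: otherwise subtracting a large multiple of [v]
    from [u] would make a squared norm negative. *)
Lemma hnorm_cauchy_schwarz u v : H u -> H v -> `|ip u v| <= N u * N v.
Proof.
move=> hu hv.
have A0 := ip_ge0 hu; have C0 := ip_ge0 hv.
rewrite -(ler_pXn2r (_ : 0 < 2)%N) ?nnegrE //; last first.
  by rewrite mulr_ge0 // N_ge0.
rewrite exprMn !N2.
have expand (t s : K) : t^* = t -> ip (t *: u - s *: v) (t *: u - s *: v) =
    t ^+ 2 * ip u u - t * (s^* * ip u v + s * (ip u v)^*) + s * s^* * ip v v.
  move=> tR; have h1 := HZ t hu; have h2 := HZ s hv; have h3 := HB h1 h2.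
  rewrite ipBl // !ipBr // !ipZl // !ipZr // tR (ipC hu hv).
  by ring.
have [c0|cn0] := eqVneq (ip v v) 0.
  rewrite c0 mulr0; case: (eqVneq (ip u v) 0) => [->|bn0].
    by rewrite normr0 expr0n.
  have B0 : 0 < `|ip u v| ^+ 2 by rewrite exprn_gt0 // normr_gt0.
  (* With this multiplier the squared norm of [u - (t * ip u v) *: v] becomes
     [ip u u - (ip u u + 1) = -1]. *)
  pose t := (ip u u + 1) / (2 * `|ip u v| ^+ 2).
  have := expand 1 (t * ip u v) (conjC1 _).
  rewrite c0 mulr0 addr0 => e.
  have : 0 <= ip (1 *: u - (t * ip u v) *: v) (1 *: u - (t * ip u v) *: v).
    by apply: ip_ge0; apply: HB; apply: HZ.
  have tR : t^* = t.
    apply/CrealP; rewrite realE; apply/orP; left.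
    by rewrite divr_ge0 ?addr_ge0 ?mulr_ge0 // ltW.
  rewrite e expr1n !mul1r rmorphM /= tR.
  have -> : ip u u - (t * (ip u v)^* * ip u v + t * ip u v * (ip u v)^*) =
     ip u u - t * (2 * `|ip u v| ^+ 2) by rewrite normCK; ring.
  rewrite /t divfK; last by rewrite mulf_neq0 ?pnatr_eq0 // gt_eqF.
  by rewrite opprD addrA subrr add0r oppr_ge0 => /(lt_le_trans ltr01); rewrite ltxx.
have cp : 0 < ip v v by rewrite lt_neqAle eq_sym cn0.
have cR : (ip v v)^* = ip v v by apply/CrealP; rewrite realE C0.
(* The multipliers [ip v v] and [ip u v] avoid a division: the squared norm is [ip v v] times the
   Cauchy-Schwarz defect. *)
have := expand (ip v v) (ip u v) cR.
have -> : (ip v v) ^+ 2 * ip u u -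
  ip v v * ((ip u v)^* * ip u v + ip u v * (ip u v)^*) +
  ip u v * (ip u v)^* * ip v v = ip v v * (ip u u * ip v v - `|ip u v| ^+ 2).
  by rewrite normCK; ring.
move=> e; have : 0 <= ip v v * (ip u u * ip v v - `|ip u v| ^+ 2).
  by rewrite -e; apply: ip_ge0; apply: HB; apply: HZ.
by rewrite pmulr_rge0 // subr_ge0.
Qed.

Let add_conj_le (x : K) : x + x^* <= 2 * `|x|.
Proof.
have -> : x + x^* = 2 * 'Re x by rewrite ReE; field.
by rewrite ler_pM2l ?ltr0n // (leif_Re_Creal x).
Qed.

Lemma hnormD_le u v : H u -> H v -> N (u + v) <= N u + N v.
Proof.
move=> hu hv; have huv := HD hu hv.
rewrite -(ler_pXn2r (_ : 0 < 2)%N) ?nnegrE ?addr_ge0 ?N_ge0 //.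
rewrite N2 ipDl // !ipDr // (ipC hu hv) sqrrD -!N2.
have -> : N u ^+ 2 + ip u v + ((ip u v)^* + N v ^+ 2) =
   N u ^+ 2 + (ip u v + (ip u v)^*) + N v ^+ 2 by ring.
rewrite lerD2r lerD2l (le_trans (add_conj_le _)) //.
by rewrite -[X in _ <= X]mulr_natl ler_pM2l ?ltr0n // hnorm_cauchy_schwarz.
Qed.

Lemma hnormZ (a : K) u : H u -> N (a *: u) = `|a| * N u.
Proof.
move=> hu; apply/eqP; rewrite -(@eqrXn2 _ 2) ?N_ge0 ?mulr_ge0 ?N_ge0 //; last exact: HZ.
by rewrite N2 ipZl ?ipZr //; [rewrite exprMn N2 normCK mulrA | exact: HZ].
Qed.

Let N0 : N 0 = 0.
Proof. by rewrite /hnorm ip0 // sqrtC0. Qed.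

Let small0 (x c : K) : 0 <= c -> (forall e, 0 < e -> `|x| <= c * e) -> x = 0.
Proof.
move=> c0 h; apply/eqP; apply: contraT => xn0.
have xp : 0 < `|x| by rewrite normr_gt0.
have c1 : 0 < c + 1 by rewrite ltr_wpDl.
have := h (`|x| / (c + 1) / 2).
rewrite !divr_gt0 // => /(_ isT).
have -> : c * (`|x| / (c + 1) / 2) = c * `|x| / ((c + 1) * 2) by rewrite invfM; ring.
rewrite ler_pdivlMr ?mulr_gt0 // => hh.
have : `|x| * ((c + 1) * 2) - c * `|x| <= 0 by rewrite subr_le0.
have -> : `|x| * ((c + 1) * 2) - c * `|x| = `|x| * (c + 2) by ring.
by rewrite pmulr_rle0 // => /(lt_le_trans (ltr_wpDl c0 (ltr0n _ 2))); rewrite ltxx.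
Qed.

Let N0_ip u v : H u -> H v -> N u = 0 -> ip u v = 0.
Proof.
move=> hu hv hN; apply/eqP; rewrite -normr_le0.
by rewrite (le_trans (hnorm_cauchy_schwarz hu hv)) // hN mul0r.
Qed.

Variables G G0 : set (V * V).
Hypothesis GH : forall f g, G (f, g) -> H f /\ H g.
Hypothesis G_0 : G (0, 0).
Hypothesis GP : forall (a : K) f1 g1 f2 g2, G (f1, g1) -> G (f2, g2) ->
  G (a *: f1 + f2, a *: g1 + g2).
Hypothesis Gdense : densely_defined H ip G.
Hypothesis Gsym : symmetric_operator ip G.
Hypothesis G0G : G0 `<=` G.
Hypothesis G0_ge0 : forall f g, G0 (f, g) -> 0 <= ip f g + ip g f.
Hypothesis G0_range : forall u, H u -> forall e : K, 0 < e ->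
  exists f g, G0 (f, g) /\ N (u - (f + g)) < e.

(** Approximating [g] itself from the domain gives [|g|^2 = <g - f1, g> <= |g - f1| |g|], impossible
    for a close [f1] unless [|g| = 0]. *)
Let orth_dense g : H g -> (forall f1 g1, G (f1, g1) -> ip f1 g = 0) -> N g = 0.
Proof.
move=> hg h; apply: contrapT => /eqP Nn0.
have Np : 0 < N g by rewrite lt_neqAle eq_sym Nn0 N_ge0.
have [f1 [g1 [Gf hf]]] := Gdense hg Np.
have [h1 _] := GH Gf.
have : N g ^+ 2 <= N (g - f1) * N g.
  rewrite N2 -(ger0_norm (ip_ge0 hg)).
  have -> : ip g g = ip (g - f1) g by rewrite ipBl // (h _ _ Gf) subr0.
  by apply: hnorm_cauchy_schwarz => //; apply: HB.
rewrite expr2 ler_pM2r // => /(lt_le_trans hf).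
by rewrite ltxx.
Qed.

Local Notation Gc := (graph_closure H ip G).

(** Symmetry places [G] inside its adjoint, and the relations defining the adjoint survive limits in
    norm. *)
Let closure_adjoint : Gc `<=` graph_adjoint H ip G.
Proof.
move=> [p q] [/= hp hq hc]; split=> //= f g Gf.
have [hf hg] := GH Gf.
apply/eqP; rewrite -subr_eq0; apply/eqP.
apply: (@small0 _ (N g + N f)) => [|e e0]; first by rewrite addr_ge0 ?N_ge0.
have [f' [g' [Gf' h1 h2]]] := hc e e0; have [hf' hg'] := GH Gf'.
have -> : ip g p - ip f q = ip g (p - f') - ip f (q - g').
  by rewrite !ipBr // (Gsym Gf Gf'); ring.
rewrite (le_trans (ler_normB _ _)) // mulrDl lerD //.
  rewrite (le_trans (hnorm_cauchy_schwarz hg (HB hp hf'))) //.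
  by rewrite ler_wpM2l ?N_ge0 // ltW.
rewrite (le_trans (hnorm_cauchy_schwarz hf (HB hq hg'))) //.
by rewrite ler_wpM2l ?N_ge0 // ltW.
Qed.

Let sub_closure : G `<=` Gc.
Proof.
move=> [p q] Gp; have [hp hq] := GH Gp; split => //= e e0.
by exists p, q; rewrite !subrr N0.
Qed.

(** For [(p, q)] in the adjoint choose [(f, g)] in [G0] with [f + g] close to [p + q]. Symmetry
    gives [<f' + g', p - f> = <f', (p - f) + (q - g)>] for [(f', g')] in [G0]. Letting [f' + g']
    approach [p - f] bounds [|p - f|^2] by about [|f'|] times the error, and positivity gives
    [|f'| <= |f' + g'|], which is about [|p - f|]. So [p - f] is as small as the error, and then so
    is [q - g] up to a factor 2. *)
Let adjoint_closure_sub : graph_adjoint H ip Gc `<=` Gc.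
Proof.
move=> [p q] [/= hp hq hadj].
have hG f g : G (f, g) -> ip g p = ip f q by move=> /sub_closure; apply: hadj.
split => //= e e0.
pose d := e / 4; have d0 : 0 < d by rewrite divr_gt0.
have [f [g [G0f hfg]]] := G0_range (HD hp hq) d0.
have Gf := G0G G0f; have [hf hg] := GH Gf.
have hp' := HB hp hf; have hq' := HB hq hg.
have hs : N ((p - f) + (q - g)) < d by rewrite addrACA -opprD.
have hpq := HD hp' hq'.
have Np : N (p - f) <= d.
  have nR : N (p - f) \is Num.real by rewrite realE N_ge0.
  have dR : d \is Num.real by rewrite realE ltW.
  rewrite real_leNgt //; apply/negP => dn.
  set n := N (p - f) in dn nR *.
  have n0 : 0 < n by apply: lt_trans d0 dn.
  (* Chosen so that [n^2 - (e' n + (n + e') d)] equals [n (n - d) / 2], still positive, against the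
     estimate derived below. *)
  pose e' := n * (n - d) / (2 * (n + d)).
  have nd0 : 0 < n - d by rewrite subr_gt0.
  have nd1 : 0 < n + d by rewrite addr_gt0.
  have e'0 : 0 < e' by rewrite divr_gt0 ?mulr_gt0.
  have [f' [g' [G0f' hfg']]] := G0_range hp' e'0.
  have Gf' := G0G G0f'; have [hf' hg'] := GH Gf'.
  have hs' := HD hf' hg'.
  have key : ip (f' + g') (p - f) = ip f' (p - f + (q - g)).
    by rewrite ipDl // (ipDr hp') // !(ipBr _ _ hg') // (ipBr hq) // (hG _ _ Gf')
      (Gsym Gf' Gf).
  (* Positivity on [G0]: in the expansion of [|f' + g'|^2] the cross terms are nonnegative. *)
  have Nf' : N f' <= N (f' + g').
    rewrite -(ler_pXn2r (_ : 0 < 2)%N) ?nnegrE ?N_ge0 //.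
    rewrite !N2 ipDl // !ipDr //.
    have -> : ip f' f' + ip f' g' + (ip g' f' + ip g' g') =
      ip f' f' + ((ip f' g' + ip g' f') + ip g' g') by ring.
    by rewrite lerDl addr_ge0 ?G0_ge0 ?ip_ge0.
  have Nfg : N (f' + g') <= n + e'.
    have -> : f' + g' = (p - f) + (-1) *: ((p - f) - (f' + g')).
      by rewrite scaleN1r opprB addrCA subrr addr0.
    rewrite (le_trans (hnormD_le _ _)) ?hnormZ ?normrN1 ?mul1r //; do ?[exact: HB | by apply: HZ; apply: HB].
    by rewrite lerD2l ltW.
  have : n ^+ 2 <= e' * n + (n + e') * d.
    rewrite /n N2 -(ger0_norm (ip_ge0 hp')).
    have -> : ip (p - f) (p - f) = ip (p - f - (f' + g')) (p - f) + ip f' (p - f + (q - g)).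
      by rewrite [in RHS]ipBl // key subrK.
    rewrite (le_trans (ler_normD _ _)) // lerD //.
      rewrite (le_trans (hnorm_cauchy_schwarz (HB hp' hs') hp')) //.
      by rewrite ler_wpM2r ?N_ge0 // ltW.
    rewrite (le_trans (hnorm_cauchy_schwarz hf' hpq)) //.
    by rewrite ler_pM ?N_ge0 // ?(le_trans Nf') // ltW.
  rewrite -subr_le0.
  have -> : n ^+ 2 - (e' * n + (n + e') * d) = n * (n - d) / 2.
    by rewrite /e'; field; rewrite gt_eqF.
  move=> /(lt_le_trans (divr_gt0 (mulr_gt0 n0 nd0) (ltr0n _ 2))).
  by rewrite ltxx.
have de : d < e by rewrite ltr_pdivrMr // ltr_pMr // ltr1n.
exists f, g; split=> //; first exact: le_lt_trans Np de.
have -> : q - g = (p - f + (q - g)) + (-1) *: (p - f).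
  by rewrite scaleN1r addrAC subrr add0r.
rewrite (le_lt_trans (hnormD_le hpq (HZ _ hp'))) // hnormZ // normrN1 mul1r.
rewrite (lt_le_trans (ltr_leD hs Np)) // /d.
have -> : e / 4 + e / 4 = e / 2 by field.
by rewrite ler_pdivrMr // ler_pMr // ler1n.
Qed.

Let closure_operator : linear_operator H ip Gc.
Proof.
split.
- by move=> f g [].
- exact: sub_closure.
- move=> a f1 g1 f2 g2 [/= hf1 hg1 h1] [/= hf2 hg2 h2].
  split; do ?exact: HP.
  move=> e e0.
  have a1 : 0 < `|a| + 1 by rewrite ltr_wpDl.
  have e1 : 0 < e / (`|a| + 1) by rewrite divr_gt0.
  have [u1 [v1 [G1 k1 l1]]] := h1 _ (divr_gt0 e1 (ltr0n _ 2)).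
  have [u2 [v2 [G2 k2 l2]]] := h2 _ (divr_gt0 e1 (ltr0n _ 2)).
  have [? ?] := GH G1; have [? ?] := GH G2.
  have aux x y x' y' : H x -> H y -> H x' -> H y' ->
    N (x - x') < e / (`|a| + 1) / 2 -> N (y - y') < e / (`|a| + 1) / 2 ->
    N (a *: x + y - (a *: x' + y')) < e.
    move=> hx hy hx' hy' k l.
    have -> : a *: x + y - (a *: x' + y') = a *: (x - x') + (y - y').
      by rewrite scalerBr opprD addrACA.
    rewrite (le_lt_trans (hnormD_le _ _)) ?hnormZ //; do ?[exact: HB | by apply: HZ; apply: HB].
    rewrite (le_lt_trans (_ : _ <= `|a| * (e / (`|a| + 1) / 2) + e / (`|a| + 1) / 2)) //.
      by rewrite lerD // ?ler_wpM2l // ltW.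
    have -> : `|a| * (e / (`|a| + 1) / 2) + e / (`|a| + 1) / 2 = e / 2.
      by field; rewrite gt_eqF.
    by rewrite ltr_pdivrMr // ltr_pMr // ltr1n.
  by exists (a *: u1 + u2), (a *: v1 + v2); split; [exact: GP | exact: aux | exact: aux].
(* If the first component of a pair in the closure is null, the second is orthogonal to the dense
   domain of [G]. *)
- move=> f g Gf Nf; have [/= hf hg _] := Gf; have [/= _ _ h] := closure_adjoint Gf.
  apply: orth_dense => // f1 g1 G1; have [hf1 hg1] := GH G1.
  by rewrite -(h _ _ G1) ipC // (N0_ip hf hg1 Nf) conjC0.
Qed.

(** Density of the range of [1 + L] on a nonnegative part, a condition at the single real point
    [-1], takes the place of the two deficiency conditions at [i] and [-i]. Since positivity and
    range concern the same subspace [G0], explicit test functions suffice. *)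
Lemma essentially_self_adjoint_of_range : essentially_self_adjoint H ip G.
Proof.
split=> //; first (split=> //).
  move=> f g Gf Nf; have [_ _ _ h4] := closure_operator.
  exact: h4 (sub_closure Gf) Nf.
split; first exact: closure_operator.
  move=> u hu e e0; have [f [g [Gf hf]]] := Gdense hu e0.
  by exists f, g; split=> //; apply: sub_closure.
apply/seteqP; split; first exact: adjoint_closure_sub.
move=> [p q] Gp; have [/= hp hq hc] := Gp.
split=> //= f g Gf; have [/= hf hg hcf] := Gf.
have [_ _ /= hadj] := closure_adjoint Gp.
apply/eqP; rewrite -subr_eq0; apply/eqP.
apply: (@small0 _ (N p + N q)) => [|e e0]; first by rewrite addr_ge0 ?N_ge0.
have [f' [g' [Gf' h1 h2]]] := hcf e e0; have [hf' hg'] := GH Gf'.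
(* Second passage to the limit: [(p, q)] is already adjoint to [G], and now [(f, g)] is approximated
   from [G]. *)
have -> : ip g p - ip f q = ip (g - g') p - ip (f - f') q.
  by rewrite !ipBl // (hadj _ _ Gf'); ring.
rewrite (le_trans (ler_normB _ _)) // mulrDl lerD // mulrC.
  rewrite (le_trans (hnorm_cauchy_schwarz (HB hg hg') hp)) //.
  by rewrite ler_wpM2r ?N_ge0 // ltW.
rewrite (le_trans (hnorm_cauchy_schwarz (HB hf hf') hq)) //.
by rewrite ler_wpM2r ?N_ge0 // ltW.
Qed.

End EssentialSelfAdjointness.

(** * Complex integrals and the weighted L2 space *)

Local Open Scope complex_scope.

Section ComplexIntegral.
Variable R : realType.
Local Notation C := R[i].
Local Notation mu := (@lebesgue_measure R).

Lemma normc_ge0 (z : C) : 0 <= normc z.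
Proof. by case: z => x y /=; exact: sqrtr_ge0. Qed.

Lemma sqr_normc_ReIm (z : C) : normc z ^+ 2 = complex.Re z ^+ 2 + complex.Im z ^+ 2.
Proof. by case: z => x y /=; rewrite sqr_sqrtr // addr_ge0 ?sqr_ge0. Qed.

Lemma normc_lerRe (z : C) : `|complex.Re z| <= normc z.
Proof.
case: z => x y /=; rewrite -sqrtr_sqr ler_wsqrtr //.
by rewrite lerDl sqr_ge0.
Qed.

Lemma normc_lerIm (z : C) : `|complex.Im z| <= normc z.
Proof.
case: z => x y /=; rewrite -sqrtr_sqr ler_wsqrtr //.
by rewrite lerDr sqr_ge0.
Qed.

Lemma normc_ler_ReIm (z : C) : normc z <= `|complex.Re z| + `|complex.Im z|.
Proof.
rewrite -(ler_pXn2r (_ : 0 < 2)%N) ?nnegrE ?addr_ge0 ?normc_ge0 //.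
rewrite sqr_normc_ReIm sqrrD !real_normK ?num_real //.
by rewrite -addrA lerD2l lerDr mulrn_wge0 // mulr_ge0.
Qed.

Lemma normc_normr (z : C) : `|z| = (normc z)%:C.
Proof. by []. Qed.

Lemma normc_real (x : R) : normc x%:C = `|x|.
Proof. by rewrite /= expr0n addr0 sqrtr_sqr. Qed.

Lemma normc_conj (z : C) : normc z^* = normc z.
Proof. by case: z => x y /=; rewrite sqrrN. Qed.

Lemma normc_i : normc 'i%C = 1 :> R.
Proof. by rewrite /= expr0n expr1n add0r sqrtr1. Qed.

Definition cmeasurable (h : R -> C) :=
  measurable_fun setT (fun x => complex.Re (h x)) /\
  measurable_fun setT (fun x => complex.Im (h x)).

Definition cintegrable (h : R -> C) :=
  mu.-integrable setT (EFin \o (fun x => complex.Re (h x))) /\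
  mu.-integrable setT (EFin \o (fun x => complex.Im (h x))).

Lemma Re_mul (x y : C) : complex.Re (x * y) =
  complex.Re x * complex.Re y - complex.Im x * complex.Im y.
Proof. by case: x y => [a b] [c d]. Qed.
Lemma Im_mul (x y : C) : complex.Im (x * y) =
  complex.Re x * complex.Im y + complex.Im x * complex.Re y.
Proof. by case: x y => [a b] [c d]. Qed.
Lemma Re_add (x y : C) : complex.Re (x + y) = complex.Re x + complex.Re y.
Proof. by case: x y => [a b] [c d]. Qed.
Lemma Im_add (x y : C) : complex.Im (x + y) = complex.Im x + complex.Im y.
Proof. by case: x y => [a b] [c d]. Qed.

Lemma cmeasurableD f g : cmeasurable f -> cmeasurable g ->
  cmeasurable (fun x => f x + g x).
Proof.
move=> [f1 f2] [g1 g2]; split.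
  by under eq_fun do rewrite Re_add; exact: measurable_funD.
by under eq_fun do rewrite Im_add; exact: measurable_funD.
Qed.

Lemma cmeasurableM f g : cmeasurable f -> cmeasurable g ->
  cmeasurable (fun x => f x * g x).
Proof.
move=> [f1 f2] [g1 g2]; split.
  by under eq_fun do rewrite Re_mul; apply: measurable_funB; apply: measurable_funM.
by under eq_fun do rewrite Im_mul; apply: measurable_funD; apply: measurable_funM.
Qed.

Lemma cmeasurable_real (f : R -> R) : measurable_fun setT f ->
  cmeasurable (fun x => (f x)%:C).
Proof. by move=> hf; split => //=; exact: measurable_cst. Qed.

Lemma cmeasurable_cst (c : C) : cmeasurable (fun=> c).
Proof. by split; exact: measurable_cst. Qed.

Lemma cmeasurable_conj f : cmeasurable f -> cmeasurable (fun x => (f x)^*).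
Proof.
move=> [f1 f2]; split.
  by rewrite (_ : (fun x => _) = (fun x => complex.Re (f x))) //; apply/funext => x; case: (f x).
rewrite (_ : (fun x => _) = (fun x => - complex.Im (f x))); first exact: measurableT_comp.
by apply/funext => x; case: (f x).
Qed.

Lemma cmeasurable_normc f : cmeasurable f -> measurable_fun setT (fun x => normc (f x)).
Proof.
move=> [f1 f2].
rewrite (_ : (fun x => _) = (fun x => Num.sqrt (complex.Re (f x) ^+ 2 + complex.Im (f x) ^+ 2))).
  apply: (measurableT_comp (continuous_measurable_fun (@sqrt_continuous R))) => //.
  by apply: measurable_funD; exact: measurable_funX.
by apply/funext => x; case: (f x).
Qed.

Lemma integrable_dom (f g : R -> R) : measurable_fun setT f ->
  mu.-integrable setT (EFin \o g) -> (forall x, `|f x| <= g x) ->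
  mu.-integrable setT (EFin \o f).
Proof.
move=> mf ig h; apply: (le_integrable _ _ _ ig) => //.
  exact/measurable_EFinP.
by move=> x _ /=; rewrite lee_fin (le_trans (h x)) // ler_norm.
Qed.

Lemma cintegrable_dom h (g : R -> R) : cmeasurable h ->
  mu.-integrable setT (EFin \o g) -> (forall x, normc (h x) <= g x) ->
  cintegrable h.
Proof.
move=> [h1 h2] ig hg; split; apply: integrable_dom ig _ => // x.
  exact: le_trans (normc_lerRe _) (hg x).
exact: le_trans (normc_lerIm _) (hg x).
Qed.

Lemma eq_cintegral (f g : R -> C) : (forall x, f x = g x) -> cintegral f = cintegral g.
Proof. by move=> /funext ->. Qed.

Lemma cintegrableD f g : cintegrable f -> cintegrable g ->
  cintegrable (fun x => f x + g x).
Proof.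
move=> [f1 f2] [g1 g2]; split.
  rewrite (_ : _ \o _ = (EFin \o (fun x => complex.Re (f x))) \+ (EFin \o (fun x => complex.Re (g x))))%E.
    exact: integrableD.
  by apply/funext => x /=; rewrite Re_add EFinD.
rewrite (_ : _ \o _ = (EFin \o (fun x => complex.Im (f x))) \+ (EFin \o (fun x => complex.Im (g x))))%E.
  exact: integrableD.
by apply/funext => x /=; rewrite Im_add EFinD.
Qed.

Lemma integrable_lin (f g : R -> R) (a b : R) : mu.-integrable setT (EFin \o f) ->
  mu.-integrable setT (EFin \o g) ->
  mu.-integrable setT (EFin \o (fun x => a * f x + b * g x)).
Proof.
move=> hf hg.
rewrite (_ : _ \o _ = (fun x => a%:E * (EFin \o f) x) \+ (fun x => b%:E * (EFin \o g) x))%E.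
  by apply: integrableD => //; exact: integrableZl.
by apply/funext => x /=; rewrite EFinD !EFinM.
Qed.

Lemma Rintegral_lin (f g : R -> R) (a b : R) : mu.-integrable setT (EFin \o f) ->
  mu.-integrable setT (EFin \o g) ->
  \int[mu]_x (a * f x + b * g x) = a * \int[mu]_x f x + b * \int[mu]_x g x.
Proof.
move=> hf hg; rewrite RintegralD //; last 2 first.
- by have := integrableZl measurableT a hf.
- by have := integrableZl measurableT b hg.
by rewrite !RintegralZl.
Qed.

Lemma cintegrableZ (c : C) f : cintegrable f -> cintegrable (fun x => c * f x).
Proof.
case: c => a b [f1 f2]; split.
  rewrite (_ : _ \o _ = EFin \o (fun x => a * complex.Re (f x) + (- b) * complex.Im (f x))).
    exact: integrable_lin.
  by apply/funext => x /=; rewrite Re_mul /= mulNr.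
rewrite (_ : _ \o _ = EFin \o (fun x => a * complex.Im (f x) + b * complex.Re (f x))).
  exact: integrable_lin.
by apply/funext => x /=; rewrite Im_mul.
Qed.

Lemma cintegralZ (c : C) f : cintegrable f ->
  cintegral (fun x => c * f x) = c * cintegral f.
Proof.
case: c => a b [f1 f2]; apply/eqP; rewrite eq_complex; apply/andP; split; apply/eqP.
  rewrite Re_mul /= -mulNr -Rintegral_lin //.
  by apply: eq_Rintegral => x _; rewrite Re_mul /= mulNr.
rewrite Im_mul /= -Rintegral_lin //.
by apply: eq_Rintegral => x _; rewrite Im_mul.
Qed.

Lemma cintegralD f g : cintegrable f -> cintegrable g ->
  cintegral (fun x => f x + g x) = cintegral f + cintegral g.
Proof.
move=> [f1 f2] [g1 g2]; apply/eqP; rewrite eq_complex; apply/andP; split; apply/eqP.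
  by rewrite Re_add /= -RintegralD //; apply: eq_Rintegral => x _; rewrite Re_add.
by rewrite Im_add /= -RintegralD //; apply: eq_Rintegral => x _; rewrite Im_add.
Qed.

Lemma cintegralB f g : cintegrable f -> cintegrable g ->
  cintegral (fun x => f x - g x) = cintegral f - cintegral g.
Proof.
move=> hf hg.
rewrite (_ : (fun x => _) = (fun x => f x + (-1) * g x)).
  by rewrite cintegralD ?cintegralZ ?mulN1r //; exact: cintegrableZ.
by apply/funext => x; rewrite mulN1r.
Qed.

Lemma cintegral_conj f : cintegrable f ->
  cintegral (fun x => (f x)^*) = (cintegral f)^*.
Proof.
move=> [f1 f2]; apply/eqP; rewrite eq_complex /=; apply/andP; split; apply/eqP.
  by apply: eq_Rintegral => x _; case: (f x).
rewrite -mulN1r -RintegralZl //.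
by apply: eq_Rintegral => x _; case: (f x) => a b /=; rewrite mulN1r.
Qed.

Lemma cintegral_real (f : R -> R) :
  cintegral (fun x => (f x)%:C) = (\int[mu]_x f x)%:C.
Proof. by rewrite /cintegral /=; congr (_ +i* _); rewrite Rintegral_cst // mul0r. Qed.

Lemma ge0_integral_opp (f : R -> \bar R) : measurable_fun setT f -> (forall x, 0 <= f x)%E ->
  (\int[mu]_x f (- x)%R = \int[mu]_x f x)%E.
Proof.
move=> mf f0.
transitivity (\int[pushforward mu (-%R : R -> measurableTypeR R)]_x f x)%E.
  by rewrite ge0_integral_pushforward.
by apply: eq_measure_integral => A mA _; exact: lebesgue_measureN.
Qed.

Lemma Rintegral_opp (f : R -> R) : mu.-integrable setT (EFin \o f) ->
  \int[mu]_x f (- x) = \int[mu]_x f x.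
Proof.
move=> hf; rewrite /Rintegral; congr fine.
have /integrableP[mf _] := hf.
rewrite integralE [RHS]integralE; congr (_ - _)%E.
  rewrite -[RHS]ge0_integral_opp //; last exact: measurable_funepos.
  by apply: eq_integral => x _; rewrite !funeposE.
rewrite -[RHS]ge0_integral_opp //; last exact: measurable_funeneg.
by apply: eq_integral => x _; rewrite !funenegE.
Qed.

Lemma cintegral_opp f : cintegrable f -> cintegral (fun x => f (- x)) = cintegral f.
Proof. by move=> [f1 f2]; rewrite /cintegral !(Rintegral_opp f1, Rintegral_opp f2). Qed.

Lemma Rintegral_dct (f_ : nat -> R -> R) (f g : R -> R) :
  (forall n, measurable_fun setT (f_ n)) ->
  (forall x, f_ n x @[n --> \oo] --> f x) ->
  mu.-integrable setT (EFin \o g) -> (forall n x, `|f_ n x| <= g x) ->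
  mu.-integrable setT (EFin \o f) /\
  \int[mu]_x f_ n x @[n --> \oo] --> \int[mu]_x f x.
Proof.
move=> mf hf ig hg.
have mff : measurable_fun setT f.
  by apply: (measurable_fun_cvg mf) => x _; exact: hf.
have := @dominated_convergence _ _ _ mu setT measurableT (fun n => EFin \o f_ n) (EFin \o f) (EFin \o g).
case=> //.
- by move=> n; apply/measurable_EFinP; exact: mf.
- by apply/measurable_EFinP; exact: mff.
- by apply/aeW => x _; apply: cvg_EFin; [exact: nearW | exact: hf].
- by apply/aeW => x n _ /=; rewrite lee_fin.
move=> h1 _ h3; split=> //.
rewrite /Rintegral; apply: fine_cvg.
by rewrite fineK ?integrable_fin_num.
Qed.

End ComplexIntegral.

(** * The weighted space as a semi-inner-product space *)

Section L2.
Variables (R : realType) (rho : R).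
Local Notation C := R[i].
Local Notation mu := (@lebesgue_measure R).
Local Notation W := (weight rho).
Local Notation L2 := (L2even rho).
Hypothesis mW : measurable_fun setT W.

Lemma weight_ge0 s : 0 <= W s.
Proof. by rewrite /weight sqr_ge0. Qed.

(** The squared norm as a real number and without the factor [(4 pi)^-1] of [inner]. Estimates are
    made on it; since that factor is at most 1, they pass to [hnorm]. *)
Definition nrm2 (v : R -> C^o) := \int[mu]_s (normc (v s) ^+ 2 * W s).

Lemma sqr_normcD (u v : C) : normc (u + v) ^+ 2 <= 2 * normc u ^+ 2 + 2 * normc v ^+ 2.
Proof.
apply: (@le_trans _ _ ((normc u + normc v) ^+ 2)).
  by rewrite ler_pXn2r ?nnegrE ?addr_ge0 ?normc_ge0 // le_normcD.
have := sqr_ge0 (normc u - normc v); nra.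
Qed.

Lemma L2_cmeasurable v : L2 v -> cmeasurable v.
Proof. by case. Qed.

Let abse_normW (v : R -> C) :
  (fun s : R => `|(EFin \o (fun s : R => (normc (v s) ^+ 2 * W s)%R)) s|)%E =
  (fun s : R => (normc (v s) ^+ 2 * W s)%:E).
Proof.
by apply/funext => s /=; rewrite ger0_norm // mulr_ge0 ?sqr_ge0 ?weight_ge0.
Qed.

Lemma L2_integrable v : L2 v ->
  mu.-integrable setT (EFin \o (fun s => normc (v s) ^+ 2 * W s)).
Proof.
move=> [m1 m2 _ h]; apply/integrableP; split.
  apply/measurable_EFinP; apply: measurable_funM => //.
  by apply: measurable_funX; exact: (@cmeasurable_normc _ v).
by move: h; rewrite -abse_normW.
Qed.

Lemma L2P v : cmeasurable v -> (forall s, v (- s) = v s) ->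
  mu.-integrable setT (EFin \o (fun s => normc (v s) ^+ 2 * W s)) -> L2 v.
Proof.
move=> [m1 m2] ev /integrableP[_ h]; split=> //.
by move: h; rewrite abse_normW.
Qed.

Lemma L2_dom v (g : R -> R) : cmeasurable v -> (forall s, v (- s) = v s) ->
  mu.-integrable setT (EFin \o g) -> (forall s, normc (v s) ^+ 2 * W s <= g s) -> L2 v.
Proof.
move=> mv ev ig h; apply: L2P => //; apply: integrable_dom ig _.
  by apply: measurable_funM => //; apply: measurable_funX; exact: cmeasurable_normc.
by move=> s; rewrite ger0_norm // mulr_ge0 ?sqr_ge0 ?weight_ge0.
Qed.

Lemma L2_lin (a : C) u v : L2 u -> L2 v -> L2 (a *: u + v : R -> C^o).
Proof.
move=> Lu Lv.
have mu_ := L2_cmeasurable Lu; have mv_ := L2_cmeasurable Lv.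
apply: (@L2_dom _ (fun s => 2 * normc a ^+ 2 * (normc (u s) ^+ 2 * W s) +
                         2 * (normc (v s) ^+ 2 * W s))).
- apply: (@cmeasurableD _ (fun s => a * u s) v) => //.
  by apply: (@cmeasurableM _ (fun=> a) u) => //; exact: cmeasurable_cst.
- move=> s; case: Lu => _ _ eu _; case: Lv => _ _ ev _.
  by rewrite !fctE /= eu ev.
- by apply: integrable_lin; exact: L2_integrable.
move=> s.
have h : normc ((a *: u + v : R -> C^o) s) ^+ 2 <= 2 * (normc a * normc (u s)) ^+ 2 + 2 * normc (v s) ^+ 2.
  by rewrite -normcM; exact: sqr_normcD.
rewrite (_ : _ + _ = (2 * (normc a * normc (u s)) ^+ 2 + 2 * normc (v s) ^+ 2) * W s).
  by rewrite ler_wpM2r ?weight_ge0.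
by rewrite exprMn; ring.
Qed.

Lemma L2_0 : L2 0.
Proof.
apply: (@L2_dom _ (fun=> 0)) => //.
  rewrite (_ : _ \o _ = cst 0%E) //; exact: integrable0.
by move=> s; rewrite /= expr0n addr0 sqrtr0 expr0n mul0r.
Qed.

Lemma L2_cintegrable u v : L2 u -> L2 v ->
  cintegrable (fun s => (u s : C) * (v s : C)^* * (W s)%:C).
Proof.
move=> Lu Lv.
apply: (@cintegrable_dom _ _ (fun s => 1 * (normc (u s) ^+ 2 * W s) + 1 * (normc (v s) ^+ 2 * W s))).
- apply: cmeasurableM; last exact: cmeasurable_real.
  by apply: cmeasurableM; [case: Lu | apply: cmeasurable_conj; case: Lv].
- by apply: integrable_lin; exact: L2_integrable.
move=> s; rewrite !mul1r !normcM normc_conj normc_real ger0_norm ?weight_ge0 //.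
have := weight_ge0 s; have := normc_ge0 (u s); have := normc_ge0 (v s).
have := sqr_ge0 (normc (u s) - normc (v s)); nra.
Qed.

Lemma inner_lin (a : C) u v w : L2 u -> L2 v -> L2 w ->
  inner rho (a *: u + v : R -> C^o) w = a * inner rho u w + inner rho v w.
Proof.
move=> Lu Lv Lw; rewrite /inner mulrCA -mulrDr; congr (_ * _).
rewrite -cintegralZ; last exact: L2_cintegrable.
rewrite -cintegralD; [|by apply: cintegrableZ; exact: L2_cintegrable|exact: L2_cintegrable].
by apply: eq_cintegral => s; rewrite !mulrA -!mulrDl.
Qed.

Lemma inner_conj u v : L2 u -> L2 v -> inner rho v u = (inner rho u v)^*%R.
Proof.
move=> Lu Lv; have -> : inner rho v u = ((4 * pi)^-1)%:C * cintegral (fun s => ((u s : C) * (v s : C)^* * (W s)%:C)^*).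
  rewrite /inner; congr (_ * _); apply: eq_cintegral => s.
  case: (u s) (v s) (W s) => [a b] [c d] x.
  by apply/eqP; rewrite eq_complex /=; apply/andP; split; apply/eqP; ring.
rewrite cintegral_conj; last exact: L2_cintegrable.
rewrite -[RHS]/(conjc (inner rho u v)) /inner [RHS](rmorphM (@conjc R)).
by congr (_ * _); rewrite /= oppr0.
Qed.

Lemma inner_nrm2 u : inner rho u u = ((4 * pi)^-1 * nrm2 u)%:C.
Proof.
rewrite /inner /nrm2 rmorphM /= -cintegral_real; congr (_ * _).
by apply: eq_cintegral => s; rewrite -sqr_normc normc_normr -rmorphXn -rmorphM.
Qed.

Lemma nrm2_ge0 u : 0 <= nrm2 u.
Proof. by apply: Rintegral_ge0 => s _; rewrite mulr_ge0 ?sqr_ge0 ?weight_ge0. Qed.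

Lemma inner_ge0 u : 0 <= inner rho u u.
Proof.
by rewrite inner_nrm2 ler0c mulr_ge0 ?nrm2_ge0 // invr_ge0 mulr_ge0 // pi_ge0.
Qed.

Lemma hnorm_lt u (e : R) : 0 < e -> nrm2 u < e ^+ 2 -> hnorm (@inner R rho) u < e%:C.
Proof.
move=> e0 h; rewrite -(@ltr_pXn2r _ 2) ?nnegrE //; last 2 first.
- by rewrite sqrtC_ge0 inner_ge0.
- by rewrite ler0c ltW.
rewrite /hnorm sqrtCK inner_nrm2 -rmorphXn /= ltcR.
apply: le_lt_trans h; rewrite -[leRHS]mul1r ler_wpM2r ?nrm2_ge0 // invf_le1.
  by have := @pi_ge2 R; lra.
by rewrite mulr_gt0 // pi_gt0.
Qed.

Lemma gtc0_real (e : C) : 0 < e -> exists2 r : R, 0 < r & e = r%:C.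
Proof.
case: e => a b; rewrite ltcE /= => /andP[/eqP -> a0].
by exists a.
Qed.

Lemma Gamma0 : Gamma (0 : C) = 0.
Proof.
rewrite /Gamma (_ : (fun n : nat => _) = (fun=> 0)).
  have h : (fun _ : nat => (0 : C^o)) @ \oo --> (0 : C^o) by exact: cvg_cst.
  exact: (cvg_lim (@norm_hausdorff _ _) h).
by apply/funext => n; rewrite big_ord_recl addr0 mul0r invr0 mulr0.
Qed.

(** Division by zero makes every Gauss quotient at the pole [0] equal to [0], and this gives the
    weight the value of its continuous extension. So the values of functions at [0], where [diff_op]
    is singular, drop out of every integrand pointwise. *)
Lemma weight0 : W 0 = 0.
Proof. by rewrite /weight (_ : 0%:C = 0) // !mulr0 Gamma0 invr0 mulr0 normc0 expr0n. Qed.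

Lemma inner_eq u u' v v' : (forall s, s != 0 -> u s = u' s) ->
  (forall s, s != 0 -> v s = v' s) -> inner rho u v = inner rho u' v'.
Proof.
move=> hu hv; rewrite /inner; congr (_ * _); apply: eq_cintegral => s.
have [->|s0] := eqVneq s 0; last by rewrite hu ?hv.
by rewrite weight0 !mulr0.
Qed.

End L2.

(** * Elementary real functions *)

Section RealCalculus.
Variable R : realType.
Local Notation mu := (@lebesgue_measure R).
Implicit Types (f g : R -> R) (x : R).

Lemma is_derive_add f g x a b : is_derive x 1 f a -> is_derive x 1 g b ->
  is_derive x 1 (fun y => f y + g y) (a + b).
Proof. by move=> hf hg; exact: is_deriveD. Qed.

Lemma is_derive_opp f x a : is_derive x 1 f a -> is_derive x 1 (fun y => - f y) (- a).
Proof. by move=> hf; exact: is_deriveN. Qed.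

Lemma is_derive_mul f g x a b : is_derive x 1 f a -> is_derive x 1 g b ->
  is_derive x 1 (fun y => f y * g y) (f x * b + g x * a).
Proof. by move=> hf hg; exact: is_deriveM. Qed.

Lemma is_derive_const (c : R) x : is_derive x 1 (fun _ : R => c) 0.
Proof. exact: is_derive_cst. Qed.

Lemma is_derive_exp f x a : is_derive x 1 f a ->
  is_derive x 1 (fun y => expR (f y)) (expR (f x) * a).
Proof. by move=> hf; exact: (@is_derive1_comp _ expR f). Qed.

Lemma is_derive_sinf f x a : is_derive x 1 f a ->
  is_derive x 1 (fun y => sin (f y)) (cos (f x) * a).
Proof. by move=> hf; exact: (@is_derive1_comp _ sin f). Qed.

Lemma is_derive_cosf f x a : is_derive x 1 f a ->
  is_derive x 1 (fun y => cos (f y)) (- sin (f x) * a).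
Proof. by move=> hf; exact: (@is_derive1_comp _ cos f). Qed.

Lemma is_derive_pow f x a n : is_derive x 1 f a ->
  is_derive x 1 (fun y => f y ^+ n) (n%:R * f x ^+ n.-1 * a).
Proof.
move=> hf; elim: n => [|n IH].
  by rewrite !mul0r; exact: is_derive_const.
have := is_derive_mul hf IH => h.
rewrite (_ : (fun y => _) = (fun y => f y * f y ^+ n)); last by apply/funext => y; rewrite exprS.
apply: (is_derive_eq h); case: n {IH h} => [|n] /=; first by rewrite !expr0; ring.
by rewrite !exprS -[in RHS](natr1 n.+1); ring.
Qed.

Lemma is_derive_var x : is_derive x 1 (fun y : R => y) 1.
Proof. exact: is_derive_id. Qed.

Lemma derive_continuous f (f' : R -> R) : (forall x, is_derive x 1 f (f' x)) -> continuous f.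
Proof. by move=> h x; apply: differentiable_continuous; apply/derivable1_diffP; exact: ex_derive. Qed.

Lemma sqr_absr x : `|x| ^+ 2 = x ^+ 2.
Proof. by rewrite real_normK ?num_real. Qed.

Lemma mvt0 f (f' : R -> R) (x K : R) : (forall y : R, is_derive y 1 f (f' y)) ->
  f 0 = 0 -> (forall y : R, `|y| <= `|x| -> `|f' y| <= K) -> `|f x| <= K * `|x|.
Proof.
move=> hf f0 hK; have cf := derive_continuous hf.
have cw a b : {within `[a, b], continuous f} by exact: continuous_subspaceT.
have [x0|x0] := leP 0 x.
  have [c] := @MVT_segment _ f f' 0 x x0 (fun y _ => hf y) (cw _ _).
  rewrite in_itv /= f0 !subr0 => /andP[c0 cx] ->.
  by rewrite normrM ler_wpM2r // hK // ger0_norm // ger0_norm.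
have [c] := @MVT_segment _ f f' x 0 (ltW x0) (fun y _ => hf y) (cw _ _).
rewrite in_itv /= f0 !sub0r => /andP[c0 cx] e.
rewrite -normrN e normrM normrN ler_wpM2r // hK // ler0_norm // ltr0_norm //.
by rewrite lerN2.
Qed.

Lemma integrable_continuous f (a b : R) : continuous f ->
  mu.-integrable `[a, b] (EFin \o f).
Proof.
by move=> cf; apply: continuous_compact_integrable;
  [exact: segment_compact | exact: continuous_subspaceT].
Qed.

Lemma Rintegral_FTC (F f : R -> R) (a b : R) : a <= b ->
  (forall x, is_derive x 1 F (f x)) -> continuous f ->
  \int[mu]_(x in `[a, b]) f x = F b - F a.
Proof.
rewrite le_eqVlt => /orP[/eqP <-|ab] hF cf.
  by rewrite set_itv1 Rintegral_set1 subrr.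
have cF := derive_continuous hF.
rewrite /Rintegral (@continuous_FTC2 _ f F) //.
- exact: continuous_subspaceT.
- split=> [x _||]; first exact: ex_derive.
  + by apply: cvg_at_right_filter; exact: cF.
  + by apply: cvg_at_left_filter; exact: cF.
by move=> x _; rewrite derive1E; exact: derive_val.
Qed.

Definition rcosh x : R := (expR x + expR (- x)) / 2.
Definition rsinh x : R := (expR x - expR (- x)) / 2.

Lemma is_derive_rcosh f x a : is_derive x 1 f a ->
  is_derive x 1 (fun y => rcosh (f y)) (rsinh (f x) * a).
Proof.
move=> hf; rewrite /rcosh /rsinh.
have h := is_derive_mul (is_derive_add (is_derive_exp hf) (is_derive_exp (is_derive_opp hf)))
  (is_derive_const 2^-1 x).
by apply: (is_derive_eq h); ring.
Qed.

Lemma is_derive_rsinh f x a : is_derive x 1 f a ->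
  is_derive x 1 (fun y => rsinh (f y)) (rcosh (f x) * a).
Proof.
move=> hf; rewrite /rcosh /rsinh.
have h := is_derive_mul (is_derive_add (is_derive_exp hf) (is_derive_opp (is_derive_exp (is_derive_opp hf))))
  (is_derive_const 2^-1 x).
by apply: (is_derive_eq h); ring.
Qed.

Lemma rcosh0 : rcosh 0 = 1.
Proof. by rewrite /rcosh oppr0 expR0; field. Qed.
Lemma rsinh0 : rsinh 0 = 0.
Proof. by rewrite /rsinh oppr0 expR0; field. Qed.
Lemma rcoshN x : rcosh (- x) = rcosh x.
Proof. by rewrite /rcosh opprK addrC. Qed.
Lemma rsinhN x : rsinh (- x) = - rsinh x.
Proof. by rewrite /rsinh opprK -mulNr opprB. Qed.
Lemma rcosh2Dsinh2 x : rcosh x ^+ 2 - rsinh x ^+ 2 = 1.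
Proof.
rewrite /rcosh /rsinh; have := expRxMexpNx_1 x.
set e := expR x; set e' := expR (- x) => h.
by transitivity (e * e'); [field | ].
Qed.
Lemma rcosh_ge1 x : 1 <= rcosh x.
Proof.
have h := rcosh2Dsinh2 x; have := sqr_ge0 (rsinh x) => h2.
have c0 : 0 < rcosh x by rewrite divr_gt0 // addr_gt0 // expR_gt0.
by nra.
Qed.
Lemma rcosh_le_exp x : rcosh x <= expR `|x|.
Proof.
rewrite /rcosh ler_pdivrMr // mulr_natr mulr2n lerD // ler_expR ?ler_norm //.
by rewrite -normrN ler_norm.
Qed.

(** The upper bound comes from [1 - x <= expR (- x)]: it gives [expR x * (1 - x) <= 1], and
    [1 - x >= 1/2]. *)
Lemma expR_taylor1 x : `|x| <= 2^-1 -> `|expR x - 1 - x| <= 2 * x ^+ 2.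
Proof.
move=> hx; have /andP[x1 x2] : - 2^-1 <= x <= 2^-1 by rewrite -ler_norml.
have h1 := expR_ge1Dx x; have h2 := expR_ge1Dx (- x).
have h3 := expRxMexpNx_1 x; have h4 := expR_gt0 x.
rewrite ger0_norm; last by lra.
have : expR x * (1 - x) <= 1 by rewrite -[leRHS]h3 ler_wpM2l // ltW.
have : 0 <= x ^+ 2 by exact: sqr_ge0.
nra.
Qed.

Lemma rcosh_sub1 x : `|x| <= 2^-1 -> `|rcosh x - 1| <= 2 * x ^+ 2.
Proof.
move=> hx; have := expR_taylor1 hx; have := @expR_taylor1 (- x).
rewrite normrN sqrrN => /(_ hx); rewrite /rcosh !ler_norml.
by move=> /andP[a b] /andP[c d]; apply/andP; split; lra.
Qed.

Lemma rsinh_subx x : `|x| <= 2^-1 -> `|rsinh x - x| <= 2 * `|x| ^+ 3.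
Proof.
move=> hx; have -> : 2 * `|x| ^+ 3 = (2 * x ^+ 2) * `|x| by rewrite -(sqr_absr x); ring.
apply: (@mvt0 (fun x => rsinh x - x) (fun x => rcosh x - 1)).
- move=> y; have h := is_derive_add (is_derive_rsinh (is_derive_var y)) (is_derive_opp (is_derive_var y)).
  by apply: (is_derive_eq h); rewrite mulr1.
- by rewrite rsinh0 subr0.
- move=> y hy; rewrite (le_trans (rcosh_sub1 (le_trans hy hx))) //.
  by rewrite ler_pM2l // -(sqr_absr y) -(sqr_absr x) ler_pXn2r ?nnegrE.
Qed.

Lemma sin_lex x : `|sin x| <= `|x|.
Proof.
rewrite -[leRHS]mul1r; apply: (@mvt0 sin cos) => //; last by move=> y _; exact: cos_max.
by rewrite sin0.
Qed.

Lemma cos_sub1 x : `|cos x - 1| <= x ^+ 2.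
Proof.
rewrite -(sqr_absr x) expr2.
apply: (@mvt0 (fun x => cos x - 1) (fun x => - sin x)).
- move=> y; have h := is_derive_add (is_derive_cosf (is_derive_var y)) (is_derive_const (-1) y).
  by apply: (is_derive_eq h); rewrite mulr1 addr0.
- by rewrite cos0 subrr.
- by move=> y hy; rewrite normrN (le_trans (sin_lex _)).
Qed.

Lemma sin_subx x : `|sin x - x| <= `|x| ^+ 3.
Proof.
rewrite exprSr; apply: (@mvt0 (fun x => sin x - x) (fun x => cos x - 1)).
- by rewrite sin0 subrr.
- by move=> y hy; rewrite (le_trans (cos_sub1 _)) // -(sqr_absr y) ler_pXn2r ?nnegrE.
Qed.

(** Wallis's integral with a hyperbolic factor. Its recursion in [n] produces the factors
    [1 + t^2 / n^2] of the infinite product for [rcosh (t * pi / 2)], so that partial products can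
    be compared with the full value without evaluating the infinite product. *)
Definition coshcos_int (n : nat) (t : R) : R :=
  \int[mu]_(x in `[0, pi / 2]) (rcosh (t * x) * cos x ^+ n).

Let is_derive_coshcos n t x : is_derive x 1
  (fun x => rcosh (t * x) * cos x ^+ n)
  (rcosh (t * x) * (n%:R * cos x ^+ n.-1 * - sin x) + cos x ^+ n * (rsinh (t * x) * t)).
Proof.
have h := is_derive_mul
  (is_derive_rcosh (is_derive_mul (is_derive_const t x) (is_derive_var x)))
  (is_derive_pow n (is_derive_cosf (is_derive_var x))).
by apply: (is_derive_eq h); ring.
Qed.

Let cont_coshcos n t : continuous (fun x => rcosh (t * x) * cos x ^+ n).
Proof. exact: derive_continuous (is_derive_coshcos n t). Qed.

Let int_coshcos n t : mu.-integrable `[0, pi / 2] (EFin \o (fun x => rcosh (t * x) * cos x ^+ n)).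
Proof. exact: integrable_continuous. Qed.

Lemma coshcos_int_rec n t :
  (n.+2%:R ^+ 2 + t ^+ 2) * coshcos_int n.+2 t = n.+2%:R * n.+1%:R * coshcos_int n t.
Proof.
(* The boundary terms of two integrations by parts; they vanish at both [0] and [pi / 2]. *)
pose F x := t * rsinh (t * x) * cos x ^+ n.+2 + n.+2%:R * rcosh (t * x) * (cos x ^+ n.+1 * sin x).
pose f x := (n.+2%:R ^+ 2 + t ^+ 2) * (rcosh (t * x) * cos x ^+ n.+2) +
   - (n.+2%:R * n.+1%:R) * (rcosh (t * x) * cos x ^+ n).
have hF x : is_derive x 1 F (f x).
  have htx := is_derive_mul (is_derive_const t x) (is_derive_var x).
  have hc := is_derive_cosf (is_derive_var x).
  have h := is_derive_add
    (is_derive_mul (is_derive_mul (is_derive_const t x) (is_derive_rsinh htx)) (is_derive_pow n.+2 hc))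
    (is_derive_mul (is_derive_mul (is_derive_const n.+2%:R x) (is_derive_rcosh htx))
       (is_derive_mul (is_derive_pow n.+1 hc) (is_derive_sinf (is_derive_var x)))).
  apply: (is_derive_eq h); rewrite /f /= !exprS.
  have := sin2cos2 x; rewrite !expr2 => hs.
  rewrite -(natr1 n.+1) -(natr1 n); set m : R := n%:R.
  set S := sin x in hs *; set c := cos x in hs *; set p := c ^+ n.
  set ch := rcosh _; set sh := rsinh _.
  have e : S * S = 1 - c * c by [].
  transitivity (ch * t * t * c * c * p + (m + 1 + 1) * ch * c * c * p
     - (m + 1 + 1) * (m + 1) * ch * p * (S * S)); [ring | rewrite e; ring].
have cf : continuous f.
  move=> x; apply: cvgD; apply: cvgM; do ?[exact: cvg_cst]; exact: cont_coshcos.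
have pih : (0 : R) <= pi / 2 by rewrite divr_ge0 // pi_ge0.
have := Rintegral_FTC pih hF cf.
rewrite /F cos_pihalf sin0 mulr0 rsinh0 !expr0n /= !(mul0r, mulr0) !addr0 subrr.
rewrite /f RintegralD //; last 2 first.
- have := integrableZl measurableT (n.+2%:R ^+ 2 + t ^+ 2).
  by move=> _; apply: integrable_continuous => x; apply: cvgM; [exact: cvg_cst | exact: cont_coshcos].
- by apply: integrable_continuous => x; apply: cvgM; [exact: cvg_cst | exact: cont_coshcos].
rewrite !RintegralZl // -!/(coshcos_int _ _) => /eqP.
by rewrite mulNr subr_eq0 => /eqP.
Qed.

Lemma coshcos_int1 t : (1 + t ^+ 2) * coshcos_int 1 t = rcosh (t * (pi / 2)).
Proof.
pose F x := t * rsinh (t * x) * cos x + rcosh (t * x) * sin x.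
pose f x := (1 + t ^+ 2) * (rcosh (t * x) * cos x ^+ 1).
have hF x : is_derive x 1 F (f x).
  have htx := is_derive_mul (is_derive_const t x) (is_derive_var x).
  have h := is_derive_add
    (is_derive_mul (is_derive_mul (is_derive_const t x) (is_derive_rsinh htx)) (is_derive_cosf (is_derive_var x)))
    (is_derive_mul (is_derive_rcosh htx) (is_derive_sinf (is_derive_var x))).
  by apply: (is_derive_eq h); rewrite /f; ring.
have cf : continuous f.
  by move=> x; apply: cvgM; [exact: cvg_cst | exact: cont_coshcos].
have pih : (0 : R) <= pi / 2 by rewrite divr_ge0 // pi_ge0.
have := Rintegral_FTC pih hF cf.
rewrite /f RintegralZl // -/(coshcos_int _ _) => ->.
by rewrite /F cos_pihalf sin_pihalf !mulr0 rsinh0 sin0; ring.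
Qed.

Lemma coshcos_int0_gt0 n : 0 < coshcos_int n.*2.+1 0.
Proof.
elim: n => [|n IH].
  have := coshcos_int1 0; rewrite expr0n addr0 !mul1r mul0r rcosh0 => ->.
  exact: ltr01.
have := coshcos_int_rec n.*2.+1 0; rewrite expr0n addr0 -doubleS => h.
have h0 : 0 < (n.*2.+3%:R : R) ^+ 2 * coshcos_int n.+1.*2.+1 0.
  by rewrite h !mulr_gt0 // ltr0n.
by move: h0; rewrite pmulr_rgt0 // exprn_gt0 // ltr0n.
Qed.

Lemma coshcos_int_ge n t : coshcos_int n 0 <= coshcos_int n t.
Proof.
apply: le_Rintegral => // x /=; rewrite in_itv /= => /andP[x0 x1].
rewrite mul0r rcosh0 ler_wpM2r ?rcosh_ge1 // exprn_ge0 // cos_ge0_pihalf // x1 andbT.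
by rewrite (le_trans _ x0) // oppr_le0 divr_ge0 // pi_ge0.
Qed.

(* The product is Wallis' recursion for the ratio of [coshcos_int] at [t] and at [0],
   a ratio that is at least 1. *)
Lemma prod_odd_le_cosh n t :
  \prod_(j < n.+1) (1 + t ^+ 2 / (j.*2.+1)%:R ^+ 2) <= rcosh (t * (pi / 2)).
Proof.
have key : \prod_(j < n.+1) (1 + t ^+ 2 / (j.*2.+1)%:R ^+ 2) * coshcos_int n.*2.+1 t =
   rcosh (t * (pi / 2)) * coshcos_int n.*2.+1 0.
  elim: n => [|n IH].
    have h0 := coshcos_int1 0; move: h0; rewrite expr0n addr0 mul1r mul0r rcosh0 => h0.
    by rewrite big_ord_recl big_ord0 /= expr1n mulr1 divr1 h0 mulr1 coshcos_int1.
  have h := coshcos_int_rec n.*2.+1 t; have h0 := coshcos_int_rec n.*2.+1 0.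
  rewrite big_ord_recr /= doubleS; set P := \prod_(_ < _) _ in IH *.
  set I := coshcos_int n.*2.+1 t in IH h *; set I' := coshcos_int n.*2.+3 t in h *.
  set J := coshcos_int n.*2.+1 0 in IH h0 *; set J' := coshcos_int n.*2.+3 0 in h0 *.
  set k : R := n.*2.+3%:R in h h0 *; set l : R := n.*2.+2%:R in h h0.
  have k0 : k != 0 by rewrite pnatr_eq0.
  have e1 : (1 + t ^+ 2 / k ^+ 2) * I' = l / k * I.
    have -> : (1 + t ^+ 2 / k ^+ 2) * I' = ((k ^+ 2 + t ^+ 2) * I') / k ^+ 2 by field.
    by rewrite h; field.
  have e2 : J' = l / k * J.
    have -> : J' = ((k ^+ 2 + 0 ^+ 2) * J') / k ^+ 2 by field.
    by rewrite h0; field.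
  by rewrite -mulrA e1 e2 mulrCA IH; ring.
have g0 := coshcos_int0_gt0 n.
have p0 : 0 <= \prod_(j < n.+1) (1 + t ^+ 2 / (j.*2.+1)%:R ^+ 2).
  apply: prodr_ge0 => j _.
  exact: addr_ge0 ler01 (divr_ge0 (sqr_ge0 t) (exprn_ge0 2 (ler0n _ _))).
rewrite -(ler_pM2r g0) -key; apply: (ler_wpM2l p0).
exact: (coshcos_int_ge n.*2.+1 t).
Qed.

End RealCalculus.

(** * Gauss's product for the Gamma function *)

Section ComplexExponential.
Variable R : realType.
Local Notation C := R[i].

Definition cexp (z : C) : C :=
  (expR (complex.Re z))%:C * (cos (complex.Im z) +i* sin (complex.Im z)).

Lemma cexpD (z w : C) : cexp (z + w) = cexp z * cexp w.
Proof.
case: z w => [a b] [c d]; rewrite /cexp /= expRD cosD sinD.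
by apply/eqP; rewrite eq_complex /=; apply/andP; split; apply/eqP; ring.
Qed.

Lemma normc_cexp (z : C) : normc (cexp z) = expR (complex.Re z).
Proof.
by rewrite /cexp normcM normc_real ger0_norm ?expR_ge0 //= cos2Dsin2 sqrtr1 mulr1.
Qed.

Lemma cexp_neq0 (z : C) : cexp z != 0.
Proof.
apply/eqP => h; have := normc_cexp z; rewrite h normc0 => /eqP.
by rewrite eq_sym expR_eq0.
Qed.

Lemma Re_sub (x y : C) : complex.Re (x - y) = complex.Re x - complex.Re y.
Proof. by case: x y => [a b] [c d]. Qed.
Lemma Im_sub (x y : C) : complex.Im (x - y) = complex.Im x - complex.Im y.
Proof. by case: x y => [a b] [c d]. Qed.

Lemma cexp_taylor1 (z : C) : normc z <= 2^-1 ->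
  normc (cexp z - 1 - z) <= 3 * normc z ^+ 2.
Proof.
move=> hz.
have hx := le_trans (normc_lerRe z) hz; have hy := le_trans (normc_lerIm z) hz.
rewrite sqr_normc_ReIm; apply: le_trans (normc_ler_ReIm _) _.
move: hx hy; case: z {hz} => x y /= hx hy.
rewrite !(mul0r, subr0, addr0).
have e1 : expR x * cos y - 1 - x = (expR x - 1 - x) * cos y + (1 + x) * (cos y - 1) by ring.
have e2 : expR x * sin y - y = (expR x - 1 - x + x) * sin y + (sin y - y) by ring.
rewrite e1 e2.
have t1 := expR_taylor1 hx; have t2 := cos_sub1 y; have t3 := sin_lex y.
have t4 := sin_subx y; have t5 := cos_max y.
have X : x ^+ 2 = `|x| ^+ 2 by rewrite sqr_absr.
have Y : y ^+ 2 = `|y| ^+ 2 by rewrite sqr_absr.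
set X' := `|x| in hx X *; set Y' := `|y| in hy Y t3 t4 *.
have X0 : 0 <= X' by exact: normr_ge0.
have Y0 : 0 <= Y' by exact: normr_ge0.
apply: (@le_trans _ _ ((2 * X' ^+ 2 * 1 + (1 + X') * Y' ^+ 2) +
   ((2 * X' ^+ 2 + X') * Y' + Y' ^+ 3))).
  apply: lerD.
    apply: le_trans (ler_normD _ _) _; apply: lerD; rewrite normrM.
      by rewrite ler_pM // -X.
    rewrite ler_pM // -?Y //; apply: le_trans (ler_normD _ _) _.
    by rewrite normr1.
  apply: le_trans (ler_normD _ _) _; apply: lerD => //; rewrite normrM.
  rewrite ler_pM //; apply: le_trans (ler_normD _ _) _.
  by rewrite lerD // -X.
rewrite X Y.
have h := sqr_ge0 (X' - Y').
have : Y' ^+ 3 <= 2^-1 * Y' ^+ 2 by rewrite exprS ler_wpM2r // sqr_ge0.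
have : X' ^+ 2 <= 2^-1 * X' by rewrite expr2 ler_wpM2r.
have : X' * Y' ^+ 2 <= 2^-1 * Y' ^+ 2 by rewrite ler_wpM2r // sqr_ge0.
have p1 : X' ^+ 2 * Y' <= 2^-1 * X' * Y'.
  by rewrite ler_wpM2r // expr2 ler_wpM2r.
by nra.
Qed.

Lemma natcpowE n (z : C) : natcpow n z = cexp (z * (ln n%:R)%:C).
Proof. by rewrite /natcpow /cexp; case: z => a b /=; rewrite !mulr0 subr0 add0r. Qed.

Lemma cvg_complex (u : nat -> C^o) (l : C) :
  complex.Re (u n) @[n --> \oo] --> complex.Re l ->
  complex.Im (u n) @[n --> \oo] --> complex.Im l ->
  u @ \oo --> (l : C^o).
Proof.
move=> h1 h2; apply/cvgrPdist_lt => e /gtc0_real[r r0 ->].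
have r2 : 0 < r / 2 by rewrite divr_gt0.
move/cvgrPdist_lt: h1 => /(_ _ r2) h1; move/cvgrPdist_lt: h2 => /(_ _ r2) h2.
near=> n; rewrite normc_normr ltcR.
apply: le_lt_trans (normc_ler_ReIm _) _; rewrite Re_sub Im_sub.
rewrite [ltRHS](splitr r) ltrD //; near: n; [exact: h1 | exact: h2].
Unshelve. all: by end_near.
Qed.

(** The hypothesis says that [v n + K / n] is nonincreasing and [v n - K / n] nondecreasing, so the
    first is bounded below and converges. *)
Lemma cvg_of_bounded_telescope (v : nat -> R) (K : R) (N : nat) : (0 < N)%N ->
  (forall n, (N <= n)%N -> `|v n.+1 - v n| <= K * (n%:R^-1 - n.+1%:R^-1)) ->
  cvgn v.
Proof.
move=> N0 hv.
pose w n := v (n + N)%N + K * (n + N)%:R^-1.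
have w_dec : nonincreasing_seq w.
  apply/nonincreasing_seqP => n; rewrite /w addSn.
  have := hv (n + N)%N (leq_addl _ _); rewrite ler_norml => /andP[_ h].
  have : v (n + N).+1 + K * (n + N).+1%:R^-1 <= v (n + N)%N + K * (n + N)%:R^-1.
    by move: h; set x := (n + N)%:R^-1; set y := _.+1%:R^-1; rewrite mulrBr; lra.
  exact.
have w_low n : v N - K * N%:R^-1 <= v (n + N)%N - K * (n + N)%:R^-1.
  elim: n => [|n IH]; first by rewrite add0n.
  rewrite addSn; have := hv (n + N)%N (leq_addl _ _).
  rewrite ler_norml => /andP[h _]; move: h IH.
  by set x := (n + N)%:R^-1; set y := _.+1%:R^-1; rewrite mulrBr; lra.
have inv_cvg : (n + N)%:R^-1 @[n --> \oo] --> (0 : R).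
  rewrite (_ : (fun n => _) = [sequence harmonic (n + N.-1)%N]_n).
    by rewrite cvg_shiftn; exact: cvg_harmonic.
  by apply/funext => n; rewrite /= -addnS prednK.
have K0 : 0 <= K.
  have := le_trans (normr_ge0 _) (hv N (leqnn N)).
  rewrite pmulr_lge0 // subr_gt0 ltf_pV2 ?posrE ?ltr0n // ltr_nat //.
have w_cvg : cvgn w.
  apply: nonincreasing_is_cvgn => //.
  exists (v N - K * N%:R^-1) => _ [n _ <-]; rewrite /w.
  have h : 0 <= K * (n + N)%:R^-1 by rewrite mulr_ge0 // invr_ge0.
  by have := w_low n; lra.
have : cvgn (fun n => v (n + N)%N).
  rewrite (_ : (fun n => _) = (fun n => w n - K * (n + N)%:R^-1)).
    apply: is_cvgB => //; apply/cvg_ex; exists (K * 0); apply: cvgM => //; exact: cvg_cst.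
  by apply/funext => n; rewrite /w addrK.
by move=> /cvg_ex[l hl]; apply/cvg_ex; exists l; rewrite -(cvg_shiftn N).
Qed.

(* The bound says [|u (n+1) / u n - 1| = O(1/n^2)], in telescoping form. *)
Lemma ratio_cvg (u : nat -> C) (c : R) (N : nat) : (0 < N)%N -> 0 <= c ->
  2 * c <= N%:R ->
  (forall n, (N <= n)%N ->
    normc (u n.+1 - u n) <= c * (n%:R^-1 - n.+1%:R^-1) * normc (u n)) ->
  u N != 0 ->
  exists l : C, [/\ l != 0, complex.Re (u n) @[n --> \oo] --> complex.Re l,
    complex.Im (u n) @[n --> \oo] --> complex.Im l &
    exists m M : R, 0 < m /\ forall n, (N <= n)%N -> m <= normc (u n) <= M].
Proof.
move=> N0 c0 cN hu uN.
have uN0 : 0 < normc (u N).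
  by rewrite lt_neqAle normc_ge0 andbT eq_sym; apply: contra uN => /eqP/eq0_normc ->.
have d0 n : (N <= n)%N -> 0 <= n%:R^-1 - n.+1%:R^-1 :> R.
  move=> Nn; rewrite subr_ge0 lef_pV2 ?posrE ?ltr0n ?ler_nat //.
  exact: leq_trans N0 Nn.
have up n : (N <= n)%N -> normc (u n) <= normc (u N) * expR (c * (N%:R^-1 - n%:R^-1)).
  move=> /subnK <-; elim: (n - N)%N => [|k IH]; first by rewrite add0n subrr mulr0 expR0 mulr1.
  rewrite addSn; set n' := (k + N)%N in IH *.
  have h := hu n' (leq_addl _ _).
  have : normc (u n'.+1) <= (1 + c * (n'%:R^-1 - n'.+1%:R^-1)) * normc (u n').
    rewrite -[u n'.+1](subrK (u n')) (le_trans (le_normcD _ _)) // mulrDl mul1r addrC.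
    by rewrite lerD2l.
  move=> /le_trans; apply.
  have -> : c * (N%:R^-1 - n'.+1%:R^-1) = c * (n'%:R^-1 - n'.+1%:R^-1) + c * (N%:R^-1 - n'%:R^-1).
    by ring.
  rewrite expRD mulrCA; apply: ler_pM => //; rewrite ?normc_ge0 ?expR_ge1Dx //.
  by rewrite addr_ge0 // mulr_ge0 // d0 // leq_addl.
have small n : (N <= n)%N -> c * (n%:R^-1 - n.+1%:R^-1) <= 2^-1.
  move=> Nn; have n0 : (0 : R) < n%:R by rewrite ltr0n (leq_trans N0).
  have hn : c * n%:R^-1 <= 2^-1.
    rewrite ler_pdivrMr // mulrC ler_pdivlMr // mulrC (le_trans cN) // ler_nat //.
  by rewrite mulrBr (le_trans _ hn) // gerBl mulr_ge0 // invr_ge0.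
have low n : (N <= n)%N -> normc (u N) * expR (- (2 * c) * (N%:R^-1 - n%:R^-1)) <= normc (u n).
  move=> /subnK <-; elim: (n - N)%N => [|k IH]; first by rewrite add0n subrr mulr0 expR0 mulr1.
  rewrite addSn; set n' := (k + N)%N in IH *.
  have Nn' : (N <= n')%N by exact: leq_addl.
  have h := hu n' Nn'; have s := small n' Nn'; have d := d0 n' Nn'.
  set e := c * _ in h s; have e0 : 0 <= e by rewrite mulr_ge0.
  have : (1 - e) * normc (u n') <= normc (u n'.+1).
    have : normc (u n') <= normc (u n'.+1) + normc (u n'.+1 - u n').
      rewrite -[normc (_ - _)]normcN opprB -[X in normc X <= _](subrKC (u n'.+1)).
      exact: le_normcD.
    by rewrite mulrBl mul1r; lra.
  apply: le_trans.
  have -> : - (2 * c) * (N%:R^-1 - n'.+1%:R^-1) = - (2 * e) + - (2 * c) * (N%:R^-1 - n'%:R^-1).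
    by rewrite /e; ring.
  rewrite expRD mulrCA ler_pM ?expR_ge0 ?mulr_ge0 ?normc_ge0 ?expR_ge0 //.
  (* Since [e <= 1/2], one has [expR (- (2 * e)) <= (1 + 2 * e)^-1 <= 1 - e]. This lower bound is
     what keeps the limit away from [0]. *)
  have h1 := expR_ge1Dx (2 * e); have h2 := expRxMexpNx_1 (2 * e).
  have h3 := expR_gt0 (- (2 * e)).
  have h4 : expR (- (2 * e)) * (1 + 2 * e) <= 1 by rewrite -[leRHS]h2 mulrC ler_wpM2r // ltW.
  have h5 : 1 <= (1 - e) * (1 + 2 * e) by nra.
  have h6 : 0 < 1 + 2 * e by lra.
  by rewrite -(ler_pM2r h6) (le_trans h4).
pose M := normc (u N) * expR (c * N%:R^-1).
pose m := normc (u N) * expR (- (2 * c) * N%:R^-1).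
have m0 : 0 < m by rewrite mulr_gt0 // expR_gt0.
have bd n : (N <= n)%N -> m <= normc (u n) <= M.
  move=> Nn; have ni : 0 <= n%:R^-1 :> R by rewrite invr_ge0.
  apply/andP; split.
    apply: le_trans (low n Nn); rewrite ler_pM2l // ler_expR mulrBr lerBrDr.
    by rewrite gerDl mulr_le0_ge0 // oppr_le0 mulr_ge0.
  apply: le_trans (up n Nn) _; rewrite ler_pM2l // ler_expR mulrBr gerBl.
  by rewrite mulr_ge0.
have tele n : (N <= n)%N -> normc (u n.+1 - u n) <= c * M * (n%:R^-1 - n.+1%:R^-1).
  move=> Nn; apply: le_trans (hu n Nn) _; rewrite mulrAC.
  by rewrite ler_wpM2r ?d0 // ler_wpM2l //; have /andP[] := bd n Nn.
have cr : cvgn (fun n => complex.Re (u n)).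
  apply: (@cvg_of_bounded_telescope _ (c * M) N) => // n Nn.
  by apply: le_trans (tele n Nn); rewrite -Re_sub; exact: normc_lerRe.
have ci : cvgn (fun n => complex.Im (u n)).
  apply: (@cvg_of_bounded_telescope _ (c * M) N) => // n Nn.
  by apply: le_trans (tele n Nn); rewrite -Im_sub; exact: normc_lerIm.
exists (limn (fun n => complex.Re (u n)) +i* limn (fun n => complex.Im (u n))); split => //.
  apply/eqP => -[h1 h2].
  have h3 : normc (u n) ^+ 2 @[n --> \oo] --> (0 : R).
    under eq_fun do rewrite sqr_normc_ReIm !expr2.
    rewrite (_ : 0 = 0 * 0 + 0 * 0); last by rewrite mul0r addr0.
    by rewrite -{1 2}h1 -h2; apply: cvgD; apply: cvgM.
  have : m ^+ 2 <= 0.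
    apply: (cvgr_to_ge h3); near=> n.
    have /andP[h _] : m <= normc (u n) <= M by apply: bd; near: n; exact: nbhs_infty_ge.
    by rewrite ler_pXn2r // nnegrE ?(ltW m0) ?normc_ge0.
  by rewrite leNgt exprn_gt0.
by exists m, M.
Unshelve. all: by end_near.
Qed.

End ComplexExponential.

(** * Convergence of Gauss's product away from the poles *)

Section GaussProduct.
Variable R : realType.
Local Notation C := R[i].

Definition gauss_prod (z : C) (n : nat) : C :=
  n`!%:R * natcpow n z / \prod_(k < n.+1) (z + k%:R).

Lemma normc_nat (n : nat) : normc (n%:R : C) = n%:R.
Proof. by rewrite -(rmorph_nat (real_complex R)) normc_real ger0_norm. Qed.

(** Successive terms have ratio [(1 + 1/n)^z (n + 1) / (z + n + 1) = 1 + O(1/n^2)], so the product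
    converges to a nonzero limit. The eventual two-sided bounds are recorded because the estimate of
    the weight must be uniform in [n]. *)
Lemma gauss_prod_cvg (z : C) : (forall k : nat, z + k%:R != 0) ->
  [/\ Gamma z != 0, complex.Re (gauss_prod z n) @[n --> \oo] --> complex.Re (Gamma z),
    complex.Im (gauss_prod z n) @[n --> \oo] --> complex.Im (Gamma z) &
    exists (N : nat) (m M : R), 0 < m /\
      forall n, (N <= n)%N -> m <= normc (gauss_prod z n) <= M].
Proof.
move=> hz.
pose A := normc z; have A0 : 0 <= A by exact: normc_ge0.
(* Half of [c] bounds the numerator below: [6 A^2] from the quadratic remainder of the exponential
   and [A] from [w - z / n.+1%:R]. The other factor 2 comes from [|z + n + 1| >= (n + 1) / 2]. *)
pose c := 12 * A ^+ 2 + 2 * A.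
have c0 : 0 <= c by rewrite addr_ge0 // mulr_ge0 // sqr_ge0.
pose N := (Num.truncn (2 * c + 4 * A + 1)).+1.
have NN : 2 * c + 4 * A + 1 <= N%:R by rewrite ltW // truncnS_gt.
have Pn0 n : \prod_(k < n) (z + k%:R) != 0 by apply/prodf_neq0 => k _; exact: hz.
have step n : (N <= n)%N -> normc (gauss_prod z n.+1 - gauss_prod z n) <=
   c * (n%:R^-1 - n.+1%:R^-1) * normc (gauss_prod z n).
  move=> Nn.
  have n0N : (0 < n)%N by exact: leq_trans Nn.
  have n0 : (0 : R) < n%:R by rewrite ltr0n.
  have nN : 4 * A + 1 <= n%:R by rewrite (@le_trans _ _ N%:R) ?ler_nat //; lra.
  have nS : (n.+1%:R : R) = n%:R + 1 by rewrite natr1.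
  pose d : R := ln n.+1%:R - ln n%:R.
  pose w : C := z * d%:C.
  have d1 : n.+1%:R^-1 <= d.
    have := @le_ln1Dx R (- n.+1%:R^-1).
    have -> : 1 + - n.+1%:R^-1 = n%:R / n.+1%:R :> R by rewrite nS; field; lra.
    rewrite ln_div ?posrE ?ltr0n // /d => h.
    have : -1 < - n.+1%:R^-1 :> R by rewrite ltrN2 invf_lt1 ?ltr0n // nS; lra.
    by move=> /h; rewrite -lerN2 opprB.
  have d2 : d <= n%:R^-1.
    have := @le_ln1Dx R (n%:R^-1).
    have -> : 1 + n%:R^-1 = n.+1%:R / n%:R :> R by rewrite nS; field; lra.
    rewrite ln_div ?posrE ?ltr0n // -/d; apply.
    by rewrite (@lt_le_trans _ _ 0) // invr_ge0.
  have zn : z + n.+1%:R != 0 by exact: hz.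
  (* The relative increment splits into the Taylor remainder of the exponential and the error of
     replacing [ln (n + 1) - ln n] by [1 / (n + 1)]. *)
  have rat : gauss_prod z n.+1 - gauss_prod z n =
     gauss_prod z n * (n.+1%:R * ((cexp w - 1 - w) + (w - z / n.+1%:R)) / (z + n.+1%:R)).
    rewrite /gauss_prod big_ord_recr /= !natcpowE.
    have -> : z * (ln n.+1%:R)%:C = z * (ln n%:R)%:C + w.
      by rewrite /w /d rmorphB /= -mulrDr addrC subrK.
    rewrite cexpD factS natrM; field.
    by rewrite Pn0 !nat1r zn pnatr_eq0.
  rewrite rat normcM mulrC ler_wpM2r ?normc_ge0 //.
  rewrite !normcM normcV normc_nat.
  have den : n.+1%:R / 2 <= normc (z + n.+1%:R).
    have : normc (n.+1%:R : C) <= normc (z + n.+1%:R) + normc z.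
      rewrite -[normc z]normcN (le_trans _ (le_normcD _ _)) // addrAC subrr add0r //.
    by rewrite normc_nat -/A nS; lra.
  have nw : normc w <= A * n%:R^-1.
    rewrite normcM normc_real ger0_norm ?ler_wpM2l ?normc_ge0 //.
    by rewrite (le_trans _ d1) // invr_ge0.
  have An : A * n%:R^-1 <= 2^-1 by rewrite ler_pdivrMr //; lra.
  have w2 : normc (w - z / n.+1%:R) <= A * (n%:R^-1 - n.+1%:R^-1).
    have -> : w - z / n.+1%:R = z * (d - n.+1%:R^-1)%:C.
      by rewrite (rmorphB (real_complex R)) (fmorphV (real_complex R)) (rmorph_nat (real_complex R)) mulrBr.
    by rewrite normcM normc_real ger0_norm ?ler_wpM2l ?normc_ge0 ?lerD2r // subr_ge0.
  have w1 := cexp_taylor1 (le_trans nw An).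
  have num : normc (cexp w - 1 - w + (w - z / n.+1%:R)) <= c / 2 * (n%:R^-1 - n.+1%:R^-1).
    apply: le_trans (le_normcD _ _) _; apply: le_trans (lerD w1 w2) _.
    have : normc w ^+ 2 <= (A * n%:R^-1) ^+ 2 by rewrite ler_pXn2r // nnegrE ?normc_ge0 // mulr_ge0 ?invr_ge0.
    have : n%:R^-1 ^+ 2 <= 2 * (n%:R^-1 - n.+1%:R^-1) :> R.
      rewrite -subr_ge0.
      have -> : 2 * (n%:R^-1 - n.+1%:R^-1) - n%:R^-1 ^+ 2 = (n%:R - 1) / (n%:R ^+ 2 * (n%:R + 1)) :> R.
        by rewrite nS; field; lra.
      by rewrite divr_ge0 // ?mulr_ge0 ?sqr_ge0 //; lra.
    rewrite exprMn; set x := n%:R^-1 ^+ 2; set y := _ - _ => h1 h2.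
    have h3 : A ^+ 2 * x <= A ^+ 2 * (2 * y) by rewrite ler_wpM2l // sqr_ge0.
    by rewrite /c; nra.
  have S0 : (0 : R) < n.+1%:R by rewrite ltr0n.
  have D0 : 0 < normc (z + n.+1%:R) by rewrite (lt_le_trans _ den) // divr_gt0.
  rewrite ler_pdivrMr //.
  apply: (@le_trans _ _ (n.+1%:R * (c / 2 * (n%:R^-1 - n.+1%:R^-1)))).
    by rewrite ler_wpM2l.
  have y0 : 0 <= n%:R^-1 - n.+1%:R^-1 :> R.
    by rewrite subr_ge0 lef_pV2 ?posrE // ler_nat.
  apply: (@le_trans _ _ (c * (n%:R^-1 - n.+1%:R^-1) * (n.+1%:R / 2))).
    by rewrite le_eqVlt; apply/orP; left; apply/eqP; field; lra.
  by rewrite ler_wpM2l // mulr_ge0.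
have gN : gauss_prod z N != 0.
  rewrite /gauss_prod mulf_neq0 ?invr_eq0 // mulf_neq0 ?pnatr_eq0 -?lt0n ?fact_gt0 //.
  by rewrite natcpowE cexp_neq0.
have cN : 2 * c <= N%:R by lra.
have [l [l0 lr li [m [M [m0 hm]]]]] := ratio_cvg (isT : (0 < N)%N) c0 cN step gN.
have -> : Gamma z = l.
  by apply: (@cvg_lim _ _ _ _ _ _ (l : C^o)); [exact: norm_hausdorff | exact: cvg_complex].
by split => //; exists N, m, M.
Qed.

Lemma sqr_normc_gauss_prod (x y : R) n :
  normc (gauss_prod (x +i* y) n) ^+ 2 =
  n`!%:R ^+ 2 * expR (2 * x * ln n%:R) / \prod_(k < n.+1) ((x + k%:R) ^+ 2 + y ^+ 2).
Proof.
rewrite /gauss_prod natcpowE 2!normcM normcV !exprMn normc_nat normc_cexp.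
congr (_ * _ * _).
  by rewrite /= mulr0 subr0 expr2 -expRD; congr expR; ring.
rewrite exprVn; congr (_^-1).
elim/big_rec2: _ => [|k u v _ <-]; first by rewrite normc1 expr1n.
rewrite normcM exprMn sqr_normc_ReIm Re_add Im_add.
by rewrite -(rmorph_nat (real_complex R)) /= addr0.
Qed.

End GaussProduct.

(** * Approximations of the weight *)

Section WeightApproximation.
Variable R : realType.
Local Notation C := R[i].

Definition wgt (a : R) (n : nat) (s : R) : R := expR (2 * a * ln n%:R) *
  \prod_(k < n.+1) ((k%:R ^+ 2 + 4 * s ^+ 2) / ((a + k%:R) ^+ 2 + s ^+ 2)).

Lemma sqr_normc_gauss_quot (a s : R) n :
  normc (gauss_prod (a +i* s) n / gauss_prod (0 +i* (2 * s)) n) ^+ 2 = wgt a n s.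
Proof.
rewrite normcM normcV exprMn exprVn !sqr_normc_gauss_prod mulr0 mul0r expR0 mulr1.
rewrite /wgt prodf_div invf_div.
have -> : \prod_(k < n.+1) ((0 + k%:R) ^+ 2 + (2 * s) ^+ 2) =
    \prod_(k < n.+1) (k%:R ^+ 2 + 4 * s ^+ 2) :> R.
  by apply: eq_bigr => k _; ring.
have f0 : (n`!%:R : R) != 0 by rewrite pnatr_eq0 -lt0n fact_gt0.
set P := \prod_(_ < _) _; set Q := \prod_(_ < _) _; move: (P^-1) => p.
by field.
Qed.

Lemma wgt_ge0 a n s : 0 <= wgt a n s.
Proof. by rewrite -sqr_normc_gauss_quot sqr_ge0. Qed.

Lemma wgtN a n s : wgt a n (- s) = wgt a n s.
Proof. by rewrite /wgt sqrrN. Qed.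

Lemma wgt_cvg (rho s : R) : rho < 2^-1 ->
  wgt (2^-1 - rho) n s @[n --> \oo] --> weight rho s.
Proof.
move=> hrho; set a := 2^-1 - rho; have a0 : 0 < a by rewrite subr_gt0.
have [->|s0] := eqVneq s 0.
  rewrite weight0 (_ : (fun n => _) = (fun=> 0)); first exact: cvg_cst.
  by apply/funext => n; rewrite /wgt big_ord_recl /= !expr0n /= mulr0 addr0 !mul0r mulr0.
have e1 : a%:C + 'i%C * s%:C = a +i* s.
  by apply/eqP; rewrite eq_complex /=; apply/andP; split; apply/eqP; ring.
have e2 : 2 * 'i%C * s%:C = 0 +i* (2 * s).
  by apply/eqP; rewrite eq_complex /=; apply/andP; split; apply/eqP; ring.
have nz1 (k : nat) : a +i* s + k%:R != 0.
  rewrite -(rmorph_nat (real_complex R)) eq_complex /= negb_and; apply/orP; left.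
  by rewrite gt_eqF // ltr_wpDr.
have nz2 (k : nat) : 0 +i* (2 * s) + k%:R != 0.
  rewrite -(rmorph_nat (real_complex R)) eq_complex /= negb_and; apply/orP; right.
  by rewrite addr0 mulf_neq0 // pnatr_eq0.
have [g1 r1 i1 _] := gauss_prod_cvg nz1.
have [g2 r2 i2 [N [m [M [m0 hm]]]]] := gauss_prod_cvg nz2.
rewrite /weight e1 e2 normcM normcV exprMn exprVn.
under eq_fun do rewrite -sqr_normc_gauss_quot normcM normcV exprMn exprVn.
have lim (z : C) (u : nat -> C) : complex.Re (u n) @[n --> \oo] --> complex.Re z ->
    complex.Im (u n) @[n --> \oo] --> complex.Im z ->
    normc (u n) ^+ 2 @[n --> \oo] --> normc z ^+ 2.
  move=> h1 h2; under eq_fun do rewrite sqr_normc_ReIm !expr2.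
  by rewrite sqr_normc_ReIm !expr2; apply: cvgD; apply: cvgM.
apply: cvgM; first exact: lim.
apply: cvgV; last exact: lim.
by rewrite sqrf_eq0; apply: contra g2 => /eqP/eq0_normc ->.
Qed.

Lemma prodr_gt0' (I : finType) (F : I -> R) : (forall i, 0 < F i) -> 0 < \prod_i F i.
Proof. by move=> h; apply: prodr_gt0 => i _. Qed.

(** Among [1, ..., 2n + 1] the even numbers [2j] give the factors [1 + s^2 / j^2]; the odd ones
    remain with [2 s]. *)
Lemma prod_split_parity (s : R) n :
  \prod_(k < n.*2.+1) (1 + 4 * s ^+ 2 / k.+1%:R ^+ 2) =
  \prod_(j < n.+1) (1 + (2 * s) ^+ 2 / (j.*2.+1)%:R ^+ 2) *
  \prod_(j < n) (1 + s ^+ 2 / j.+1%:R ^+ 2).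
Proof.
elim: n => [|n IH].
  by rewrite !big_ord_recl !big_ord0 /=; ring.
rewrite doubleS 2!big_ord_recr /= IH [in RHS]big_ord_recr [X in _ = _ * X]big_ord_recr /=.
have -> : 4 * s ^+ 2 / n.*2.+2%:R ^+ 2 = s ^+ 2 / n.+1%:R ^+ 2.
  rewrite -doubleS -muln2 natrM; field.
  by rewrite nat1r pnatr_eq0.
have -> : (2 * s) ^+ 2 = 4 * s ^+ 2 by ring.
by rewrite doubleS; ring.
Qed.

(** A finite-stage form of [sinh (2 pi s) / (2 sinh (pi s)) = cosh (pi s)]. After the parity split
    the even numerators are cancelled by the denominators, and the odd product is at most
    [cosh (pi s)]. *)
Lemma prod_quot_le (s : R) n :
  \prod_(k < n) ((k.+1%:R ^+ 2 + 4 * s ^+ 2) / (k.+1%:R ^+ 2 + s ^+ 2)) <= expR (pi * `|s|).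
Proof.
pose q (k : nat) : R := (k.+1%:R ^+ 2 + 4 * s ^+ 2) / (k.+1%:R ^+ 2 + s ^+ 2).
have k0 (k : nat) : (0 : R) < k.+1%:R ^+ 2 by rewrite exprn_gt0 // ltr0n.
have s2 := sqr_ge0 s.
have q1 k : 1 <= q k.
  by rewrite ler_pdivlMr ?mul1r ?lerD2l; have := k0 k; lra.
have mono m : \prod_(k < n) q k <= \prod_(k < n + m) q k.
  elim: m => [|m IH]; first by rewrite addn0.
  rewrite addnS big_ord_recr /= (le_trans IH) // ler_peMr //.
  by apply: prodr_ge0 => k _; exact: le_trans (q1 k).
(* All factors are at least 1, so the product may be lengthened to [2n + 1] factors, where the
   parity split applies. *)
apply: le_trans (mono n.+1) _; rewrite addnS addnn.
have -> : \prod_(k < n.*2.+1) q k = \prod_(k < n.*2.+1) (1 + 4 * s ^+ 2 / k.+1%:R ^+ 2) /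
    \prod_(k < n.*2.+1) (1 + s ^+ 2 / k.+1%:R ^+ 2).
  rewrite -prodf_div; apply: eq_bigr => k _; rewrite /q; field.
  by have := k0 k; rewrite !nat1r => h; apply/andP; split; apply/eqP; nra.
rewrite prod_split_parity.
set A := \prod_(_ < n.+1) _; set B := \prod_(_ < n) _; set D := \prod_(_ < _) _.
have f1 (k : nat) : 1 <= 1 + s ^+ 2 / k.+1%:R ^+ 2.
  by rewrite lerDl divr_ge0 // ltW.
have B0 : 0 <= B by apply: prodr_ge0 => k _; exact: le_trans (f1 k).
have D0 : 0 < D by apply: prodr_gt0' => k; exact: lt_le_trans (f1 k).
have BD : B <= D.
  have h m : B <= \prod_(k < n + m) (1 + s ^+ 2 / k.+1%:R ^+ 2).
    elim: m => [|m IH]; first by rewrite addn0.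
    rewrite addnS big_ord_recr /= (le_trans IH) // ler_peMr //.
    by apply: prodr_ge0 => k _; exact: le_trans (f1 k).
  by have := h n.+1; rewrite addnS addnn.
have A0 : 0 <= A by apply: prodr_ge0 => k _; rewrite addr_ge0 // divr_ge0 ?sqr_ge0 // exprn_ge0.
rewrite ler_pdivrMr //.
apply: (@le_trans _ _ (A * D)); first by rewrite ler_wpM2l.
rewrite ler_wpM2r ?(ltW D0) //; apply: le_trans (prod_odd_le_cosh _ _) _.
apply: le_trans (rcosh_le_exp _) _; rewrite ler_expR.
have -> : 2 * s * (pi / 2) = pi * s :> R by field.
by rewrite normrM ger0_norm // pi_ge0.
Qed.

(** For an integer parameter the denominators are a shifted piece of the single product [P], so the
    whole is [4 s^2 P N] times a quotient bounded by [prod_quot_le], times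
    [P n n^(2N+2) / P (N + n + 1)]. The last factor is at most 1, as each of the [N + 1] additional
    factors of [P] is at least [n^2]. *)
Lemma wgt_int_le (N : nat) (s : R) n : (0 < n)%N ->
  n%:R ^+ (2 * N.+1) * \prod_(k < n.+1) ((k%:R ^+ 2 + 4 * s ^+ 2) / ((N.+1%:R + k%:R) ^+ 2 + s ^+ 2))
  <= 4 * s ^+ 2 * \prod_(j < N) (j.+1%:R ^+ 2 + s ^+ 2) * expR (pi * `|s|).
Proof.
move=> n0.
have s2 := sqr_ge0 s.
have k0 (k : nat) : (0 : R) < k.+1%:R ^+ 2 + s ^+ 2.
  by rewrite ltr_wpDr // exprn_gt0 // ltr0n.
pose P (m : nat) : R := \prod_(j < m) (j.+1%:R ^+ 2 + s ^+ 2).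
have P0 m : 0 < P m by apply: prodr_gt0' => k.
have PD m : \prod_(k < m) ((N.+1%:R + k%:R) ^+ 2 + s ^+ 2) = P (N + m)%N / P N.
  elim: m => [|m IH]; first by rewrite big_ord0 addn0 divff // gt_eqF.
  rewrite big_ord_recr /= IH addnS /P [in RHS]big_ord_recr /= -natrD addSn.
  by rewrite mulrAC.
have PN : P n * n%:R ^+ (2 * N.+1) <= P (N + n.+1)%N.
  have h m : P n * n%:R ^+ (2 * m) <= P (n + m)%N.
    elim: m => [|m IH]; first by rewrite muln0 expr0 mulr1 addn0.
    rewrite addnS /P big_ord_recr /= -/(P _).
    have -> : n%:R ^+ (2 * m.+1) = n%:R ^+ (2 * m) * n%:R ^+ 2 :> R by rewrite -exprD mulnS addnC.
    rewrite mulrA ler_pM // ?mulr_ge0 ?exprn_ge0 ?(ltW (P0 _)) //.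
    rewrite ler_wpDr // ler_pXn2r ?nnegrE // ler_nat.
    by rewrite -addnS leq_addr.
  by have := h N.+1; rewrite addnC addSnnS.
rewrite prodf_div PD big_ord_recl /= expr0n add0r.
have -> : \prod_(i < n) ((bump 0 i)%:R ^+ 2 + 4 * s ^+ 2) =
   \prod_(k < n) ((k.+1%:R ^+ 2 + 4 * s ^+ 2) / (k.+1%:R ^+ 2 + s ^+ 2)) * P n :> R.
  by rewrite prodf_div divfK // gt_eqF //; exact: P0.
have := prod_quot_le s n; set q := \prod_(_ < _) _ => hq.
have q0 : 0 <= q by apply: prodr_ge0 => k _; rewrite divr_ge0 ?(ltW (k0 _)) // addr_ge0 ?exprn_ge0 // mulr_ge0.
rewrite -/(P N).
have -> : n%:R ^+ (2 * N.+1) * (4 * s ^+ 2 * (q * P n) / (P (N + n.+1)%N / P N)) =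
  (4 * s ^+ 2 * P N) * (q * (P n * n%:R ^+ (2 * N.+1) / P (N + n.+1)%N)).
  by field; rewrite !gt_eqF.
have Pn := ltW (P0 n); have PNn := ltW (P0 (N + n.+1)%N).
rewrite ler_wpM2l //.
  by apply: mulr_ge0; [exact: mulr_ge0 | exact: ltW].
rewrite -[leRHS]mulr1 ler_pM //.
  by rewrite divr_ge0 // mulr_ge0 // exprn_ge0.
by rewrite ler_pdivrMr // mul1r.
Qed.

(** Comparison with the integer parameter [M + 1], where [M] is the integer part of [a]. The cost of
    changing parameter is largest at [s = 0], where it is a quotient of two Gauss products, bounded
    uniformly in [n]. The resulting power [2 M + 2] exceeds the true exponent [2 a] of the weight by
    at most 2. *)
Lemma wgt_le (a : R) : 0 < a -> exists (M N : nat) (K : R),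
  M%:R <= a /\ forall n s, (N <= n)%N ->
    wgt a n s <= K * s ^+ 2 * (1 + s ^+ 2) ^+ M * expR (pi * `|s|).
Proof.
move=> a0; pose M := Num.truncn a.
have Ma : M%:R <= a by rewrite truncn_le // ltW.
have aM : a < M.+1%:R by exact: truncnS_gt.
have nz (x : R) : 0 < x -> forall k : nat, (x%:C + k%:R : C) != 0.
  move=> x0 k; rewrite -(rmorph_nat (real_complex R)) eq_complex /= negb_and; apply/orP; left.
  by rewrite gt_eqF // ltr_wpDr.
have [_ _ _ [N1 [m1 [K1 [m10 h1]]]]] := gauss_prod_cvg (nz a a0).
have [_ _ _ [N2 [m2 [K2 [m20 h2]]]]] := gauss_prod_cvg (nz M.+1%:R (ltr0Sn _ _)).
pose L : R := \prod_(j < M) (j.+1%:R ^+ 2).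
exists M, (N1 + N2).+1, ((K1 / m2) ^+ 2 * 4 * L); split=> // n s Nn.
have n0 : (0 < n)%N by exact: leq_trans Nn.
have n0R : (0 : R) < n%:R by rewrite ltr0n.
have s2 := sqr_ge0 s.
have [b1 b2] : normc (gauss_prod a%:C n) <= K1 /\ m2 <= normc (gauss_prod (M.+1%:R)%:C n).
  split; first by have /andP[] := h1 n (leq_trans (leq_trans (leq_addr _ _) (leqnSn _)) Nn).
  by have /andP[] := h2 n (leq_trans (leq_trans (leq_addl _ _) (leqnSn _)) Nn).
have g1 := sqr_normc_gauss_prod a 0 n; have g2 := sqr_normc_gauss_prod (M.+1%:R : R) 0 n.
pose F (x : R) : R := \prod_(k < n.+1) ((x + k%:R) ^+ 2 + 0 ^+ 2).
have F0 x : 0 < x -> 0 < F x.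
  move=> x0; apply: prodr_gt0' => k; rewrite expr0n addr0 exprn_gt0 //.
  by rewrite ltr_wpDr.
have f0 : (0 : R) < n`!%:R by rewrite ltr0n fact_gt0.
have K10 : 0 <= K1 by exact: le_trans (normc_ge0 _) b1.
have ratio : expR (2 * a * ln n%:R) * F M.+1%:R / F a <= (K1 / m2) ^+ 2 * n%:R ^+ (2 * M.+1).
  have E : n%:R ^+ (2 * M.+1) = expR (2 * M.+1%:R * ln n%:R) :> R.
    by rewrite -natrM expRM_natl lnK ?posrE.
  have Fa := F0 _ a0; have FM := F0 _ (ltr0Sn R M).
  have e0 := expR_gt0 (2 * M.+1%:R * ln n%:R : R).
  have h : expR (2 * a * ln n%:R) * F M.+1%:R / F a =
    (normc (gauss_prod a%:C n) ^+ 2 / normc (gauss_prod (M.+1%:R)%:C n) ^+ 2) * n%:R ^+ (2 * M.+1).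
    by rewrite g1 g2 -/(F _) -/(F _) E; field; rewrite ?gt_eqF.
  rewrite h ler_wpM2r ?exprn_ge0 //.
  rewrite -expr_div_n ler_pXn2r ?nnegrE ?divr_ge0 ?normc_ge0 ?(ltW m20) //.
  rewrite ler_pM ?normc_ge0 ?invr_ge0 ?normc_ge0 //.
  by rewrite lef_pV2 ?posrE // (lt_le_trans m20).
pose G (x : R) : R := \prod_(k < n.+1) ((k%:R ^+ 2 + 4 * s ^+ 2) / ((x + k%:R) ^+ 2 + s ^+ 2)).
(* Factor by factor: for [x <= y], [1 / (x + s^2) <= (y / x) / (y + s^2)]. *)
have comp : G a <= (F M.+1%:R / F a) * G M.+1%:R.
  rewrite /F -prodf_div /G -big_split /=; apply: ler_prod => k _.
  have k0 : (0 : R) <= k%:R by [].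
  have x0 : 0 < (a + k%:R) ^+ 2 by rewrite exprn_gt0 // ltr_wpDr.
  have xy : (a + k%:R) ^+ 2 <= (M.+1%:R + k%:R) ^+ 2.
    by rewrite ler_pXn2r ?nnegrE ?addr_ge0 ?lerD2r ?(ltW a0) ?(ltW aM).
  have y0 := lt_le_trans x0 xy.
  rewrite expr0n !addr0; set x := (a + _) ^+ 2 in x0 xy *; set y := _ ^+ 2 in xy y0 *.
  set u := k%:R ^+ 2 + _.
  have u0 : 0 <= u by rewrite addr_ge0 ?sqr_ge0 // mulr_ge0.
  rewrite divr_ge0 //=; last by rewrite addr_ge0 // ltW.
  have -> : y / x * (u / (y + s ^+ 2)) = u * (y / (x * (y + s ^+ 2))) by field; lra.
  rewrite ler_wpM2l // -(@ler_pM2r _ ((x + s ^+ 2) * (x * (y + s ^+ 2)))); last first.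
    have s0 := sqr_ge0 s; exact: mulr_gt0 (ltr_wpDr s0 x0) (mulr_gt0 x0 (ltr_wpDr s0 y0)).
  have -> : (x + s ^+ 2)^-1 * ((x + s ^+ 2) * (x * (y + s ^+ 2))) = x * (y + s ^+ 2) by field; lra.
  have -> : y / (x * (y + s ^+ 2)) * ((x + s ^+ 2) * (x * (y + s ^+ 2))) = y * (x + s ^+ 2) by field; lra.
  by rewrite !mulrDr mulrC lerD2l ler_wpM2r.
have G0 : 0 <= G M.+1%:R.
  by apply: prodr_ge0 => k _; rewrite divr_ge0 // addr_ge0 ?sqr_ge0 // mulr_ge0.
apply: (@le_trans _ _ ((K1 / m2) ^+ 2 * (n%:R ^+ (2 * M.+1) * G M.+1%:R))).
  apply: (@le_trans _ _ (expR (2 * a * ln n%:R) * ((F M.+1%:R / F a) * G M.+1%:R))).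
    by rewrite ler_wpM2l ?expR_ge0.
  rewrite mulrA [X in _ <= X]mulrA ler_wpM2r //.
  by rewrite mulrA.
have := wgt_int_le M s n0; rewrite -/(G _) => h.
apply: (@le_trans _ _ ((K1 / m2) ^+ 2 * (4 * s ^+ 2 * \prod_(j < M) (j.+1%:R ^+ 2 + s ^+ 2) * expR (pi * `|s|)))).
  by rewrite ler_wpM2l // sqr_ge0.
have -> : (K1 / m2) ^+ 2 * 4 * L * s ^+ 2 * (1 + s ^+ 2) ^+ M * expR (pi * `|s|) =
  (K1 / m2) ^+ 2 * (4 * s ^+ 2 * (L * (1 + s ^+ 2) ^+ M) * expR (pi * `|s|)) by ring.
have c4 : 0 <= 4 * s ^+ 2 by rewrite mulr_ge0.
rewrite ler_wpM2l ?sqr_ge0 // ler_wpM2r ?expR_ge0 // ler_wpM2l //.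
have -> : (1 + s ^+ 2) ^+ M = \prod_(j < M) (1 + s ^+ 2) :> R by rewrite prodr_const card_ord.
rewrite -big_split /=; apply: ler_prod => j _.
rewrite addr_ge0 ?sqr_ge0 //= mulrDr mulr1 lerD2l ler_peMl //.
by rewrite exprn_ege1 // ler1n.
Qed.

End WeightApproximation.

(** * Goursat's theorem on a rectangle *)

Lemma ltr_dist_itv (R : realDomainType) (u v p q d : R) :
  p <= v <= q -> p <= u <= q -> q - p < d -> `|u - v| < d.
Proof. by rewrite ltr_norml => *; lra. Qed.

Section Goursat.
Variable R : realType.
Local Notation mu := (@lebesgue_measure R).
Local Notation I f a b := (\int[mu]_(t in `[a, b]) f t).

Lemma Rintegral_split (f : R -> R) a m b : a <= m -> m <= b ->
  mu.-integrable `[a, b] (EFin \o f) -> I f a b = I f a m + I f m b.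
Proof.
move=> am mb hf.
have := @Rintegral_itvB _ f (BLeft a) (BRight b) m hf; rewrite !bnd_simp => /(_ am mb).
rewrite (@Rintegral_itv_obnd_cbnd _ m (BRight b)); first by move=> <-; rewrite subrKC.
apply: (@integrableS _ _ _ mu `[a, b]) => //.
by apply: subset_itv; rewrite bnd_simp.
Qed.

Lemma Rintegral_dist (f : R -> R) a b k e : a <= b -> mu.-integrable `[a, b] (EFin \o f) ->
  (forall t, a <= t <= b -> `|f t - k| <= e) -> `|I f a b - k * (b - a)| <= e * (b - a).
Proof.
move=> ab hf h.
have cst_int (c : R) : mu.-integrable `[a, b] (EFin \o (cst c)).
  by apply: integrable_continuous => x; exact: cst_continuous.
have cstI (c : R) : I (cst c) a b = c * (b - a).
  have hd (x : R) : is_derive x 1 (fun t : R => c * t) (cst c x).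
    have h0 := is_derive_mul (is_derive_const c x) (is_derive_var x).
    by apply: (is_derive_eq h0); rewrite mulr1 mulr0 addr0.
  by rewrite (Rintegral_FTC ab hd (@cst_continuous _ _ c)) mulrBr.
rewrite ler_norml; apply/andP; split.
  have : I (cst (k - e)) a b <= I f a b.
    apply: le_Rintegral => // x /=; rewrite in_itv /= => /h; rewrite ler_norml => /andP[]; lra.
  by rewrite cstI; lra.
have : I f a b <= I (cst (k + e)) a b.
  apply: le_Rintegral => // x /=; rewrite in_itv /= => /h; rewrite ler_norml => /andP[]; lra.
by rewrite cstI; lra.
Qed.

Variables (P Q : R -> R -> R) (y1 y2 : R).

(* [P dx + Q dy] is differentiable and closed at the point: [p2] is both
   [dP/dy] and [dQ/dx]. *)
Definition closed_form_at (x0 y0 : R) := exists p1 p2 q2 : R,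
  forall e : R, 0 < e -> exists2 d : R, 0 < d & forall x y : R,
    `|x - x0| < d -> `|y - y0| < d ->
    `|P x y - (P x0 y0 + p1 * (x - x0) + p2 * (y - y0))| <= e * (`|x - x0| + `|y - y0|) /\
    `|Q x y - (Q x0 y0 + p2 * (x - x0) + q2 * (y - y0))| <= e * (`|x - x0| + `|y - y0|).

Hypothesis PQ : forall x0 y0, y1 < y0 < y2 -> closed_form_at x0 y0.

Let affine_continuous (F : R -> R) (t0 A B : R) :
  (forall e : R, 0 < e -> exists2 d : R, 0 < d & forall t, `|t - t0| < d ->
     `|F t - (F t0 + A * (t - t0))| <= e * `|t - t0|) -> {for t0, continuous F}.
Proof.
move=> h; apply/cvgrPdist_lt => e e0.
have [d d0 hd] := h 1 ltr01.
pose r := Num.min d (e / (`|A| + 2)).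
have A2 : 0 < `|A| + 2 by rewrite ltr_wpDl.
have r0 : 0 < r by rewrite lt_min d0 divr_gt0.
apply/nbhs_ballP; exists r => //= t tr0.
have tr : `|t - t0| < r by rewrite distrC.
have td : `|t - t0| < d by rewrite (lt_le_trans tr) // ge_min lexx.
have te : `|t - t0| < e / (`|A| + 2) by rewrite (lt_le_trans tr) // ge_min lexx orbT.
have := hd t td; rewrite mul1r => hh.
rewrite distrC.
have -> : F t - F t0 = (F t - (F t0 + A * (t - t0))) + A * (t - t0) by ring.
rewrite (le_lt_trans (ler_normD _ _)) // (@le_lt_trans _ _ (`|t - t0| + `|A| * `|t - t0|)) //.
  by rewrite normrM lerD2r.
rewrite ltr_pdivlMr // in te.
have := normr_ge0 (t - t0); have := normr_ge0 A; nra.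
Qed.

Let contPx y0 : y1 < y0 < y2 -> continuous (P ^~ y0).
Proof.
move=> hy x0; have [p1 [p2 [q2 h]]] := PQ x0 hy.
apply: (@affine_continuous _ _ p1 0) => e e0; have [d d0 hd] := h e e0.
exists d => // t ht; have [] := hd t y0 ht; first by rewrite subrr normr0.
by rewrite !subrr mulr0 normr0 !addr0.
Qed.

Lemma closed_form_continuous_y y0 x0 : y1 < y0 < y2 -> {for y0, continuous (Q x0)}.
Proof.
move=> hy; have [p1 [p2 [q2 h]]] := PQ x0 hy.
apply: (@affine_continuous _ _ q2 0) => e e0; have [d d0 hd] := h e e0.
exists d => // t ht; have [|_] := hd x0 t _ ht; first by rewrite subrr normr0.
by rewrite !subrr mulr0 normr0 addr0 add0r.
Qed.

Let intP y0 a b : y1 < y0 < y2 -> mu.-integrable `[a, b] (EFin \o (P ^~ y0)).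
Proof. by move=> hy; apply: integrable_continuous; exact: contPx. Qed.

Let intQ x0 c d : y1 < c -> d < y2 -> mu.-integrable `[c, d] (EFin \o (Q x0)).
Proof.
move=> hc hd; apply: continuous_compact_integrable; first exact: segment_compact.
apply: continuous_in_subspaceT => y; rewrite inE /= in_itv /= => /andP[cy yd].
by apply: closed_form_continuous_y; rewrite (lt_le_trans hc) // (le_lt_trans yd).
Qed.

Definition circulation (a b c d : R) : R :=
  I (P ^~ c) a b - I (P ^~ d) a b + I (Q b) c d - I (Q a) c d.

(** The affine parts contribute [p2 (c - d) (b - a)] and [p2 (b - a) (d - c)], which cancel because
    the same [p2] serves for [P] and for [Q]. Only the error terms remain. *)
Let circulation_local (x0 y0 p1 p2 q2 e a b c d : R) : a <= b -> c <= d ->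
  y1 < c -> d < y2 -> 0 <= e ->
  a <= x0 <= b -> c <= y0 <= d ->
  (forall x y, a <= x <= b -> c <= y <= d ->
    `|P x y - (P x0 y0 + p1 * (x - x0) + p2 * (y - y0))| <= e * (`|x - x0| + `|y - y0|) /\
    `|Q x y - (Q x0 y0 + p2 * (x - x0) + q2 * (y - y0))| <= e * (`|x - x0| + `|y - y0|)) ->
  `|circulation a b c d| <= 2 * e * ((b - a) + (d - c)) ^+ 2.
Proof.
move=> ab cd hc hd e0 hx0 hy0 h.
have hc' : y1 < c < y2 by rewrite hc (le_lt_trans cd).
have hd' : y1 < d < y2 by rewrite hd andbT (lt_le_trans hc).
set l := (b - a) + (d - c).
have small x y : a <= x <= b -> c <= y <= d -> e * (`|x - x0| + `|y - y0|) <= e * l.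
  move=> hx hy; rewrite ler_wpM2l // lerD // ler_norml; lra.
have h1 : `|I (fun x => P x c - P x d) a b - p2 * (c - d) * (b - a)| <= 2 * e * l * (b - a).
  apply: Rintegral_dist => //.
    apply: integrable_continuous => x; apply: cvgB; exact: contPx.
  move=> x hx; have c1 : c <= c <= d by rewrite lexx.
  have d1 : c <= d <= d by rewrite lexx andbT.
  have [A _] := h x c hx c1; have [B _] := h x d hx d1.
  have := le_trans A (small _ _ hx c1); have := le_trans B (small _ _ hx d1).
  clear; rewrite !ler_norml => /andP[? ?] /andP[? ?]; apply/andP; split; lra.
have h2 : `|I (fun y => Q b y - Q a y) c d - p2 * (b - a) * (d - c)| <= 2 * e * l * (d - c).
  apply: Rintegral_dist => //.
    apply: continuous_compact_integrable; first exact: segment_compact.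
    apply: continuous_in_subspaceT => y; rewrite inE /= in_itv /= => /andP[cy yd].
    by apply: cvgB; apply: closed_form_continuous_y; rewrite (lt_le_trans hc) // (le_lt_trans yd).
  move=> y hy; have a1 : a <= a <= b by rewrite lexx.
  have b1 : a <= b <= b by rewrite lexx andbT.
  have [_ A] := h a y a1 hy; have [_ B] := h b y b1 hy.
  have := le_trans A (small _ _ a1 hy); have := le_trans B (small _ _ b1 hy).
  clear; rewrite !ler_norml => /andP[? ?] /andP[? ?]; apply/andP; split; lra.
have -> : circulation a b c d = I (fun x => P x c - P x d) a b + I (fun y => Q b y - Q a y) c d.
  by rewrite /circulation !RintegralB ?addrA //; do ?[exact: intP | exact: intQ].
have -> : 2 * e * l ^+ 2 = 2 * e * l * (b - a) + 2 * e * l * (d - c) by rewrite /l; ring.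
move: h1 h2; clear; rewrite !ler_norml => /andP[? ?] /andP[? ?]; apply/andP; split; lra.
Qed.

Let rect := (R * R * (R * R))%type.
Let circ (r : rect) := circulation r.1.1 r.1.2 r.2.1 r.2.2.
Let mid (a b : R) := (a + b) / 2.
Let q1 (r : rect) : rect := ((r.1.1, mid r.1.1 r.1.2), (r.2.1, mid r.2.1 r.2.2)).
Let q2 (r : rect) : rect := ((mid r.1.1 r.1.2, r.1.2), (r.2.1, mid r.2.1 r.2.2)).
Let q3 (r : rect) : rect := ((r.1.1, mid r.1.1 r.1.2), (mid r.2.1 r.2.2, r.2.2)).
Let q4 (r : rect) : rect := ((mid r.1.1 r.1.2, r.1.2), (mid r.2.1 r.2.2, r.2.2)).
Let valid (r : rect) := [&& r.1.1 <= r.1.2, r.2.1 <= r.2.2, y1 < r.2.1 & r.2.2 < y2].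
Let next (r : rect) : rect :=
  if `|circ r| / 4 <= `|circ (q1 r)| then q1 r else
  if `|circ r| / 4 <= `|circ (q2 r)| then q2 r else
  if `|circ r| / 4 <= `|circ (q3 r)| then q3 r else q4 r.

Let circ_quarter r : valid r -> circ r = circ (q1 r) + circ (q2 r) + circ (q3 r) + circ (q4 r).
Proof.
move: r => [[a b] [c d]] /and4P[/= ab cd hc hd].
rewrite /circ /circulation /= -/(mid a b) -/(mid c d).
have [am mb] : a <= mid a b /\ mid a b <= b by rewrite /mid; split; lra.
have [cm md] : c <= mid c d /\ mid c d <= d by rewrite /mid; split; lra.
have hc' : y1 < c < y2 by rewrite hc (le_lt_trans cd).
have hd' : y1 < d < y2 by rewrite hd andbT (lt_le_trans hc).
have A := Rintegral_split am mb (intP a b hc').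
have B := Rintegral_split am mb (intP a b hd').
have D := Rintegral_split cm md (intQ b hc hd).
have E := Rintegral_split cm md (intQ a hc hd).
by rewrite A B D E; ring.
Qed.

Let next_ge r : valid r -> `|circ r| / 4 <= `|circ (next r)|.
Proof.
move=> /circ_quarter e; rewrite /next.
case: ifPn => // /negP h1; case: ifPn => // /negP h2; case: ifPn => // /negP h3.
move: h1 h2 h3 => /negP; rewrite -ltNge => h1 /negP; rewrite -ltNge => h2 /negP; rewrite -ltNge => h3.
have : `|circ r| <= `|circ (q1 r)| + `|circ (q2 r)| + `|circ (q3 r)| + `|circ (q4 r)|.
  by rewrite {1}e !(le_trans (ler_normD _ _)) // !lerD2r !(le_trans (ler_normD _ _)) // lerD2r ler_normD.
by lra.
Qed.

Let next_sub r : valid r -> [/\ valid (next r),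
  r.1.1 <= (next r).1.1 /\ (next r).1.2 <= r.1.2,
  r.2.1 <= (next r).2.1 /\ (next r).2.2 <= r.2.2 &
  (next r).1.2 - (next r).1.1 = (r.1.2 - r.1.1) / 2 /\
  (next r).2.2 - (next r).2.1 = (r.2.2 - r.2.1) / 2].
Proof.
move: r => [[a b] [c d]] /and4P[/= ab cd hc hd].
rewrite /next; case: ifP => _; [|case: ifP => _; [|case: ifP => _]];
  by rewrite /q1 /q2 /q3 /q4 /valid /mid /=; split; [apply/and4P; split; lra|split; lra|split; lra|split; lra].
Qed.

(** Bisection: keep a quarter carrying at least a quarter of the circulation. The nested rectangles
    shrink to a point, where differentiability bounds the circulation by a small multiple of the
    squared size. *)
Theorem goursat_rectangle (a b c d : R) : a <= b -> c <= d -> y1 < c -> d < y2 ->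
  circulation a b c d = 0.
Proof.
move=> ab cd hc hd.
pose r k : rect := iter k next ((a, b), (c, d)).
have v0 : valid (r 0%N) by apply/and4P.
have v k : valid (r k) by elim: k => // k IH; have [] := next_sub IH.
have circk k : `|circulation a b c d| <= 4 ^+ k * `|circ (r k)|.
  elim: k => [|k IH]; first by rewrite expr0 mul1r.
  apply: le_trans IH _; rewrite exprSr -mulrA ler_wpM2l ?exprn_ge0 //.
  by have := next_ge (v k); rewrite -/(r k.+1); lra.
have size k : ((r k).1.2 - (r k).1.1) + ((r k).2.2 - (r k).2.1) = ((b - a) + (d - c)) / 2 ^+ k.
  elim: k => [|k IH]; first by rewrite expr0 divr1.
  have [_ _ _ [-> ->]] := next_sub (v k); rewrite -mulrDl IH exprSr.
  by field; rewrite expf_neq0.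
have lowx k j : (r k).1.1 <= (r (k + j)%N).1.1 /\ (r (k + j)%N).1.2 <= (r k).1.2.
  elim: j => [|j [i1 i2]]; first by rewrite addn0.
  by rewrite addnS; have [_ [? ?] _ _] := next_sub (v (k + j)%N); split; [apply: le_trans i1 _ | apply: le_trans i2].
have lowy k j : (r k).2.1 <= (r (k + j)%N).2.1 /\ (r (k + j)%N).2.2 <= (r k).2.2.
  elim: j => [|j [i1 i2]]; first by rewrite addn0.
  by rewrite addnS; have [_ _ [? ?] _] := next_sub (v (k + j)%N); split; [apply: le_trans i1 _ | apply: le_trans i2].
have nested (l u : nat -> R) : (forall k j, l k <= l (k + j)%N /\ u (k + j)%N <= u k) ->
    (forall k, l k <= u k) -> exists x, forall k, l k <= x <= u k.
  move=> h1 h2; have lu k j : l k <= u j.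
    have [A _] := h1 k j; have [_ B] := h1 j k; rewrite addnC in B.
    exact: le_trans A (le_trans (h2 _) B).
  exists (sup (range l)) => k; apply/andP; split.
    apply: ub_le_sup; last by exists k.
    by exists (u 0%N) => _ [j _ <-].
  apply: ge_sup; first by exists (l 0%N), 0%N.
  by move=> _ [j _ <-].
have [x0 hx0] := nested _ _ lowx (fun k => let: And4 h _ _ _ := and4P (v k) in h).
have [y0 hy0] := nested _ _ lowy (fun k => let: And4 _ h _ _ := and4P (v k) in h).
have hy : y1 < y0 < y2.
  have /andP[/= A B] := hy0 0%N.
  by rewrite (lt_le_trans hc) // (le_lt_trans B).
have [p1 [p2 [q2' h]]] := PQ x0 hy.
set L := (b - a) + (d - c) in size.
have L0 : 0 <= L by rewrite addr_ge0 // subr_ge0.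
have key e : 0 < e -> `|circulation a b c d| <= 2 * e * L ^+ 2.
  move=> e0; have [dl dl0 hdl] := h e e0.
  pose k := (Num.truncn (L / dl)).+1.
  have kdl : L / 2 ^+ k < dl.
    rewrite ltr_pdivrMr ?exprn_gt0 // mulrC -ltr_pdivrMr // (lt_le_trans (truncnS_gt _)) //.
    by rewrite -natrX ler_nat ltnW // ltn_expl.
  have /and4P[w1 w2 w3 w4] := v k; have sk := size k.
  apply: le_trans (circk k) _.
  have := @circulation_local x0 y0 p1 p2 q2' e _ _ _ _ w1 w2 w3 w4 (ltW e0) (hx0 k) (hy0 k).
  rewrite -/(circ (r k)) sk => hk.
  (* The factor [4^k] lost in the choice of quarters is recovered exactly, since [k] bisections
     divide the squared size by [4^k]. *)
  have e4 : 2 * e * L ^+ 2 = 4 ^+ k * (2 * e * (L / 2 ^+ k) ^+ 2).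
    have -> : (4 : R) ^+ k = (2 ^+ k) ^+ 2 by rewrite -exprM mulnC exprM; congr (_ ^+ _); ring.
    by field; rewrite expf_neq0.
  rewrite e4 ler_wpM2l ?exprn_ge0 //; apply: hk => x y hx hy'.
  apply: hdl.
    by apply: ltr_dist_itv (hx0 k) hx _; rewrite (le_lt_trans _ kdl) // -sk lerDl subr_ge0.
  by apply: ltr_dist_itv (hy0 k) hy' _; rewrite (le_lt_trans _ kdl) // -sk lerDr subr_ge0.
apply/eqP; rewrite -normr_le0 leNgt; apply/negP => pos.
have L1 : 0 < 2 * L ^+ 2 + 1 by rewrite ltr_wpDl // mulr_ge0 // sqr_ge0.
have := key (`|circulation a b c d| / (2 * L ^+ 2 + 1)); rewrite divr_gt0 // => /(_ isT).
set x := `|_| in pos *; set m := 2 * L ^+ 2.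
have -> : 2 * (x / (2 * L ^+ 2 + 1)) * L ^+ 2 = x * m / (m + 1) by rewrite /m; field; lra.
rewrite ler_pdivlMr // mulrDr mulr1 gerDl leNgt pos //.
Qed.

End Goursat.

(** * Complex derivatives and contour shift *)

Section ComplexDerivative.
Variable R : realType.
Local Notation C := R[i].
Local Notation mu := (@lebesgue_measure R).
Implicit Types f g : C -> C.

(** Complex differentiability with real radii and errors, so that estimates stay in [R]; [derivable]
    has them in [R[i]]. *)
Definition cderiv f (z D : C) := forall e : R, 0 < e -> exists2 d : R, 0 < d &
  forall h : C, normc h < d -> normc (f (z + h) - f z - D * h) <= e * normc h.

Lemma derivable_cderiv f z : derivable (f : C^o -> C^o) z 1 -> exists D, cderiv f z D.
Proof.
move=> /cvg_ex[D /cvgrPdist_le hD]; exists D => e e0.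
have e0C : 0 < e%:C :> C by rewrite ltcR.
have /nbhs_ballP[d d0 hd] := hD _ e0C.
have [r r0 dr] := gtc0_real d0.
exists r => // h hr.
have [->|hn0] := eqVneq h 0; first by rewrite addr0 subrr sub0r mulr0 oppr0 normc0 mulr0.
have := hd h; rewrite /ball /= sub0r normrN normc_normr dr ltcR => /(_ hr hn0).
rewrite normc_normr lecR => hh.
have -> : f (z + h) - f z - D * h = - (D - h^-1 *: (f (h *: (1 : C^o) + z) - f z)) * h.
  rewrite -[h *: _]/(h * 1) -[h^-1 *: _]/(h^-1 * _) mulr1 (addrC h); field; exact: hn0.
by rewrite normcM normcN ler_wpM2r ?normc_ge0.
Qed.

Lemma cderiv_derivable f z D : cderiv f z D -> derivable (f : C^o -> C^o) z 1.
Proof.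
move=> hD; apply/cvg_ex; exists D; apply/cvgrPdist_le => e /gtc0_real[r r0 ->].
have [d d0 hd] := hD r r0.
apply/nbhs_ballP; exists d%:C; first by rewrite /= ltcR.
move=> h /=; rewrite /ball /= sub0r normrN normc_normr ltcR => hr hn0.
rewrite normc_normr lecR.
have hp : 0 < normc h.
  by rewrite lt_neqAle normc_ge0 andbT eq_sym; apply: contra hn0 => /eqP/eq0_normc ->.
rewrite -(ler_pM2r hp) -normcM (le_trans _ (hd h hr)) // -normcN.
rewrite -[h *: _]/(h * 1) -[h^-1 *: _]/(h^-1 * _) mulr1 (addrC h).
by rewrite le_eqVlt; apply/orP; left; apply/eqP; congr normc; field.
Qed.

Lemma cderiv_cst (c z : C) : cderiv (fun=> c) z 0.
Proof. by move=> e e0; exists 1 => // h _; rewrite subrr mul0r subr0 normc0 mulr_ge0 ?normc_ge0 // ltW. Qed.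

Lemma cderiv_id (z : C) : cderiv id z 1.
Proof.
move=> e e0; exists 1 => // h _.
by rewrite mul1r (addrC z) addrK subrr normc0 mulr_ge0 ?normc_ge0 // ltW.
Qed.

Lemma cderivD f g z D E : cderiv f z D -> cderiv g z E -> cderiv (fun w => f w + g w) z (D + E).
Proof.
move=> hf hg e e0; have e2 : 0 < e / 2 by rewrite divr_gt0.
have [d1 d10 h1] := hf _ e2; have [d2 d20 h2] := hg _ e2.
exists (Num.min d1 d2); first by rewrite lt_min d10.
move=> h; rewrite lt_min => /andP[/h1 k1 /h2 k2].
have -> : f (z + h) + g (z + h) - (f z + g z) - (D + E) * h =
  (f (z + h) - f z - D * h) + (g (z + h) - g z - E * h) by ring.
by apply: le_trans (le_normcD _ _) _; rewrite (le_trans (lerD k1 k2)) // -mulrDl -splitr.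
Qed.

Lemma cderiv_lipschitz f z D : cderiv f z D -> exists2 d : R, 0 < d &
  forall h, normc h < d -> normc (f (z + h) - f z) <= (normc D + 1) * normc h.
Proof.
move=> /(_ 1 ltr01)[d d0 hd]; exists d => // h /hd; rewrite mul1r => k.
rewrite -[f _ - _](subrK (D * h)) (le_trans (le_normcD _ _)) // normcM mulrDl mul1r addrC.
by rewrite lerD2l.
Qed.

Lemma cderivM f g z D E : cderiv f z D -> cderiv g z E ->
  cderiv (fun w => f w * g w) z (D * g z + f z * E).
Proof.
move=> hf hg e e0.
pose K := normc (g z) + normc (f z) + (normc D + 1) * (normc E + 1) + 1.
have D1 : 0 < normc D + 1 by rewrite ltr_wpDl ?normc_ge0.
have E1 : 0 < normc E + 1 by rewrite ltr_wpDl ?normc_ge0.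
have DE := mulr_gt0 D1 E1.
have K0 : 0 < K by have := normc_ge0 (g z); have := normc_ge0 (f z); rewrite /K; lra.
have e2 : 0 < e / K by rewrite divr_gt0.
have [d1 d10 h1] := hf _ e2; have [d2 d20 h2] := hg _ e2.
have [d3 d30 h3] := cderiv_lipschitz hf; have [d4 d40 h4] := cderiv_lipschitz hg.
exists (Num.min (Num.min d1 d2) (Num.min (Num.min d3 d4) (e / K))).
  by rewrite !lt_min d10 d20 d30 d40.
move=> h; rewrite !lt_min => /andP[/andP[/h1 k1 /h2 k2] /andP[/andP[/h3 k3 /h4 k4] k5]].
have -> : f (z + h) * g (z + h) - f z * g z - (D * g z + f z * E) * h =
  (f (z + h) - f z - D * h) * g z + f z * (g (z + h) - g z - E * h) +
  (f (z + h) - f z) * (g (z + h) - g z) by ring.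
have H0 := normc_ge0 h.
apply: (@le_trans _ _ (e / K * normc h * normc (g z) + normc (f z) * (e / K * normc h) +
   ((normc D + 1) * normc h) * ((normc E + 1) * normc h))).
  apply: le_trans (le_normcD _ _) _; apply: lerD; last by rewrite normcM ler_pM ?normc_ge0.
  apply: le_trans (le_normcD _ _) _; rewrite !normcM; apply: lerD.
    by rewrite ler_wpM2r ?normc_ge0.
  by rewrite ler_wpM2l ?normc_ge0.
have : normc h * normc h <= e / K * normc h by rewrite ler_wpM2r // ltW.
have -> : e * normc h = e / K * normc h * K by field; rewrite gt_eqF.
rewrite /K; set x := e / K * normc h => hx.
have x0 : 0 <= x by rewrite mulr_ge0 // ltW.
have : (normc D + 1) * (normc E + 1) * (normc h * normc h) <= (normc D + 1) * (normc E + 1) * x.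
  by rewrite ler_wpM2l // mulr_ge0 // ltW.
by nra.
Qed.

Lemma cderivV f z D : f z != 0 -> cderiv f z D ->
  cderiv (fun w => (f w)^-1) z (- D / (f z) ^+ 2).
Proof.
move=> fz hf e e0.
pose A := normc (f z).
have A0 : 0 < A by rewrite lt_neqAle normc_ge0 andbT eq_sym; apply: contra fz => /eqP/eq0_normc ->.
pose L := normc D + 1; have L0 : 0 < L by rewrite ltr_wpDl ?normc_ge0.
have e1 : 0 < e * A ^+ 2 / 4 by rewrite divr_gt0 // mulr_gt0 // exprn_gt0.
have [d1 d10 h1] := hf _ e1; have [d2 d20 h2] := cderiv_lipschitz hf.
pose d3 := Num.min (A / (2 * L)) (e * A ^+ 3 / (4 * L ^+ 2)).
have d30 : 0 < d3 by rewrite lt_min !divr_gt0 ?mulr_gt0 ?exprn_gt0.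
exists (Num.min (Num.min d1 d2) d3); first by rewrite lt_min d30 andbT lt_min d10.
move=> h; rewrite /d3 !lt_min => /andP[/andP[/h1 k1 /h2 k2] /andP[k3 k4]].
have H0 := normc_ge0 h.
have low : A / 2 <= normc (f (z + h)).
  have : A <= normc (f (z + h)) + normc (f (z + h) - f z).
    rewrite /A -[normc (_ - _)]normcN opprB -[X in normc X <= _](subrKC (f (z + h))).
    exact: le_normcD.
  move: k3; rewrite ltr_pdivlMr ?mulr_gt0 // -/L in k2 * => k3.
  lra.
have B0 : 0 < normc (f (z + h)) by rewrite (lt_le_trans _ low) // divr_gt0.
have fzh : f (z + h) != 0 by apply: contraTneq B0 => ->; rewrite normc0 ltxx.
have -> : (f (z + h))^-1 - (f z)^-1 - - D / f z ^+ 2 * h =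
  (- (f (z + h) - f z - D * h) * f z + (f (z + h) - f z) * (D * h)) / (f (z + h) * f z ^+ 2)
  + 0 by field; rewrite fz.
rewrite addr0 normcM normcV.
have nden : normc (f (z + h) * f z ^+ 2) = normc (f (z + h)) * A ^+ 2.
  by rewrite normcM expr2 normcM -expr2.
rewrite nden ler_pdivrMr; last by rewrite mulr_gt0 // exprn_gt0.
apply: (@le_trans _ _ (e * A ^+ 2 / 4 * normc h * A + (L * normc h) * (L * normc h))).
  apply: le_trans (le_normcD _ _) _; apply: lerD.
    by rewrite normcM normcN ler_wpM2r ?normc_ge0.
  rewrite normcM ler_pM ?normc_ge0 //; rewrite normcM ler_wpM2r //.
  by rewrite /L lerDl.
apply: (@le_trans _ _ (e * normc h * (A / 2 * A ^+ 2))); last first.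
  by rewrite ler_wpM2l ?mulr_ge0 ?(ltW e0) // ler_wpM2r // sqr_ge0.
have : L ^+ 2 * normc h <= e * A ^+ 3 / 4.
  move: k4; rewrite ltr_pdivlMr ?mulr_gt0 ?exprn_gt0 // => k4; lra.
move=> k6; have : L ^+ 2 * normc h * normc h <= e * A ^+ 3 / 4 * normc h by rewrite ler_wpM2r.
have -> : A ^+ 3 = A * A ^+ 2 by rewrite exprS.
by lra.
Qed.

Lemma cderiv_ext f g z D (d : R) : 0 < d -> (forall h, normc h < d -> f (z + h) = g (z + h)) ->
  cderiv f z D -> cderiv g z D.
Proof.
move=> d0 fg hf e e0; have [d1 d10 h1] := hf e e0.
exists (Num.min d d1); first by rewrite lt_min d0.
move=> h; rewrite lt_min => /andP[hd /h1].
have := fg 0; rewrite normc0 addr0 => /(_ d0) <-.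
by rewrite (fg _ hd).
Qed.

Lemma cderiv_affine f (a b z D : C) : cderiv f (a * z + b) D ->
  cderiv (fun w => f (a * w + b)) z (D * a).
Proof.
move=> hf e e0; have a1 : 0 < normc a + 1 by rewrite ltr_wpDl ?normc_ge0.
have [d d0 hd] := hf _ (divr_gt0 e0 a1).
exists (d / (normc a + 1)); first by rewrite divr_gt0.
move=> h; rewrite ltr_pdivlMr // => hh; have H0 := normc_ge0 h; have A0 := normc_ge0 a.
have ah : normc (a * h) < d by rewrite normcM (le_lt_trans _ hh) // mulrC ler_wpM2l // lerDl.
have := hd _ ah; have -> : a * z + b + a * h = a * (z + h) + b by ring.
rewrite mulrA => /le_trans; apply.
rewrite normcM.
have -> : e / (normc a + 1) * (normc a * normc h) = (e * normc h) * (normc a / (normc a + 1)).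
  by field; rewrite gt_eqF.
by rewrite ler_piMr ?mulr_ge0 ?(ltW e0) // ler_pdivrMr // mul1r lerDl.
Qed.

Lemma cderiv_conj f z D : cderiv f (z^*) D -> cderiv (fun w => (f (w^*))^*) z (D^*).
Proof.
move=> hf e e0; have [d d0 hd] := hf e e0; exists d => // h hh.
have := hd (h^*); rewrite normc_conj => /(_ hh).
rewrite -(@normc_conj _ (_ - _)) !rmorphB rmorphM /= conjcK.
by rewrite rmorphD.
Qed.

Lemma cderiv_cexp z : cderiv (@cexp R) z (cexp z).
Proof.
move=> e e0; pose A := normc (cexp z).
have A0 : 0 < A by rewrite /A normc_cexp expR_gt0.
exists (Num.min (2^-1) (e / (3 * A))); first by rewrite lt_min invr_gt0 ltr0n divr_gt0 // mulr_gt0.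
move=> h; rewrite lt_min => /andP[/ltW h1 h2].
have -> : cexp (z + h) - cexp z - cexp z * h = cexp z * (cexp h - 1 - h) by rewrite cexpD; ring.
rewrite normcM -/A.
have k := cexp_taylor1 h1; have H0 := normc_ge0 h.
apply: (@le_trans _ _ (A * (3 * normc h ^+ 2))); first by rewrite ler_wpM2l // ltW.
move: h2; rewrite ltr_pdivlMr ?mulr_gt0 // => h2.
by rewrite expr2; nra.
Qed.

Lemma cderiv_continuous_within f z D : cderiv f z D -> forall e : R, 0 < e -> exists2 d : R, 0 < d &
  forall h, normc h < d -> normc (f (z + h) - f z) < e.
Proof.
move=> /cderiv_lipschitz[d d0 hd] e e0.
have L0 : 0 < normc D + 1 by rewrite ltr_wpDl ?normc_ge0.
exists (Num.min d (e / (normc D + 1))); first by rewrite lt_min d0 divr_gt0.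
move=> h; rewrite lt_min => /andP[/hd k]; rewrite ltr_pdivlMr // => k2.
by rewrite (le_lt_trans k) // mulrC.
Qed.

End ComplexDerivative.

(** * Moving the line of integration *)

Section ContourShift.
Variable R : realType.
Local Notation C := R[i].
Local Notation mu := (@lebesgue_measure R).

Lemma integrable_even_FTC (f F : R -> R) (l : R) : (forall x, 0 <= f x) -> continuous f ->
  (forall x, f (- x) = f x) -> (forall x : R, 0 < x -> is_derive x 1 F (f x)) ->
  F x @[x --> 0^'+] --> F 0 -> F x @[x --> +oo] --> l ->
  mu.-integrable setT (EFin \o f).
Proof.
move=> f0 cf ef dF F0 Fl; apply/integrableP; split.
  by apply/measurable_EFinP; exact: continuous_measurable_fun.
have -> : (\int[mu]_x `|(EFin \o f) x| = \int[mu]_x (f x)%:E)%E.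
  by apply: eq_integral => x _ /=; rewrite ger0_norm.
rewrite ge0_symfun_integralT //; last by move=> x /=; rewrite ef.
rewrite (_ : [set x | 0 <= x] = `[0, +oo[%classic); last first.
  by apply/seteqP; split => x /=; rewrite in_itv /= andbT.
rewrite (@ge0_continuous_FTC2y _ f F 0 l) //.
- by rewrite -EFinB -EFinM ltry.
- exact: continuous_subspaceT.
- by move=> x /dF h; exact: ex_derive.
- by move=> x; rewrite in_itv /= andbT => /dF h; rewrite derive1E; exact: derive_val.
Qed.

Lemma continuous_normr : continuous (fun x : R => `|x|).
Proof. by move=> x; exact: norm_continuous. Qed.

Lemma integrable_exp_norm : mu.-integrable setT (EFin \o (fun x : R => expR (- `|x|))).
Proof.
have hd (x : R) : is_derive x 1 (fun y : R => - expR (- y)) (expR (- x)).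
  have h := is_derive_opp (is_derive_exp (is_derive_opp (is_derive_var x))).
  by apply: (is_derive_eq h); rewrite mulrN1 opprK.
apply: (@integrable_even_FTC _ (fun x => - expR (- x)) 0).
- by move=> x; exact: expR_ge0.
- move=> x; apply: continuous_comp; last exact: continuous_expR.
  by apply: continuous_comp; [exact: continuous_normr | exact: opp_continuous].
- by move=> x; rewrite normrN.
- by move=> x x0; rewrite gtr0_norm.
- by apply: cvg_at_right_filter; exact: (derive_continuous hd).
- by rewrite -[X in _ --> X]oppr0; apply: cvgN; exact: cvgr_expR.
Qed.

Lemma Rintegral_cvg_itv (f : R -> R) : mu.-integrable setT (EFin \o f) ->
  \int[mu]_(x in `[- n%:R, n%:R]) f x @[n --> \oo] --> \int[mu]_x f x.
Proof.
move=> hf; have /integrableP[/measurable_EFinP mf _] := hf.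
under eq_fun do rewrite Rintegral_mkcond.
apply: (proj2 (@Rintegral_dct _ _ f (fun x => `|f x|) _ _ _ _)).
- move=> n; apply/(measurable_restrictT _ _).1 => //.
  exact: measurable_funTS.
- move=> x; apply: (@cvg_near_cst _ _ _ _ _) => //; near=> n.
  rewrite patchE ifT // inE /= in_itv /= -ler_norml.
  near: n; exact: nbhs_infty_ger.
- exact: (integrable_abse hf).
- by move=> n x; rewrite patchE; case: ifP => // _; rewrite normr0.
Unshelve. all: by end_near.
Qed.

(** The Cauchy-Riemann equations: for [F = u + i v] the form [F dz] has real part [u dx - v dy] and
    imaginary part [v dx + u dy], both closed. *)
Lemma closed_form_cderiv (F : C -> C) x0 y0 D : cderiv F (x0 +i* y0) D ->
  closed_form_at (fun x y => complex.Re (F (x +i* y))) (fun x y => - complex.Im (F (x +i* y))) x0 y0 /\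
  closed_form_at (fun x y => complex.Im (F (x +i* y))) (fun x y => complex.Re (F (x +i* y))) x0 y0.
Proof.
case: D => p q hF.
have key e : 0 < e -> exists2 d : R, 0 < d & forall x y : R,
    `|x - x0| < d -> `|y - y0| < d ->
    `|complex.Re (F (x +i* y)) - (complex.Re (F (x0 +i* y0)) + p * (x - x0) - q * (y - y0))| <= e * (`|x - x0| + `|y - y0|) /\
    `|complex.Im (F (x +i* y)) - (complex.Im (F (x0 +i* y0)) + q * (x - x0) + p * (y - y0))| <= e * (`|x - x0| + `|y - y0|).
  move=> e0; have [d d0 hd] := hF e e0; exists (d / 2); first by rewrite divr_gt0.
  move=> x y hx hy; pose h : C := (x - x0) +i* (y - y0).
  have nh : normc h <= `|x - x0| + `|y - y0| by exact: normc_ler_ReIm.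
  have hh : normc h < d by apply: le_lt_trans nh _; rewrite [ltRHS](splitr d) ltrD.
  have e1 : x0 +i* y0 + h = x +i* y.
    by apply/eqP; rewrite eq_complex /=; apply/andP; split; apply/eqP; ring.
  have := hd h hh; rewrite e1 => k.
  have k2 : e * normc h <= e * (`|x - x0| + `|y - y0|) by rewrite ler_wpM2l // ltW.
  have kR := le_trans (normc_lerRe _) (le_trans k k2).
  have kI := le_trans (normc_lerIm _) (le_trans k k2).
  move: kR kI; rewrite !(Re_sub, Im_sub, Re_mul, Im_mul) /= => kR kI; split.
    by apply: le_trans kR; rewrite le_eqVlt; apply/orP; left; apply/eqP; congr `|_|; ring.
  by apply: le_trans kI; rewrite le_eqVlt; apply/orP; left; apply/eqP; congr `|_|; ring.
split.
  exists p, (- q), (- p) => e /key[d d0 hd]; exists d => // x y hx hy.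
  have [A B] := hd x y hx hy; split.
    by apply: le_trans A; rewrite mulNr.
  apply: le_trans B; rewrite -normrN le_eqVlt; apply/orP; left; apply/eqP; congr `|_|; ring.
exists q, p, (- q) => e /key[d d0 hd]; exists d => // x y hx hy.
have [A B] := hd x y hx hy; split=> //.
by apply: le_trans A; rewrite mulNr.
Qed.

Lemma cmeasurable_line (F : C -> C) (y : R) : (forall x, exists D, cderiv F (x +i* y) D) ->
  cmeasurable (fun x : R => F (x +i* y)).
Proof.
move=> h.
have cont x e : 0 < e -> \forall t \near x, normc (F (x +i* y) - F (t +i* y)) < e.
  move=> e0; have [D hD] := h x; have [d d0 hd] := cderiv_continuous_within hD e0.
  apply/nbhs_ballP; exists d => //= t tx.
  rewrite -normcN opprB.
  have -> : t +i* y = x +i* y + (t - x)%:C.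
    by apply/eqP; rewrite eq_complex /=; apply/andP; split; apply/eqP; ring.
  by apply: hd; rewrite normc_real distrC.
split; apply: continuous_measurable_fun => x; apply/cvgrPdist_lt => e e0.
  by apply: filterS (cont x e e0) => t; rewrite -Re_sub; exact: le_lt_trans (normc_lerRe _).
by apply: filterS (cont x e e0) => t; rewrite -Im_sub; exact: le_lt_trans (normc_lerIm _).
Qed.

(** Goursat's theorem on [[-n, n] x [c, d]]; the integrals over the vertical sides are
    [O(expR (- n))], while the horizontal ones tend to the integrals over the two lines. *)
Lemma contour_shift (F : C -> C) (y1 y2 c d K : R) : c <= d -> y1 < c -> d < y2 ->
  (forall z, y1 < complex.Im z < y2 -> exists D, cderiv F z D) ->
  (forall x y, c <= y <= d -> normc (F (x +i* y)) <= K * expR (- `|x|)) ->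
  cintegral (fun x => F (x +i* c)) = cintegral (fun x => F (x +i* d)).
Proof.
move=> cd hc hd hF hK.
have int_line y : c <= y <= d -> cintegrable (fun x => F (x +i* y)).
  move=> hy; apply: (@cintegrable_dom _ _ (fun x => K * expR (- `|x|) + 0 * expR (- `|x|))).
  - apply: cmeasurable_line => x; apply: hF; rewrite /=.
    by move: hy => /andP[a b]; rewrite (lt_le_trans hc) // (le_lt_trans b).
  - by apply: integrable_lin; exact: integrable_exp_norm.
  - by move=> x; rewrite mul0r addr0; exact: hK.
have [uc vc] := int_line c (introT andP (conj (lexx c) cd)).
have [ud vd] := int_line d (introT andP (conj cd (lexx d))).
have shift (P Q : R -> R -> R) :
    (forall x0 y0, y1 < y0 < y2 -> closed_form_at P Q x0 y0) ->
    (forall x y, c <= y <= d -> `|Q x y| <= K * expR (- `|x|)) ->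
    mu.-integrable setT (EFin \o (fun x => P x c)) ->
    mu.-integrable setT (EFin \o (fun x => P x d)) ->
    \int[mu]_x P x c = \int[mu]_x P x d.
  move=> hPQ hQ ic jd.
  have lc := Rintegral_cvg_itv ic; have ld := Rintegral_cvg_itv jd.
  have hsmall n : `|\int[mu]_(x in `[- n%:R, n%:R]) P x c - \int[mu]_(x in `[- n%:R, n%:R]) P x d|
      <= 2 * (d - c) * K * expR (- n%:R).
    have nn : - n%:R <= n%:R :> R by rewrite (@le_trans _ _ 0) // oppr_le0.
    have := goursat_rectangle hPQ nn cd hc hd; rewrite /circulation.
    have iQ x0 : mu.-integrable `[c, d] (EFin \o (Q x0)).
      apply: continuous_compact_integrable; first exact: segment_compact.
      apply: continuous_in_subspaceT => y; rewrite inE /= in_itv /= => /andP[cy yd].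
      by apply: (closed_form_continuous_y hPQ); rewrite (lt_le_trans hc) // (le_lt_trans yd).
    have b x0 : `|x0| = n%:R -> `|\int[mu]_(y in `[c, d]) Q x0 y| <= K * expR (- n%:R) * (d - c).
      move=> ex0; have := @Rintegral_dist _ (Q x0) c d 0 (K * expR (- n%:R)) cd (iQ x0).
      rewrite mul0r subr0; apply=> t ht; rewrite subr0 -ex0; exact: hQ.
    have nb : `|- n%:R| = n%:R :> R by rewrite normrN ger0_norm.
    have := b n%:R (ger0_norm (ler0n _ _)); have := b (- n%:R) nb.
    clear; rewrite !ler_norml => /andP[? ?] /andP[? ?] ?; apply/andP; split; lra.
  have lim0 : 2 * (d - c) * K * expR (- n%:R) @[n --> \oo] --> (0 : R).
    rewrite -[X in _ --> X](mulr0 (2 * (d - c) * K)); apply: cvgM; first exact: cvg_cst.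
    exact: cvgn_expR.
  have lim0' : \int[mu]_(x in `[- n%:R, n%:R]) P x c - \int[mu]_(x in `[- n%:R, n%:R]) P x d
     @[n --> \oo] --> (0 : R).
    apply/norm_cvg0P; apply: (@squeeze_cvgr _ _ _ _ (fun=> 0) _ _ _ _ (cvg_cst _) lim0).
    by near=> n; rewrite normr_ge0 hsmall.
  apply/eqP; rewrite -subr_eq0; apply/eqP.
  exact: (cvg_unique (@Rhausdorff R) (cvgB lc ld) lim0').
rewrite /cintegral; congr (_ +i* _).
  apply: (shift (fun x y => complex.Re (F (x +i* y))) (fun x y => - complex.Im (F (x +i* y)))) => //.
    move=> x0 y0 hy; have [D hD] := hF (x0 +i* y0) hy; exact: (closed_form_cderiv hD).1.
  by move=> x y hy; rewrite normrN (le_trans (normc_lerIm _)) // hK.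
apply: (shift (fun x y => complex.Im (F (x +i* y))) (fun x y => complex.Re (F (x +i* y)))) => //.
  move=> x0 y0 hy; have [D hD] := hF (x0 +i* y0) hy; exact: (closed_form_cderiv hD).2.
by move=> x y hy; rewrite (le_trans (normc_lerRe _)) // hK.
Unshelve. all: by end_near.
Qed.

End ContourShift.

(** * Growth estimates *)

Section Domain.
Variable R : realType.
Local Notation C := R[i].
Local Notation mu := (@lebesgue_measure R).

(* [expR (p * lnp s)] is [(1 + |s|) `^ p]. *)
Definition lnp (s : R) : R := ln (1 + `|s|).

Lemma lnp_ge0 s : 0 <= lnp s.
Proof. by rewrite ln_ge0 // lerDl. Qed.

Lemma lnpN s : lnp (- s) = lnp s.
Proof. by rewrite /lnp normrN. Qed.

Lemma expR_lnp s : expR (lnp s) = 1 + `|s|.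
Proof. by rewrite lnK // posrE ltr_pwDl. Qed.

Lemma expR_lnpX (n : nat) s : expR (n%:R * lnp s) = (1 + `|s|) ^+ n.
Proof. by rewrite expRM_natl expR_lnp. Qed.

Lemma le_expR_lnp s p q : p <= q -> expR (p * lnp s) <= expR (q * lnp s).
Proof. by move=> pq; rewrite ler_expR ler_wpM2r // lnp_ge0. Qed.

Lemma continuous_lnp : continuous lnp.
Proof.
move=> s; apply: (@continuous_comp _ _ _ (fun s : R => 1 + `|s|) (@ln R)).
  by apply: cvgD; [exact: cvg_cst | exact: continuous_normr].
by apply: continuous_ln; rewrite ltr_pwDl.
Qed.

Lemma is_derive_continuous_at (f : R -> R) (x a : R) : is_derive x 1 f a -> f @ x --> f x.
Proof.
by move=> h; apply: differentiable_continuous; apply/derivable1_diffP; exact: ex_derive.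
Qed.

Lemma integrable_lnp (e : R) : 0 < e ->
  mu.-integrable setT (EFin \o (fun s : R => expR (- (1 + e) * lnp s))).
Proof.
move=> e0.
have hd (x : R) : -1 < x -> is_derive x 1 (fun y : R => - e^-1 * expR (- e * ln (1 + y)))
    (expR (- (1 + e) * ln (1 + x))).
  move=> x1; have x0 : 0 < 1 + x by lra.
  have hln : is_derive x 1 (fun y : R => ln (1 + y)) ((1 + x)^-1 * (0 + 1)).
    have h0 : is_derive (1 + x) 1 (@ln R) (1 + x)^-1 by exact: is_derive1_ln.
    exact: (@is_derive1_comp _ (@ln R) (fun y => 1 + y) x _ _ h0
      (is_derive_add (is_derive_const 1 x) (is_derive_var x))).
  have h := is_derive_mul (is_derive_const (- e^-1) x)
    (is_derive_exp (is_derive_mul (is_derive_const (- e) x) hln)).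
  apply: (is_derive_eq h).
  have -> : - (1 + e) * ln (1 + x) = - ln (1 + x) + - e * ln (1 + x) by ring.
  rewrite expRD expRN lnK ?posrE //; field; lra.
apply: (@integrable_even_FTC R (fun s : R => expR (- (1 + e) * lnp s))
  (fun y : R => - e^-1 * expR (- e * ln (1 + y))) 0).
- by move=> x; exact: expR_ge0.
- move=> x; apply: continuous_comp; last exact: continuous_expR.
  by apply: cvgM; [exact: cvg_cst | exact: continuous_lnp].
- by move=> x; rewrite lnpN.
- move=> x x0; have h := hd x (lt_trans (ltrN10 R) x0).
  by rewrite /lnp (gtr0_norm x0); exact: h.
- apply: cvg_at_right_filter.
  have h0 := hd 0 (ltrN10 R).
  exact: (is_derive_continuous_at h0).
- rewrite -[X in _ --> X](mulr0 (- e^-1)); apply: cvgM; first exact: cvg_cst.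
  apply/cvgrPdist_lt => d d0; near=> x.
  rewrite sub0r normrN ger0_norm ?expR_ge0 //.
  have x0 : 0 < x by near: x; exact: nbhs_pinfty_gt.
  have xd : expR (- (ln d / e)) < x by near: x; apply: nbhs_pinfty_gt; exact: num_real.
  rewrite -[ltRHS](@lnK _ d) ?posrE // ltr_expR mulNr ltrNl.
  rewrite -ltr_pdivrMl // mulrC mulNr.
  rewrite -[ltLHS]expRK ltr_ln ?posrE ?expR_gt0 //; last by lra.
  by rewrite (lt_trans xd) // ltrDr.
Unshelve. all: by end_near.
Qed.

Lemma measurable_funV_ge0 (f : R -> R) : measurable_fun setT f -> (forall s, 0 <= f s) ->
  measurable_fun setT (fun s => (f s)^-1).
Proof.
move=> mf f0; rewrite (_ : (fun s => _) = (fun s => f s `^ (-1))).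
  exact: (measurableT_comp (measurable_powR _)).
by apply/funext => s; rewrite powR_inv1.
Qed.

Lemma cmeasurableV (f : R -> C) : cmeasurable f -> cmeasurable (fun s => (f s)^-1).
Proof.
move=> [f1 f2].
have mN : measurable_fun setT (fun s => (complex.Re (f s) ^+ 2 + complex.Im (f s) ^+ 2)^-1).
  apply: measurable_funV_ge0 => [|s]; last by rewrite addr_ge0 // sqr_ge0.
  by apply: measurable_funD; exact: measurable_funX.
split.
  rewrite (_ : (fun s => _) = (fun s => complex.Re (f s) * (complex.Re (f s) ^+ 2 + complex.Im (f s) ^+ 2)^-1)).
    exact: measurable_funM.
  by apply/funext => s; case: (f s).
rewrite (_ : (fun s => _) = (fun s => (- complex.Im (f s)) * (complex.Re (f s) ^+ 2 + complex.Im (f s) ^+ 2)^-1)).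
  by apply: measurable_funM => //; exact: measurableT_comp.
by apply/funext => s; case: (f s) => x y /=; rewrite mulNr.
Qed.

Definition cdiff (f : C -> C) (z : C) := exists D, cderiv f z D.

Lemma cdiff_continuous_box (f : C -> C) (A B : R) :
  (forall x y, `|y| <= B -> cdiff f (x +i* y)) ->
  exists M : R, forall x y, `|x| <= A -> `|y| <= B -> normc (f (x +i* y)) <= M.
Proof.
move=> hf.
pose K : set (R * R) := `[- A, A]%classic `*` `[- B, B]%classic.
pose g (p : R * R) : R := normc (f (p.1 +i* p.2)).
have cK : compact K by apply: compact_setX; exact: segment_compact.
have cg : {within K, continuous g}.
  apply: continuous_in_subspaceT => -[x y]; rewrite inE => -[_ /=]; rewrite in_itv /= -ler_norml => hy.
  have [D hD] := hf x y hy.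
  apply/cvgrPdist_lt => e e0; have [d d0 hd] := cderiv_continuous_within hD e0.
  exists (ball x (d / 2), ball y (d / 2)).
    by split; apply: nbhsx_ballx; rewrite divr_gt0.
  move=> [x' y'] [/= hx' hy'].
  have := hd ((x' - x) +i* (y' - y)); rewrite (_ : x +i* y + _ = x' +i* y'); last first.
    by apply/eqP; rewrite eq_complex /=; apply/andP; split; apply/eqP; ring.
  move=> h; rewrite /g /=.
  have : normc (f (x' +i* y') - f (x +i* y)) < e.
    apply: h; apply: le_lt_trans (normc_ler_ReIm _) _; rewrite /= [ltRHS](splitr d).
    by rewrite ltrD // distrC.
  apply: le_lt_trans; rewrite ler_norml; apply/andP; split.
    rewrite lerNl opprB lerBlDr -[X in normc X <= _](subrK (f (x +i* y))).
    exact: le_normcD.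
  rewrite lerBlDr -[X in _ <= X + _]normcN opprB -[X in normc X <= _](subrK (f (x' +i* y'))).
  exact: le_normcD.
have := compact_bounded (continuous_compact cg cK).
move=> [M [Mr hM]]; exists (M + 1) => x y hx hy.
have gK : [set g x | x in K] (g (x, y)).
  by exists (x, y) => //; split => /=; rewrite in_itv /= -ler_norml.
have := hM (M + 1) _ _ gK.
by rewrite ltrDl ltr01 => /(_ isT) /=; rewrite ger0_norm // normc_ge0.
Qed.

Variable rho : R.
Hypothesis hrho : rho < 2^-1.

Lemma domainH_cdiff f : domainH rho f -> exists2 d : R, 0 < d &
  (forall z, `|complex.Im z| < 1 + d -> f (- z) = f z) /\
  (forall z, `|complex.Im z| < 1 + d -> cdiff f z).
Proof.
by move=> [d d0 [h1 h2 _]]; exists d => //; split=> // z hz; apply: derivable_cderiv; exact: h2.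
Qed.

(** The growth condition concerns large [|Re z|] only; on the remaining compact box continuity
    bounds [f]. The bound in [1 + |x|], valid for all [x] and uniform in [y], serves as a majorant
    on each line. *)
Lemma domainH_bound f : domainH rho f -> exists2 e : R, 0 < e & exists2 K : R, 0 <= K &
  forall x y, `|y| <= 1 ->
    normc (f (x +i* y)) <= K * expR ((rho - 2 - e) * lnp x) * expR (- (pi * `|x| / 2)).
Proof.
move=> hf; have [d d0 [_ hd]] := domainH_cdiff hf.
move: hf => [_ _ [_ _ [e e0 [A [B hB]]]]]; exists e => //.
have q0 : 0 < - (rho - 2 - e) by move: (hrho) (e0 : 0 < e :> R); lra.
pose A' := Num.max 1 A.
have [M hM] := @cdiff_continuous_box f A' 1 (fun x y hy => hd (x +i* y) (le_lt_trans hy (ltr_pwDr d0 (lexx 1)))).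
set q := rho - 2 - e in q0 *.
(* The least value of the majorant on [|x| <= A'], attained at the end because the exponent [q] is
   negative. *)
pose c := expR (q * lnp A') * expR (- (pi * A' / 2)).
have c0 : 0 < c by rewrite mulr_gt0 // expR_gt0.
(* In [K2] the power of 2 comes from [1 + |x| <= 2 |z|], valid for [|x| >= 1], raised to the
   negative exponent [q]. *)
pose K1 := `|M| / c; pose K2 := `|B| * expR (- q * ln 2).
have K10 : 0 <= K1 by rewrite divr_ge0 // ltW.
have K20 : 0 <= K2 by rewrite mulr_ge0 // expR_ge0.
exists (K1 + K2); first exact: addr_ge0.
move=> x y hy; rewrite (mulrDl K1 K2) [leRHS]mulrDl.
have E1 := expR_ge0 (q * lnp x); have E2 := expR_ge0 (- (pi * `|x| / 2)).
have [xA|Ax] := leP `|x| A'.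
  apply: (@le_trans _ _ (K1 * expR (q * lnp x) * expR (- (pi * `|x| / 2)))); last first.
    by rewrite lerDl; exact: (mulr_ge0 (mulr_ge0 K20 E1) E2).
  apply: le_trans (hM x y xA hy) _; apply: le_trans (ler_norm _) _.
  rewrite /K1 -mulrA mulrAC ler_pdivlMr // ler_wpM2l //.
  have A0 : 0 <= A' by rewrite le_max ler01.
  rewrite ler_pM ?expR_ge0 // ler_expR.
    rewrite -[leLHS]opprK -mulNr lerNl -mulNr ler_wpM2l ?(ltW q0) // ler_ln ?posrE ?ltr_pwDl // lerD2l.
    by rewrite (ger0_norm A0).
  by rewrite lerN2 ler_wpM2r // ler_wpM2l // pi_ge0.
apply: (@le_trans _ _ (K2 * expR (q * lnp x) * expR (- (pi * `|x| / 2)))); last first.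
  by rewrite lerDr; exact: (mulr_ge0 (mulr_ge0 K10 E1) E2).
have x1 : 1 <= `|x| by rewrite ltW // (le_lt_trans _ Ax) // le_max lexx.
have xA : A <= `|x| by rewrite ltW // (le_lt_trans _ Ax) // le_max lexx orbT.
apply: le_trans (hB (x +i* y) hy xA) _; rewrite ler_wpM2r //.
apply: (@le_trans _ _ (`|B| * normc (x +i* y) `^ q)).
  by rewrite ler_wpM2r ?powR_ge0 // ler_norm.
rewrite /K2 -mulrA ler_wpM2l // -expRD.
have nx : `|x| <= normc (x +i* y) by exact: (normc_lerRe (x +i* y)).
have n0 : 0 < normc (x +i* y) by rewrite (lt_le_trans ltr01) // (le_trans x1).
rewrite /powR gt_eqF // ler_expR -subr_ge0.
have -> : - q * ln 2 + q * lnp x - q * ln (normc (x +i* y)) =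
   - q * (ln 2 + ln (normc (x +i* y)) - lnp x) by ring.
rewrite mulr_ge0 ?(ltW q0) // subr_ge0 -lnM ?posrE // ler_ln ?posrE ?mulr_gt0 ?ltr_pwDl //.
lra.
Qed.

Lemma weight_bound : exists (M N : nat) (K : R), [/\ M%:R <= 2^-1 - rho, 0 <= K &
  forall n s, (N <= n)%N -> wgt (2^-1 - rho) n s <=
    K * s ^+ 2 * expR ((2 * M)%:R * lnp s) * expR (pi * `|s|)].
Proof.
have a0 : 0 < 2^-1 - rho by rewrite subr_gt0.
have [M [N [K [MK hK]]]] := wgt_le a0.
have K0 : 0 <= K.
  have := le_trans (wgt_ge0 _ _ _) (hK N 1 (leqnn _)).
  by rewrite expr1n mulr1 -mulrA pmulr_lge0 // mulr_gt0 ?expR_gt0 // exprn_gt0.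
exists M, N, K; split=> // n s Nn; apply: le_trans (hK n s Nn) _.
rewrite ler_wpM2r ?expR_ge0 // ler_wpM2l ?(mulr_ge0 K0 (sqr_ge0 s)) //.
rewrite expR_lnpX exprM lerXn2r ?nnegrE ?exprn_ge0 ?addr_ge0 ?sqr_ge0 //.
by rewrite sqrrD expr1n sqr_absr lerD2r lerDl mulrn_wge0 // mul1r.
Qed.

Lemma weight_le (M N : nat) (K : R) :
  (forall n s, (N <= n)%N -> wgt (2^-1 - rho) n s <=
    K * s ^+ 2 * expR ((2 * M)%:R * lnp s) * expR (pi * `|s|)) ->
  forall s, weight rho s <= K * s ^+ 2 * expR ((2 * M)%:R * lnp s) * expR (pi * `|s|).
Proof.
move=> h s; have hw : wgt (2^-1 - rho) n s @[n --> \oo] --> (weight rho s : R) := @wgt_cvg R rho s hrho.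
apply: (cvgr_to_le hw); near=> n.
by apply: h; near: n; exact: nbhs_infty_ge.
Unshelve. all: by end_near.
Qed.

Lemma measurable_wgt a n : measurable_fun setT (@wgt R a n).
Proof.
apply: measurable_funM; first exact: measurable_cst.
have mX : measurable_fun setT (fun s : R => s ^+ 2) by exact: exprn_measurable.
elim: n.+1 => [|m IH].
  by under eq_fun do rewrite big_ord0; exact: measurable_cst.
under eq_fun do rewrite big_ord_recr /=; apply: measurable_funM => //.
apply: measurable_funM.
  apply: measurable_funD; first exact: measurable_cst.
  by apply: measurable_funM => //; exact: measurable_cst.
apply: measurable_funV_ge0 => [|s]; last by rewrite addr_ge0 // sqr_ge0.
by apply: measurable_funD => //; exact: measurable_cst.
Qed.

Lemma measurable_weight : measurable_fun setT (weight rho).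
Proof.
apply: (@measurable_fun_cvg _ _ _ _ (fun n => wgt (2^-1 - rho) n)).
  by move=> n; exact: measurable_wgt.
by move=> s _; exact: wgt_cvg.
Qed.

Lemma weightN s : weight rho (- s) = weight rho s.
Proof.
have hw : wgt (2^-1 - rho) n (- s) @[n --> \oo] --> (weight rho (- s) : R) := @wgt_cvg R rho (- s) hrho.
have e : (fun n => wgt (2^-1 - rho) n (- s)) = (fun n => wgt (2^-1 - rho) n s).
  by apply/funext => n; exact: wgtN.
rewrite e in hw; exact: (cvg_unique (@Rhausdorff R) hw (@wgt_cvg R rho s hrho)).
Qed.

End Domain.

(** * The difference operator on its domain *)

Section ComplexSequences.
Variable R : realType.
Local Notation C := R[i].
Local Notation mu := (@lebesgue_measure R).

Definition ccvg (u : nat -> C) (l : C) := normc (u n - l) @[n --> \oo] --> (0 : R).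

Lemma squeeze0 (u v : nat -> R) : (forall n, 0 <= u n <= v n) ->
  v n @[n --> \oo] --> (0 : R) -> u n @[n --> \oo] --> (0 : R).
Proof.
move=> uv hv; apply: (squeeze_cvgr _ (cvg_cst (0 : R)) hv).
by near=> n; exact: uv.
Unshelve. all: by end_near.
Qed.

Lemma ccvg_le (u : nat -> C) (l : C) (v : nat -> R) : (forall n, normc (u n - l) <= v n) ->
  v n @[n --> \oo] --> (0 : R) -> ccvg u l.
Proof. by move=> h; apply: squeeze0 => n; rewrite normc_ge0 h. Qed.

Lemma ccvg_cst (l : C) : ccvg (fun=> l) l.
Proof. by rewrite /ccvg; under eq_fun do rewrite subrr normc0; exact: cvg_cst. Qed.

Lemma ccvg_real (u : nat -> R) (l : R) : u n @[n --> \oo] --> l -> ccvg (fun n => (u n)%:C) l%:C.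
Proof.
move=> h; rewrite /ccvg; under eq_fun do rewrite -rmorphB normc_real.
have h2 : (fun n => u n - l) @ \oo --> (0 : R).
  by rewrite -(subrr l); apply: cvgB => //; exact: cvg_cst.
by have h3 := cvg_norm h2; rewrite normr0 in h3; exact: h3.
Qed.

Lemma ccvgM (u v : nat -> C) (l m : C) : ccvg u l -> ccvg v m ->
  ccvg (fun n => u n * v n) (l * m).
Proof.
move=> hu hv.
apply: (@ccvg_le _ _ (fun n => normc (u n - l) * normc (v n - m) + normc l * normc (v n - m)
   + normc m * normc (u n - l))).
  move=> n; rewrite -!normcM.
  have -> : u n * v n - l * m = (u n - l) * (v n - m) + l * (v n - m) + m * (u n - l) by ring.
  by apply: le_trans (le_normcD _ _) _; rewrite lerD2r le_normcD.
rewrite (_ : 0 = 0 * 0 + normc l * 0 + normc m * 0); last by rewrite !mulr0 !addr0.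
by apply: cvgD; [apply: cvgD|]; apply: cvgM => //; exact: cvg_cst.
Qed.

Lemma ccvg_Re (u : nat -> C) l : ccvg u l -> complex.Re (u n) @[n --> \oo] --> complex.Re l.
Proof.
move=> h; apply/cvgrPdist_lt => e e0; move/cvgrPdist_lt: h => /(_ _ e0).
apply: filterS => n; rewrite sub0r normrN ger0_norm ?normc_ge0 // => h.
by rewrite distrC -Re_sub; exact: le_lt_trans (normc_lerRe _) h.
Qed.

Lemma ccvg_Im (u : nat -> C) l : ccvg u l -> complex.Im (u n) @[n --> \oo] --> complex.Im l.
Proof.
move=> h; apply/cvgrPdist_lt => e e0; move/cvgrPdist_lt: h => /(_ _ e0).
apply: filterS => n; rewrite sub0r normrN ger0_norm ?normc_ge0 // => h.
by rewrite distrC -Im_sub; exact: le_lt_trans (normc_lerIm _) h.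
Qed.

Lemma cintegral_dct (F : nat -> R -> C) (G : R -> C) (g : R -> R) :
  (forall n, cmeasurable (F n)) -> (forall s, ccvg (F^~ s) (G s)) ->
  mu.-integrable setT (EFin \o g) -> (forall n s, normc (F n s) <= g s) ->
  complex.Re (cintegral (F n)) @[n --> \oo] --> complex.Re (cintegral G) /\
  complex.Im (cintegral (F n)) @[n --> \oo] --> complex.Im (cintegral G).
Proof.
move=> mF hF ig hg; split.
  apply: (proj2 (@Rintegral_dct _ (fun n s => complex.Re (F n s)) (fun s => complex.Re (G s)) g _ _ _ _)) => //.
  - by move=> n; exact: (mF n).1.
  - by move=> s; exact: ccvg_Re.
  - by move=> n s; exact: le_trans (normc_lerRe _) (hg n s).
apply: (proj2 (@Rintegral_dct _ (fun n s => complex.Im (F n s)) (fun s => complex.Im (G s)) g _ _ _ _)) => //.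
- by move=> n; exact: (mF n).2.
- by move=> s; exact: ccvg_Im.
- by move=> n s; exact: le_trans (normc_lerIm _) (hg n s).
Qed.

Lemma cdiff_cst (c z : C) : cdiff (fun=> c) z.
Proof. by exists 0; exact: cderiv_cst. Qed.
Lemma cdiff_id (z : C) : cdiff id z.
Proof. by exists 1; exact: cderiv_id. Qed.
Lemma cdiffD (f g : C -> C) z : cdiff f z -> cdiff g z -> cdiff (fun w => f w + g w) z.
Proof. by move=> [D hD] [E hE]; exists (D + E); exact: cderivD. Qed.
Lemma cdiffM (f g : C -> C) z : cdiff f z -> cdiff g z -> cdiff (fun w => f w * g w) z.
Proof. by move=> [D hD] [E hE]; exists (D * g z + f z * E); exact: cderivM. Qed.
Lemma cdiffV (f : C -> C) z : f z != 0 -> cdiff f z -> cdiff (fun w => (f w)^-1) z.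
Proof. by move=> f0 [D hD]; exists (- D / f z ^+ 2); exact: cderivV. Qed.
Lemma cdiff_affine (f : C -> C) (a b z : C) : cdiff f (a * z + b) -> cdiff (fun w => f (a * w + b)) z.
Proof. by move=> [D hD]; exists (D * a); exact: cderiv_affine. Qed.
Lemma cdiff_conj (f : C -> C) z : cdiff f (z^*) -> cdiff (fun w => (f (w^*))^*) z.
Proof. by move=> [D hD]; exists (D^*); exact: cderiv_conj. Qed.
Lemma cdiff_lin (a b z : C) : cdiff (fun w => a * w + b) z.
Proof. by apply: (@cdiff_affine id); exact: cdiff_id. Qed.
Lemma cdiff_prod n (f : nat -> C -> C) z : (forall k, cdiff (f k) z) ->
  cdiff (fun w => \prod_(k < n) f k w) z.
Proof.
move=> h; elim: n => [|n IH].
  by under eq_fun do rewrite big_ord0; exact: cdiff_cst.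
by under eq_fun do rewrite big_ord_recr /=; exact: cdiffM.
Qed.

Lemma neq0_Re (z : C) : 0 < complex.Re z -> z != 0.
Proof. by case: z => x y /= x0; rewrite eq_complex /= negb_and gt_eqF. Qed.

Lemma Re_le_normc (z : C) : complex.Re z <= normc z.
Proof. exact: le_trans (ler_norm _) (normc_lerRe z). Qed.

End ComplexSequences.

Section Symmetry.
Variables (R : realType) (rho : R).
Hypothesis hrho : rho < 2^-1.
Local Notation C := R[i].
Local Notation mu := (@lebesgue_measure R).
Local Notation a := (2^-1 - rho).
Local Notation W := (weight rho).

Let a0 : 0 < a. Proof. by rewrite subr_gt0. Qed.

Definition coef (s : R) : C :=
  (a%:C - 'i%C * s%:C) / ((- 2 * 'i%C * s%:C) * (1 - 2 * 'i%C * s%:C)).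

Lemma coefN s : coef (- s) = (a%:C + 'i%C * s%:C) / ((2 * 'i%C * s%:C) * (1 + 2 * 'i%C * s%:C)).
Proof.
have e : (- s)%:C = - s%:C :> C by rewrite rmorphN.
by rewrite /coef e; congr (_ / (_ * _)); ring.
Qed.

Lemma coef_conj s : (coef s)^* = coef (- s).
Proof.
have e : (- s)%:C = - s%:C :> C by rewrite rmorphN.
pose cj := @conjc R : C -> C.
have ci : cj 'i%C = - 'i%C by apply/eqP; rewrite eq_complex /= oppr0 !eqxx.
have cr (x : R) : cj x%:C = x%:C by apply/eqP; rewrite eq_complex /= oppr0 !eqxx.
have cM (x y : C) : cj (x * y) = cj x * cj y by exact: rmorphM.
have cB (x y : C) : cj (x - y) = cj x - cj y by exact: rmorphB.
have cN (x : C) : cj (- x) = - cj x by exact: rmorphN.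
have cV (x : C) : cj x^-1 = (cj x)^-1 by exact: fmorphV.
have c1 : cj 1 = 1 by exact: rmorph1.
have c2 : cj 2 = 2 by exact: rmorph_nat.
rewrite /coef e; move: (cr a) (cr s); move: (a%:C) (s%:C) => A S cA cS.
rewrite -[LHS]/(cj _) cM cV cM !cB !cM cN c1 c2 ci cA cS.
by congr (_ / (_ * _)); ring.
Qed.

Lemma normc_coef s : s != 0 -> normc (coef s) <= (a + 1) / `|s|.
Proof.
move=> s0; have sp : 0 < `|s| by rewrite normr_gt0.
rewrite /coef normcM normcV normcM.
have n1 : normc (a%:C - 'i%C * s%:C) <= a + `|s|.
  apply: le_trans (le_normcD _ _) _; rewrite normcN normcM normc_i mul1r !normc_real.
  by rewrite (gtr0_norm a0).
have n2 : normc (- 2 * 'i%C * s%:C) = 2 * `|s|.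
  by rewrite !normcM normcN normc_nat normc_i mulr1 normc_real.
have n3 : (1 + 2 * `|s|) / 2 <= normc (1 - 2 * 'i%C * s%:C).
  have h1 := normc_lerRe (1 - 2 * 'i%C * s%:C); have h2 := normc_lerIm (1 - 2 * 'i%C * s%:C).
  have e1 : complex.Re (1 - 2 * 'i%C * s%:C) = 1 by rewrite /=; ring.
  have e2 : complex.Im (1 - 2 * 'i%C * s%:C) = - (2 * s) by rewrite /=; ring.
  rewrite e1 normr1 in h1; rewrite e2 normrN normrM ger0_norm // in h2.
  lra.
rewrite n2 ler_pdivrMr; last by rewrite mulr_gt0 ?mulr_gt0 // (lt_le_trans _ n3) // divr_gt0 // ltr_pwDl ?mulr_ge0.
apply: le_trans n1 _; apply: (@le_trans _ _ ((a + 1) / `|s| * (2 * `|s| * ((1 + 2 * `|s|) / 2)))).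
  have -> : (a + 1) / `|s| * (2 * `|s| * ((1 + 2 * `|s|) / 2)) = (a + 1) * (1 + 2 * `|s|).
    by field; rewrite gt_eqF.
  by have := a0; nra.
have a1 : 0 <= a + 1 by have := a0; lra.
apply: ler_wpM2l; first by apply: divr_ge0.
by apply: ler_wpM2l; first exact: mulr_ge0.
Qed.

Lemma cmeasurable_coef : cmeasurable coef.
Proof.
have m : cmeasurable (fun s : R => s%:C) by apply: cmeasurable_real; exact: measurable_id.
have c (k : C) : cmeasurable (fun=> k) by exact: cmeasurable_cst.
have b (k : C) : cmeasurable (fun s => k * s%:C) by exact: cmeasurableM.
apply: cmeasurableM.
  have := cmeasurableD (c a%:C) (b (- 'i%C)).
  by under eq_fun do rewrite mulNr.
apply: cmeasurableV; apply: cmeasurableM => //.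
have := cmeasurableD (c 1) (b (- (2 * 'i%C))).
by under eq_fun do rewrite mulNr.
Qed.

Lemma realD_i (s : R) : s%:C + 'i%C = s +i* 1.
Proof. by apply/eqP; rewrite eq_complex /=; apply/andP; split; apply/eqP; ring. Qed.

Variables (f : C -> C) (hf : domainH rho f).

Lemma domainH_even s : f (- s)%:C = f s%:C.
Proof.
have [d d0 [h _]] := domainH_cdiff hf.
rewrite -h; first by rewrite rmorphN /= ?opprK.
by rewrite /= normr0 ltr_wpDr // ltW.
Qed.

Lemma domainH_even_i s : f ((- s)%:C + 'i%C) = f (s%:C - 'i%C).
Proof.
have [d d0 [h _]] := domainH_cdiff hf.
rewrite -h; last by rewrite realD_i /= normr1 ltrDl.
by congr f; rewrite rmorphN /=; ring.
Qed.

Definition shift_part (s : R) : C := coef s * (f (s%:C + 'i%C) - f s%:C).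

(** Evenness of [f] makes the second term of the operator the reflection of the first, so only one
    shift has to be estimated. *)
Lemma diff_op_split s : diff_op rho f s%:C = shift_part s + shift_part (- s).
Proof. by rewrite /diff_op /shift_part coefN domainH_even_i domainH_even. Qed.

Lemma cmeasurable_domainH y : `|y| <= 1 -> cmeasurable (fun s : R => f (s +i* y)).
Proof.
move=> hy; have [d d0 [_ h]] := domainH_cdiff hf.
by apply: cmeasurable_line => x; apply: h; rewrite /= (le_lt_trans hy) // ltrDl.
Qed.

Let mf0 : cmeasurable (fun s : R => f s%:C).
Proof. by apply: cmeasurable_domainH; rewrite normr0. Qed.
Let mf1 : cmeasurable (fun s : R => f (s%:C + 'i%C)).
Proof. by under eq_fun do rewrite realD_i; apply: cmeasurable_domainH; rewrite normr1. Qed.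

Lemma cmeasurable_shift_part : cmeasurable shift_part.
Proof.
apply: cmeasurableM; first exact: cmeasurable_coef.
have := cmeasurableD mf1 (cmeasurableM (cmeasurable_cst (-1)) mf0).
by under eq_fun do rewrite mulN1r.
Qed.

Lemma cmeasurable_opp (h : R -> C) : cmeasurable h -> cmeasurable (fun s => h (- s)).
Proof.
move=> [h1 h2]; split.
  exact: (measurableT_comp h1 (@oppr_measurable R setT)).
exact: (measurableT_comp h2 (@oppr_measurable R setT)).
Qed.

(** The pole [1 / |s|] allowed here is that of the coefficients of [diff_op]; squared, it cancels
    the [s^2] in the weight bound. The remaining exponent is [2 (rho - 1 - e) + 2 M], at most
    [-1 - 2 e] because [2 M <= 1 - 2 rho]. *)
Lemma L2_of_bound (v : R -> C^o) (K e : R) : 0 < e -> cmeasurable v -> (forall s, v (- s) = v s) ->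
  (forall s, s != 0 -> normc (v s) <= K / `|s| * expR ((rho - 1 - e) * lnp s) * expR (- (pi * `|s| / 2))) ->
  L2even rho v.
Proof.
move=> e0 mv ev hv; have [M [N [L [ML L0 hL]]]] := weight_bound hrho.
have hW := weight_le hrho hL.
have mW := measurable_weight hrho.
apply: (@L2_dom _ _ mW v (fun s => K ^+ 2 * L * expR (- (1 + 2 * e) * lnp s) + 0 * expR (- (1 + 2 * e) * lnp s))) => //.
  by apply: integrable_lin; apply: integrable_lnp; rewrite mulr_gt0.
move=> s; rewrite mul0r addr0.
have [->|s0] := eqVneq s 0.
  by rewrite weight0 mulr0; exact: (mulr_ge0 (mulr_ge0 (sqr_ge0 K) L0) (expR_ge0 _)).
have sp : 0 < `|s| by rewrite normr_gt0.
apply: (@le_trans _ _ ((K / `|s| * expR ((rho - 1 - e) * lnp s) * expR (- (pi * `|s| / 2))) ^+ 2 *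
  (L * s ^+ 2 * expR ((2 * M)%:R * lnp s) * expR (pi * `|s|)))).
  apply: ler_pM; rewrite ?sqr_ge0 ?weight_ge0 //.
  have nv := normc_ge0 (v s).
  have h1 := hv s s0; have h2 := le_trans nv h1.
  by apply: lerXn2r; rewrite ?nnegrE.
have -> : (K / `|s| * expR ((rho - 1 - e) * lnp s) * expR (- (pi * `|s| / 2))) ^+ 2 *
  (L * s ^+ 2 * expR ((2 * M)%:R * lnp s) * expR (pi * `|s|)) =
  K ^+ 2 * L * expR ((2 * (rho - 1 - e) + (2 * M)%:R) * lnp s).
  have e1 : expR ((2 * (rho - 1 - e) + (2 * M)%:R) * lnp s) =
    expR ((rho - 1 - e) * lnp s) ^+ 2 * expR ((2 * M)%:R * lnp s).
    by rewrite -expRM_natl -expRD; congr expR; ring.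
  have e2 : expR (pi * `|s|) = (expR (- (pi * `|s| / 2)))^-1 ^+ 2.
    by rewrite -expRN opprK -expRM_natl; congr expR; field.
  rewrite e1 e2 -(sqr_absr s); field.
  by rewrite (gt_eqF sp) gt_eqF ?expR_gt0.
rewrite ler_wpM2l ?(mulr_ge0 (sqr_ge0 K) L0) // le_expR_lnp //.
by rewrite natrM; have := ML; lra.
Qed.

(** Trades one power of [1 + |s|] for the pole that [L2_of_bound] expects. *)
Lemma lnp_pow_le (p s : R) : s != 0 -> expR (p * lnp s) <= `|s|^-1 * expR ((p + 1) * lnp s).
Proof.
move=> s0; have sp : 0 < `|s| by rewrite normr_gt0.
rewrite mulrDl mul1r expRD expR_lnp mulrCA ler_peMr ?expR_ge0 //.
by rewrite mulrC ler_pdivlMr // mul1r lerDr.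
Qed.

Lemma domainH_L2 : L2even rho (fun s : R => f s%:C).
Proof.
have [e e0 [K K0 hK]] := domainH_bound hrho hf.
apply: (@L2_of_bound _ K e) => //; first by move=> s; exact: domainH_even.
move=> s s0; apply: le_trans (hK s 0 _) _; first by rewrite normr0.
rewrite ler_wpM2r ?expR_ge0 // -mulrA ler_wpM2l //.
have := lnp_pow_le (rho - 2 - e) s0.
by have -> : rho - 2 - e + 1 = rho - 1 - e by ring.
Qed.

Lemma diff_op_L2 : L2even rho (fun s : R => diff_op rho f s%:C).
Proof.
have [e e0 [K K0 hK]] := domainH_bound hrho hf.
apply: (@L2_of_bound _ (4 * (a + 1) * K) e e0).
- under eq_fun do rewrite diff_op_split.
  by apply: cmeasurableD; [|apply: cmeasurable_opp]; exact: cmeasurable_shift_part.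
- by move=> s; rewrite !diff_op_split opprK addrC.
move=> s s0.
have b t : t != 0 -> normc (shift_part t) <= 2 * (a + 1) * K / `|t| * expR ((rho - 2 - e) * lnp t) * expR (- (pi * `|t| / 2)).
  move=> t0; rewrite /shift_part normcM.
  have h : normc (f (t%:C + 'i%C) - f t%:C) <= 2 * (K * expR ((rho - 2 - e) * lnp t) * expR (- (pi * `|t| / 2))).
    apply: le_trans (le_normcD _ _) _; rewrite normcN realD_i mulr_natl mulr2n.
    by apply: lerD; apply: hK; rewrite ?normr1 ?normr0.
  apply: le_trans (ler_pM (normc_ge0 _) (normc_ge0 _) (normc_coef t0) h) _.
  by rewrite le_eqVlt; apply/orP; left; apply/eqP; ring.
rewrite diff_op_split; apply: le_trans (le_normcD _ _) _.
have h1 := b s s0; have := b (- s); rewrite oppr_eq0 normrN lnpN => /(_ s0) h2.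
apply: le_trans (lerD h1 h2) _; rewrite -!mulrDl.
rewrite ler_wpM2r ?expR_ge0 //; apply: ler_pM => //; rewrite ?expR_ge0 //.
- have a1 : 0 <= a + 1 by rewrite addr_ge0 // ltW.
  by rewrite divr_ge0 // mulr_ge0 // mulr_ge0.
- by rewrite le_eqVlt; apply/orP; left; apply/eqP; ring.
- by rewrite le_expR_lnp //; lra.
Qed.

End Symmetry.

(** * Symmetry *)

Section ShiftKernel.
Variables (R : realType) (a : R).
Hypothesis a0 : 0 < a.
Local Notation C := R[i].

(* [n]-th Gauss approximation of
   [Gamma (a + t) * Gamma (a + 1 - t) / (Gamma (2 * t) * Gamma (2 - 2 * t))],
   invariant under [t |-> 1 - t] before the passage to the limit. *)
Definition shift_kernel (n : nat) (t : C) : C :=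
  (expR ((2 * a - 1) * ln n%:R))%:C *
  \prod_(k < n.+1) ((2 * t + k%:R) * (2 - 2 * t + k%:R) /
                    ((a%:C + t + k%:R) * (a%:C + 1 - t + k%:R))).

Lemma shift_kernel_sym n t : shift_kernel n (t + 1) = shift_kernel n (- t).
Proof.
rewrite /shift_kernel; congr (_ * _); apply: eq_bigr => k _.
have -> : (2 * (t + 1) + k%:R) * (2 - 2 * (t + 1) + k%:R) = (2 * - t + k%:R) * (2 - 2 * - t + k%:R).
  by ring.
by congr (_ / _); ring.
Qed.

Lemma prod_shift1 (v : C) m : (\prod_(k < m) (v + 1 + k%:R)) * v = (\prod_(k < m) (v + k%:R)) * (v + m%:R).
Proof.
elim: m => [|m IH]; first by rewrite !big_ord0 !mul1r addr0.
rewrite !big_ord_recr /= mulrAC IH -natr1; ring.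
Qed.

Lemma prod_shift2 (u : C) m : (\prod_(k < m) (u + 2 + k%:R)) * (u * (u + 1)) =
  (\prod_(k < m) (u + k%:R)) * ((u + m%:R) * (u + m%:R + 1)).
Proof.
elim: m => [|m IH]; first by rewrite !big_ord0 !mul1r addr0.
rewrite !big_ord_recr /= mulrAC IH -natr1; ring.
Qed.

(** The factor by which the functional equation of Gamma fails at stage [n]; it tends to 1. *)
Definition kernel_ratio (n : nat) (s : R) : C :=
  (n.+1%:R - 2 * ('i%C * s%:C)) * (n.+2%:R - 2 * ('i%C * s%:C)) /
  (n%:R * (a%:C - 'i%C * s%:C + n.+1%:R)).

(** In the limit this is [Gamma (a + 1 - t) = (a - t) Gamma (a - t)] and [Gamma (2 - 2 t) = (1 - 2
    t) (- 2 t) Gamma (- 2 t)] at [t = i s]: the kernel becomes the weight times the first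
    coefficient of [diff_op]. *)
Lemma shift_kernel_real (s : R) n : (0 < n)%N -> s != 0 ->
  shift_kernel n ('i%C * s%:C) =
  (a%:C - 'i%C * s%:C) / ((- 2 * 'i%C * s%:C) * (1 - 2 * 'i%C * s%:C)) *
  (wgt a n s)%:C * kernel_ratio n s.
Proof.
move=> n0 s0; set t := 'i%C * s%:C.
have t0 : t != 0.
  rewrite mulf_eq0 negb_or; apply/andP; split; first by rewrite eq_complex /= oner_eq0 andbF.
  by rewrite eq_complex /= negb_and s0.
have nz (x : R) : 0 < x -> x%:C - t != 0 /\ x%:C + t != 0.
  by move=> x0; split; apply: neq0_Re; rewrite /t /= ?(mul0r, mulr0, addr0, subr0, subrr, oppr0).
have nR : (0 : R) < n%:R by rewrite ltr0n.
have nC : (n%:R : C) != 0 by rewrite pnatr_eq0 -lt0n.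
have natC (k : nat) : (k%:R : C) = k%:R%:C by rewrite (rmorph_nat (real_complex R)).
pose u := - 2 * t; pose v := a%:C - t.
pose X := \prod_(k < n.+1) (2 * t + k%:R); pose X' := \prod_(k < n.+1) (u + k%:R).
pose Y := \prod_(k < n.+1) (a%:C + t + k%:R); pose Y' := \prod_(k < n.+1) (v + k%:R).
pose X2 := \prod_(k < n.+1) (u + 2 + k%:R); pose Y1 := \prod_(k < n.+1) (v + 1 + k%:R).
have E1 : X2 * (u * (u + 1)) = X' * ((u + n.+1%:R) * (u + n.+1%:R + 1)) by exact: prod_shift2.
have E2 : Y1 * v = Y' * (v + n.+1%:R) by exact: prod_shift1.
have ak (k : nat) : 0 < a + k%:R by rewrite ltr_wpDr.
have Y0 : Y != 0.
  apply/prodf_neq0 => k _; rewrite addrAC natC -rmorphD /=.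
  exact: (nz _ (ak k)).2.
have Y'0 : Y' != 0.
  apply/prodf_neq0 => k _; rewrite /v addrAC natC -rmorphD /=.
  exact: (nz _ (ak k)).1.
have u0 : u != 0 by rewrite /u mulf_neq0 // oppr_eq0 pnatr_eq0.
have u1 : u + 1 != 0.
  apply: neq0_Re; rewrite /u /t /=.
  by have -> : (- (1 + 1) * (0 * s - 1 * 0) - - (0 + 0) * (0 * 0 + 1 * s) + 1 : R) = 1 by ring.
have v0 : v != 0 by exact: (nz _ a0).1.
have vn : v + n.+1%:R != 0.
  by rewrite /v addrAC natC -rmorphD /=; exact: (nz _ (ak n.+1)).1.
have EX2 : X2 = X' * ((u + n.+1%:R) * (u + n.+1%:R + 1)) / (u * (u + 1)).
  by rewrite -E1 mulfK // mulf_neq0.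
have EY1 : Y1 = Y' * (v + n.+1%:R) / v by rewrite -E2 mulfK.
have -> : shift_kernel n t = (expR ((2 * a - 1) * ln n%:R))%:C * (X * X2 / (Y * Y1)).
  rewrite /shift_kernel /X /X2 /Y /Y1 -!big_split /= -prodf_div; congr (_ * _).
  apply: eq_bigr => k _.
  have -> : 2 - 2 * t + k%:R = u + 2 + k%:R by rewrite /u; ring.
  by have -> : a%:C + 1 - t + k%:R = v + 1 + k%:R by rewrite /v; ring.
have -> : (wgt a n s)%:C = (expR (2 * a * ln n%:R))%:C * (X * X' / (Y * Y')).
  rewrite /wgt rmorphM /= rmorph_prod /= /X /X' /Y /Y' -!big_split /= -prodf_div; congr (_ * _).
  have ti : t * t = - (s ^+ 2)%:C.
    by apply/eqP; rewrite eq_complex /=; apply/andP; split; apply/eqP; ring.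
  apply: eq_bigr => k _; rewrite (fmorph_div (real_complex R)); congr (_ / _).
    rewrite (rmorphD (real_complex R)) (rmorphXn (real_complex R)) (rmorphM (real_complex R)) (rmorphXn (real_complex R)) /= -(natC k) -(natC 4) /u.
    have -> : (2 * t + k%:R) * (- 2 * t + k%:R) = k%:R ^+ 2 - 4 * (t * t) by ring.
    by rewrite ti (rmorphXn (real_complex R)); ring.
  rewrite (rmorphD (real_complex R)) !(rmorphXn (real_complex R)) (rmorphD (real_complex R)) /= -(natC k) /v.
  have -> : (a%:C + t + k%:R) * (a%:C - t + k%:R) = (a%:C + k%:R) ^+ 2 - t * t by ring.
  by rewrite ti (rmorphXn (real_complex R)) opprK.
have -> : (expR ((2 * a - 1) * ln n%:R))%:C = (expR (2 * a * ln n%:R))%:C / n%:R.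
  by rewrite natC -fmorphV -rmorphM mulrBl mul1r expRB lnK.
rewrite EX2 EY1 /kernel_ratio -/t.
have -> : n.+1%:R - 2 * t = u + n.+1%:R by rewrite /u; ring.
have -> : n.+2%:R - 2 * t = u + n.+1%:R + 1 by rewrite /u -(natr1 n.+1); ring.
rewrite -/v.
have -> : - 2 * 'i%C * s%:C = u by rewrite /u /t; ring.
have -> : 1 - 2 * 'i%C * s%:C = u + 1 by rewrite /u /t; ring.
field.
by rewrite Y0 Y'0 u0 u1 v0 nC [1 + _]addrC natr1 vn.
Qed.

Lemma normc_kernel_ratio (s : R) n : (0 < n)%N -> normc (kernel_ratio n s) <= 6 * (1 + `|s|).
Proof.
move=> n0; have n1 : (1 : R) <= n%:R by rewrite ler1n.
have nR : (0 : R) < n%:R by rewrite ltr0n.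
have e1 (m : nat) (b : R) : m%:R - b%:C * ('i%C * s%:C) = m%:R +i* (- (b * s)).
  rewrite -(rmorph_nat (real_complex R)).
  by apply/eqP; rewrite eq_complex /=; apply/andP; split; apply/eqP; ring.
have e2 : a%:C - 'i%C * s%:C + n.+1%:R = (a + n.+1%:R) +i* (- s).
  rewrite -(rmorph_nat (real_complex R)).
  by apply/eqP; rewrite eq_complex /=; apply/andP; split; apply/eqP; ring.
have two : (2 : C) = (2 : R)%:C by rewrite rmorph_nat.
rewrite /kernel_ratio two !e1 e2 !normcM normcV normcM normc_nat.
set D := normc ((a + _) +i* _); set A := normc (n.+1%:R +i* _); set B := normc (n.+2%:R +i* _).
have nS : (n.+1%:R : R) = n%:R + 1 by rewrite natr1.
have AD : A <= 2 * D.
  rewrite -(ler_pXn2r (_ : 0 < 2)%N) ?nnegrE ?mulr_ge0 ?normc_ge0 // exprMn !sqr_normc_ReIm /=.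
  rewrite !sqrrN exprMn nS; have := a0; have := sqr_ge0 s; nra.
have Bn : B <= n%:R * (3 * (1 + `|s|)).
  apply: le_trans (normc_ler_ReIm _) _; rewrite /= normrN normrM ger0_norm // (ger0_norm (ler0n _ _)).
  rewrite -(natr1 n.+1) nS; have := normr_ge0 s; nra.
have D0 : 0 < D.
  by rewrite (lt_le_trans _ (Re_le_normc _)) //= ltr_wpDr.
rewrite ler_pdivrMr ?mulr_gt0 //.
apply: (@le_trans _ _ (2 * D * (n%:R * (3 * (1 + `|s|))))); first by rewrite ler_pM ?normc_ge0.
by rewrite le_eqVlt; apply/orP; left; apply/eqP; ring.
Qed.

Lemma kernel_ratio_cvg (s : R) : ccvg (fun n => kernel_ratio n.+1 s) 1.
Proof.
set t := 'i%C * s%:C.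
pose K := normc (2 - a%:C - 3 * t) + normc ((1 - 2 * t) * (2 - 2 * t)).
apply: (@ccvg_le _ _ _ (fun n => K * n.+1%:R^-1)).
  move=> n; set m := n.+1.
  have m0 : (0 : R) < m%:R by rewrite ltr0n.
  have mC : (m%:R : C) != 0 by rewrite pnatr_eq0.
  have re : complex.Re (a%:C - t + m.+1%:R) = a + m.+1%:R.
    by rewrite /t -(rmorph_nat (real_complex R)) /=; ring.
  have den : m%:R <= normc (a%:C - t + m.+1%:R).
    apply: (le_trans _ (Re_le_normc _)); rewrite re.
    by have := a0; rewrite -natr1; lra.
  have d0 : a%:C - t + m.+1%:R != 0.
    by apply: neq0_Re; rewrite re ltr_wpDr.
  have -> : kernel_ratio m s - 1 =
    (m%:R * (2 - a%:C - 3 * t) + (1 - 2 * t) * (2 - 2 * t)) / (m%:R * (a%:C - t + m.+1%:R)).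
    rewrite /kernel_ratio -/t -(natr1 m.+1) -(natr1 m) in d0 *; field.
    by apply/andP; split; [exact: d0|exact: mC].
  rewrite normcM normcV normcM normc_nat.
  have D0 := lt_le_trans m0 den.
  rewrite ler_pdivrMr ?mulr_gt0 //.
  apply: (@le_trans _ _ (m%:R * K)).
    apply: le_trans (le_normcD _ _) _; rewrite normcM normc_nat /K [X in _ <= X]mulrDr lerD2l.
    by rewrite ler_peMl ?normc_ge0 // ler1n.
  have -> : K * m%:R^-1 * (m%:R * normc (a%:C - t + m.+1%:R)) = K * normc (a%:C - t + m.+1%:R).
    by field; rewrite gt_eqF.
  by rewrite mulrC ler_wpM2l // addr_ge0 // normc_ge0.
rewrite -[X in _ --> X](mulr0 K); apply: cvgM; first exact: cvg_cst.
exact: cvg_harmonic.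
Qed.

(** Exactly on this strip both denominators have positive real part for every [k]. It contains the
    closed strip between [Im z = -1] and [Im z = 0] because [a > 0], so no pole is met when the line
    moves. *)
Lemma cdiff_shift_kernel n (z : C) : -1 - a < complex.Im z < a ->
  cdiff (fun z => shift_kernel n ('i%C * z)) z.
Proof.
move=> /andP[z1 z2].
apply: cdiffM; first exact: cdiff_cst.
apply: (@cdiff_prod _ _ (fun k z => (2 * ('i%C * z) + k%:R) * (2 - 2 * ('i%C * z) + k%:R) /
                    ((a%:C + 'i%C * z + k%:R) * (a%:C + 1 - 'i%C * z + k%:R)))) => k.
have lin (b c : C) : cdiff (fun z => b * z + c) z by exact: cdiff_lin.
have natR (j : nat) : (j%:R : C) = j%:R%:C by rewrite (rmorph_nat (real_complex R)).
have k0 : (0 : R) <= k%:R by [].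
apply: cdiffM.
  apply: cdiffM.
    have := lin (2 * 'i%C) k%:R; congr (cdiff _ z).
    by apply/funext => w; ring.
  have := lin (- (2 * 'i%C)) (2 + k%:R); congr (cdiff _ z).
  by apply/funext => w; ring.
apply: cdiffV.
  apply: mulf_neq0; apply: neq0_Re; rewrite natR; move: z1 z2; case: (z) => x y /= z1 z2; lra.
apply: cdiffM.
  have := lin 'i%C (a%:C + k%:R); congr (cdiff _ z).
  by apply/funext => w; ring.
have := lin (- 'i%C) (a%:C + 1 + k%:R); congr (cdiff _ z).
by apply/funext => w; ring.
Qed.

(** Constant and exponent depend on [n], which is harmless: the line is moved at fixed [n], where
    the decay of the domain functions beats any power. *)
Lemma normc_shift_kernel n : exists2 K : R, 0 <= K & forall x y : R, -1 <= y <= 0 ->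
  normc (shift_kernel n ('i%C * (x +i* y))) <= K * (1 + `|x|) ^+ (2 * n.+1).
Proof.
pose c (k : nat) : R := (2 + k%:R) * (4 + k%:R) / a ^+ 2.
have c0 k : 0 <= c k by rewrite divr_ge0 ?sqr_ge0 // mulr_ge0 // addr_ge0.
pose E := expR ((2 * a - 1) * ln n%:R).
exists (E * \prod_(k < n.+1) c k); first by rewrite mulr_ge0 ?expR_ge0 // prodr_ge0.
move=> x y /andP[y1 y0]; rewrite normcM normc_real ger0_norm ?expR_ge0 // -mulrA.
rewrite ler_wpM2l ?expR_ge0 //.
have -> : (1 + `|x|) ^+ (2 * n.+1) = \prod_(k < n.+1) (1 + `|x|) ^+ 2.
  by rewrite prodr_const card_ord exprM.
rewrite -big_split /=.
have -> : normc (\prod_(k < n.+1)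
    ((2 * ('i%C * (x +i* y)) + k%:R) * (2 - 2 * ('i%C * (x +i* y)) + k%:R) /
    ((a%:C + 'i%C * (x +i* y) + k%:R) * (a%:C + 1 - 'i%C * (x +i* y) + k%:R)))) =
  \prod_(k < n.+1) normc ((2 * ('i%C * (x +i* y)) + k%:R) * (2 - 2 * ('i%C * (x +i* y)) + k%:R) /
    ((a%:C + 'i%C * (x +i* y) + k%:R) * (a%:C + 1 - 'i%C * (x +i* y) + k%:R))).
  by elim/big_rec2: _ => [|k p q _ <-]; rewrite ?normc1 ?normcM.
apply: ler_prod => k _; rewrite normc_ge0 /=.
have k0 : (0 : R) <= k%:R by [].
have natR : (k%:R : C) = k%:R%:C by rewrite (rmorph_nat (real_complex R)).
set X := `|x|; have X0 : 0 <= X by exact: normr_ge0.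
have Y1 : `|y| <= 1 by rewrite ler_norml; apply/andP; split; lra.
have nt : normc ('i%C * (x +i* y)) <= X + 1.
  rewrite normcM normc_i mul1r; apply: le_trans (normc_ler_ReIm _) _ => /=.
  by rewrite lerD2l.
have b1 : normc (2 * ('i%C * (x +i* y)) + k%:R) <= (2 + k%:R) * (1 + X).
  apply: le_trans (le_normcD _ _) _; rewrite normcM !normc_nat; nra.
have b2 : normc (2 - 2 * ('i%C * (x +i* y)) + k%:R) <= (4 + k%:R) * (1 + X).
  apply: le_trans (le_normcD _ _) _; rewrite normc_nat.
  apply: (@le_trans _ _ (2 + 2 * (X + 1) + k%:R)); last by nra.
  rewrite lerD2r; apply: le_trans (le_normcD _ _) _.
  by rewrite normcN normcM !normc_nat lerD2l ler_wpM2l.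
have d1 : a <= normc (a%:C + 'i%C * (x +i* y) + k%:R).
  by apply: (le_trans _ (Re_le_normc _)); rewrite natR /=; lra.
have d2 : a <= normc (a%:C + 1 - 'i%C * (x +i* y) + k%:R).
  by apply: (le_trans _ (Re_le_normc _)); rewrite natR /=; lra.
rewrite normcM normcV !normcM.
have p1 := lt_le_trans a0 d1; have p2 := lt_le_trans a0 d2.
rewrite ler_pdivrMr ?mulr_gt0 //.
apply: (@le_trans _ _ (((2 + k%:R) * (1 + X)) * ((4 + k%:R) * (1 + X)))).
  by rewrite ler_pM ?normc_ge0.
have -> : (2 + k%:R) * (1 + X) * ((4 + k%:R) * (1 + X)) = c k * (1 + X) ^+ 2 * (a * a).
  by rewrite /c; field; rewrite gt_eqF.
by apply: ler_wpM2l; [exact: mulr_ge0 (c0 k) (sqr_ge0 _)|exact: ler_pM (ltW a0) (ltW a0) d1 d2].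
Qed.

End ShiftKernel.

(** * The limit of the shifted integrals *)

Section Symmetric.
Variables (R : realType) (rho : R).
Hypothesis hrho : rho < 2^-1.
Local Notation C := R[i].
Local Notation mu := (@lebesgue_measure R).
Local Notation a := (2^-1 - rho).
Local Notation W := (weight rho).

Let a0 : 0 < a. Proof. by rewrite subr_gt0. Qed.
Let mW := measurable_weight hrho.

(** The decay of a product of two functions of the domain, each taken on a horizontal line of the
    closed strip. *)
Definition fast_decay (u : R -> C) := cmeasurable u /\
  exists2 e : R, 0 < e & exists2 K : R, 0 <= K & forall s,
    normc (u s) <= K * expR ((2 * rho - 4 - e) * lnp s) * expR (- (pi * `|s|)).

Lemma fast_decay_opp u : fast_decay u -> fast_decay (fun s => u (- s)).
Proof.
move=> [mu_ [e e0 [K K0 h]]]; split; first exact: cmeasurable_opp.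
by exists e => //; exists K => // s; apply: le_trans (h (- s)) _; rewrite lnpN normrN.
Qed.

Lemma fast_decay_conj u : fast_decay u -> fast_decay (fun s => (u s)^*).
Proof.
move=> [mu_ [e e0 [K K0 h]]]; split; first exact: cmeasurable_conj.
by exists e => //; exists K => // s; rewrite normc_conj.
Qed.

Lemma fast_decay_domainH (f g : C -> C) y y' : domainH rho f -> domainH rho g ->
  `|y| <= 1 -> `|y'| <= 1 -> fast_decay (fun s => f (s +i* y) * (g (s +i* y'))^*).
Proof.
move=> hf hg hy hy'; split.
  by apply: cmeasurableM; [|apply: cmeasurable_conj]; exact: (@cmeasurable_domainH _ rho).
have [e1 p1 [K1 k1 h1]] := domainH_bound hrho hf.
have [e2 p2 [K2 k2 h2]] := domainH_bound hrho hg.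
exists (e1 + e2); first exact: addr_gt0.
exists (K1 * K2); first exact: mulr_ge0.
move=> s; rewrite normcM normc_conj.
apply: le_trans (ler_pM (normc_ge0 _) (normc_ge0 _) (h1 s y hy) (h2 s y' hy')) _.
have -> : (2 * rho - 4 - (e1 + e2)) * lnp s = (rho - 2 - e1) * lnp s + (rho - 2 - e2) * lnp s by ring.
have -> : - (pi * `|s|) = - (pi * `|s| / 2) + - (pi * `|s| / 2) by field.
by rewrite !expRD le_eqVlt; apply/orP; left; apply/eqP; ring.
Qed.

(** One majorant for the limit and all its approximations: [w] stands for [weight] or for [wgt], and
    [6 (1 + |s|)] for the bound on [kernel_ratio]. The powers [|s|^-1] from [coef],
    [s^2 (1 + |s|)^(2 M)] from [w] with [2 M <= 1 - 2 rho], and [1 + |s|] leave [(1 + |s|)^(-1 - e)]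
    after multiplication by the decay of [u]. *)
Lemma fast_decay_coef u M (K : R) : fast_decay u -> M%:R <= a -> 0 <= K ->
  exists2 e : R, 0 < e & exists2 L : R, 0 <= L & forall w s, 0 <= w ->
   w <= K * s ^+ 2 * expR ((2 * M)%:R * lnp s) * expR (pi * `|s|) ->
   normc (coef rho s) * w * normc (u s) * (6 * (1 + `|s|)) <= L * expR (- (1 + e) * lnp s).
Proof.
move=> [_ [e e0 [L L0 hu]]] ML K0; exists e => //.
have a1 : 0 <= a + 1 by rewrite addr_ge0 // ltW.
exists ((a + 1) * K * L * 6); first by rewrite !mulr_ge0.
move=> w s w0 hw.
have [->|s0] := eqVneq s 0.
  have -> : coef rho 0 = 0 by rewrite /coef !mulr0 mul0r invr0 mulr0.
  by rewrite normc0 !mul0r; exact: (mulr_ge0 (mulr_ge0 (mulr_ge0 (mulr_ge0 a1 K0) L0) (ler0n _ 6)) (expR_ge0 _)).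
have sp : 0 < `|s| by rewrite normr_gt0.
have cn := normc_ge0 (coef rho s); have un := normc_ge0 (u s).
have h1 := ler_pM cn w0 (normc_coef hrho s0) hw.
have h2 := ler_pM (mulr_ge0 cn w0) un h1 (hu s).
have s6 : 0 <= 6 * (1 + `|s|) by rewrite mulr_ge0 // addr_ge0.
apply: le_trans (ler_wpM2r s6 h2) _.
have E : expR (pi * `|s|) * expR (- (pi * `|s|)) = 1 by rewrite -expRD subrr expR0.
have -> : (a + 1) / `|s| * (K * s ^+ 2 * expR ((2 * M)%:R * lnp s) * expR (pi * `|s|)) *
   (L * expR ((2 * rho - 4 - e) * lnp s) * expR (- (pi * `|s|))) * (6 * (1 + `|s|)) =
  (a + 1) * K * L * 6 * (expR (((2 * M)%:R + (2 * rho - 4 - e)) * lnp s) * (`|s| * (1 + `|s|))) *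
   (expR (pi * `|s|) * expR (- (pi * `|s|))).
  by rewrite -(sqr_absr s) (mulrDl (2 * M)%:R) expRD; field; rewrite gt_eqF.
rewrite E mulr1 ler_wpM2l //; first by rewrite !mulr_ge0.
apply: (@le_trans _ _ (expR (((2 * M)%:R + (2 * rho - 4 - e) + 2) * lnp s))).
  rewrite [in leRHS]mulrDl expRD ler_wpM2l ?expR_ge0 // expR_lnpX expr2.
  by rewrite ler_wpM2r ?addr_ge0 // lerDr.
by rewrite le_expR_lnp // natrM; lra.
Qed.

Definition shift_form (u : R -> C) : C := cintegral (fun s => coef rho s * (W s)%:C * u s).

Lemma shift_form_integrable u : fast_decay u ->
  cintegrable (fun s => coef rho s * (W s)%:C * u s).
Proof.
move=> hu; have [M [N [K [ML K0 hK]]]] := weight_bound hrho.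
have [e e0 [L L0 h]] := fast_decay_coef hu ML K0.
apply: (@cintegrable_dom _ _ (fun s => L * expR (- (1 + e) * lnp s) + 0 * expR (- (1 + e) * lnp s))).
- apply: cmeasurableM; last exact: hu.1.
  by apply: cmeasurableM; [exact: cmeasurable_coef | exact: cmeasurable_real].
- by apply: integrable_lin; exact: integrable_lnp.
- move=> s; rewrite mul0r addr0.
  have w0 := weight_ge0 rho s.
  apply: le_trans (h (W s) s w0 (weight_le hrho hK s)).
  rewrite normcM (normcM (coef rho s)) normc_real ger0_norm //.
  have p := mulr_ge0 (mulr_ge0 (normc_ge0 (coef rho s)) w0) (normc_ge0 (u s)).
  by rewrite ler_peMr //; have := normr_ge0 s; lra.
Qed.

Lemma shift_form_conj u : fast_decay u ->
  (shift_form u)^* = shift_form (fun s => (u (- s))^*).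
Proof.
move=> hu; rewrite /shift_form -cintegral_conj; last exact: shift_form_integrable.
rewrite -[RHS]cintegral_opp; last first.
  by apply: shift_form_integrable; exact: fast_decay_conj (fast_decay_opp hu).
apply: eq_cintegral => s; rewrite opprK -coef_conj weightN //.
pose cj := @conjc R : C -> C.
have cM (x y : C) : cj (x * y) = cj x * cj y by exact: rmorphM.
rewrite -[LHS]/(cj _) cM (cM (coef rho s)); congr (_ * _ * _).
by apply/eqP; rewrite eq_complex /= oppr0 !eqxx.
Qed.

Lemma shift_kernel0 n : shift_kernel a n 0 = 0.
Proof. by rewrite /shift_kernel big_ord_recl !mulr0 addr0 !mul0r mulr0. Qed.

Lemma shift_kernel_bound u M N (K : R) : fast_decay u -> M%:R <= a -> 0 <= K ->
  (forall n s, (N <= n)%N -> wgt a n s <=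
    K * s ^+ 2 * expR ((2 * M)%:R * lnp s) * expR (pi * `|s|)) ->
  exists2 e : R, 0 < e & exists2 L : R, 0 <= L & forall n s, (N <= n)%N -> (0 < n)%N ->
    normc (shift_kernel a n ('i%C * s%:C) * u s) <= L * expR (- (1 + e) * lnp s).
Proof.
move=> hu ML K0 hK; have [e e0 [L L0 h]] := fast_decay_coef hu ML K0.
exists e => //; exists L => // n s Nn n0.
have [->|s0] := eqVneq s 0.
  by rewrite mulr0 shift_kernel0 mul0r normc0 mulr_ge0 // expR_ge0.
have w0 := wgt_ge0 a n s.
rewrite shift_kernel_real //.
apply: le_trans (h (wgt a n s) s w0 (hK n s Nn)).
rewrite -/(coef rho s) normcM (normcM (_ * _)) (normcM (coef rho s)) normc_real (ger0_norm w0) mulrAC.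
have p := mulr_ge0 (mulr_ge0 (normc_ge0 (coef rho s)) w0) (normc_ge0 (u s)).
by rewrite ler_wpM2l // normc_kernel_ratio.
Qed.

Lemma cmeasurable_shift_kernel n : cmeasurable (fun s => shift_kernel a n ('i%C * s%:C)).
Proof.
have h := @cmeasurable_line R (fun z => shift_kernel a n ('i%C * z)) 0.
have := h; rewrite (_ : (fun x => _) = (fun s => shift_kernel a n ('i%C * s%:C))) //.
by apply => x; apply: cdiff_shift_kernel => //=; have := a0; lra.
Qed.

Lemma shift_form_limit u M N (K : R) : fast_decay u -> M%:R <= a -> 0 <= K ->
  (forall n s, (N <= n)%N -> wgt a n s <=
    K * s ^+ 2 * expR ((2 * M)%:R * lnp s) * expR (pi * `|s|)) ->
  let F n := cintegral (fun s => shift_kernel a (n + N).+1 ('i%C * s%:C) * u s) in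
  complex.Re (F n) @[n --> \oo] --> complex.Re (shift_form u) /\
  complex.Im (F n) @[n --> \oo] --> complex.Im (shift_form u).
Proof.
move=> hu ML K0 hK F; have [e e0 [L L0 h]] := shift_kernel_bound hu ML K0 hK.
apply: (@cintegral_dct R (fun n s => shift_kernel a (n + N).+1 ('i%C * s%:C) * u s) _
  (fun s => L * expR (- (1 + e) * lnp s) + 0 * expR (- (1 + e) * lnp s))).
- move=> n; apply: cmeasurableM; [exact: cmeasurable_shift_kernel | exact: hu.1].
- move=> s; apply: (@ccvgM R (fun n => shift_kernel a (n + N).+1 ('i%C * s%:C)) (fun=> u s)); last exact: ccvg_cst.
  have [->|s0] := eqVneq s 0.
    rewrite weight0 [coef rho 0 * _]mulr0; under eq_fun do rewrite mulr0 shift_kernel0.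
    exact: ccvg_cst.
  rewrite (_ : (fun n => shift_kernel a _ _) = (fun n => coef rho s * (wgt a (n + N).+1 s)%:C * kernel_ratio a (n + N).+1 s)); last first.
    by apply/funext => n; rewrite shift_kernel_real.
  rewrite -[coef rho s * (W s)%:C]mulr1; apply: ccvgM.
    apply: ccvgM; first exact: ccvg_cst.
    apply: ccvg_real.
    have hw := @wgt_cvg R rho s hrho.
    rewrite (_ : (fun n => _) = (wgt a)^~ s \o addn^~ N.+1); last by apply/funext => n /=; rewrite addnS.
    exact: (cvg_comp _ _ (cvg_addnr N.+1) hw).
  have hr := @kernel_ratio_cvg R a a0 s.
  by have := cvg_comp _ _ (cvg_addnr N) hr.
- by apply: integrable_lin; exact: integrable_lnp.
- by move=> n s; rewrite mul0r addr0; apply: h => //; rewrite leqW // leq_addl.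
Qed.

Lemma pow_le_exp (m : nat) : exists2 K : R, 0 <= K & forall x : R, 0 <= x ->
  (1 + x) ^+ m <= K * expR x.
Proof.
exists (m.+1`!%:R * expR 1); first by rewrite mulr_ge0 // expR_ge0.
move=> x x0; rewrite -mulrA -expRD.
apply: (@le_trans _ _ ((1 + x) ^+ m.+1)).
  by rewrite ler_weXn2l // lerDl.
have h := @expR_ge1Dxn R (1 + x) m (addr_ge0 ler01 x0).
have f0 : (0 : R) < m.+1`!%:R by rewrite ltr0n fact_gt0.
rewrite mulrC -ler_pdivrMr //; apply: le_trans h; by rewrite lerDr.
Qed.

(* The line of integration moves from [Im z = 0] to [Im z = -1]. *)
Lemma shift_kernel_contour (f g : C -> C) n : domainH rho f -> domainH rho g ->
  cintegral (fun s => shift_kernel a n ('i%C * s%:C) * (f (s +i* 1) * (g (s +i* 0))^*)) =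
  cintegral (fun s => shift_kernel a n (- ('i%C * s%:C)) * (f (s +i* 0) * (g (s +i* 1))^*)).
Proof.
move=> hf hg.
have [d1 p1 [_ c1]] := domainH_cdiff hf; have [d2 p2 [_ c2]] := domainH_cdiff hg.
have [e1 q1 [K1 k1 b1]] := domainH_bound hrho hf.
have [e2 q2 [K2 k2 b2]] := domainH_bound hrho hg.
have [K k0 b] := normc_shift_kernel a0 n.
have [L l0 bL] := pow_le_exp (2 * n.+1).
pose d := Num.min a (Num.min d1 d2).
have d0 : 0 < d by rewrite !lt_min a0 p1 p2.
have [da dd1 dd2] : [/\ d <= a, d <= d1 & d <= d2].
  by split; rewrite /d ?ge_min ?lexx ?orbT.
(* Conjugating both the argument and the value of [g] keeps the integrand holomorphic. For [Im z] in
   [[-1, 0]], both [z + i] and the conjugate of [z] have imaginary part in [[0, 1]]. *)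
pose F (z : C) : C := shift_kernel a n ('i%C * z) * (f (z + 'i%C) * (g (z^*))^*).
have := @contour_shift R F (-1 - d) d (-1) 0 (K * L * (K1 * K2)).
have eL : cintegral (fun x => F (x +i* 0)) =
    cintegral (fun s => shift_kernel a n ('i%C * s%:C) * (f (s +i* 1) * (g (s +i* 0))^*)).
  apply: eq_cintegral => s; rewrite /F.
  have -> : (s +i* 0) + 'i%C = s +i* 1 by apply/eqP; rewrite eq_complex /= addr0 add0r !eqxx.
  by have -> : (s +i* 0)^* = s +i* 0 by apply/eqP; rewrite eq_complex /= oppr0 !eqxx.
have eR : cintegral (fun x => F (x +i* -1)) =
    cintegral (fun s => shift_kernel a n (- ('i%C * s%:C)) * (f (s +i* 0) * (g (s +i* 1))^*)).
  apply: eq_cintegral => s; rewrite /F.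
  have -> : (s +i* -1) + 'i%C = s +i* 0 by apply/eqP; rewrite eq_complex /= addr0 addNr !eqxx.
  have -> : (s +i* -1)^* = s +i* 1 by apply/eqP; rewrite eq_complex /= opprK !eqxx.
  (* The downward step by [i] is the step by 1 under which the kernel has its exact symmetry. *)
  have -> : 'i%C * (s +i* -1) = 'i%C * s%:C + 1.
    by apply/eqP; rewrite eq_complex /=; apply/andP; split; apply/eqP; ring.
  by rewrite shift_kernel_sym.
rewrite eL eR => H; apply/esym; apply: H.
- lra.
- lra.
- exact: d0.
- move=> z /andP[z1 z2].
  have [D hD] : cdiff F z; last by exists D.
  apply: cdiffM.
    by apply: cdiff_shift_kernel; apply/andP; split; lra.
  apply: cdiffM.
    have := @cdiff_affine R f 1 'i%C z; under eq_fun do rewrite mul1r; apply.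
    rewrite mul1r; apply: c1; case: (z) z1 z2 => x y /= z1 z2.
    by rewrite ltr_norml; apply/andP; split; lra.
  apply: cdiff_conj; apply: c2; case: (z) z1 z2 => x y /= z1 z2.
  by rewrite ltr_norml; apply/andP; split; lra.
move=> x y /andP[y1 y0]; rewrite /F normcM (normcM (f _)) normc_conj.
have ef : (x +i* y) + 'i%C = x +i* (y + 1) by apply/eqP; rewrite eq_complex /= addr0 !eqxx.
have eg : (x +i* y)^* = x +i* (- y) by [].
have hy1 : `|y + 1| <= 1 by rewrite ler_norml; apply/andP; split; lra.
have hy2 : `|- y| <= 1 by rewrite ler_norml; apply/andP; split; lra.
rewrite ef eg.
have B := b x y (introT andP (conj y1 y0)).
have BL := bL `|x| (normr_ge0 x).
have Bk := le_trans B (ler_wpM2l k0 BL).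
(* As [pi / 2 >= 1], each of [f] and [g] supplies a factor [expR (- |x|)]: one pays for the
   polynomial growth of the kernel, the other is the decay required by [contour_shift]. *)
have dec (h : C -> C) (e q : R) (t : R) : 0 < e -> normc (h (x +i* t)) <= q * expR ((rho - 2 - e) * lnp x) * expR (- (pi * `|x| / 2)) ->
    0 <= q -> normc (h (x +i* t)) <= q * expR (- `|x|).
  move=> e0 hb q0; apply: le_trans hb _; rewrite -mulrA ler_wpM2l //.
  rewrite -expRD ler_expR.
  have l1 := lnp_ge0 x; have x1 := normr_ge0 x; have pi2 := @pi_ge2 R.
  have h1 : 0 <= (2 + e - rho) * lnp x by apply: mulr_ge0 l1; have := hrho; lra.
  have h2 : `|x| <= pi * `|x| / 2 by nra.
  by lra.
have F1 := dec f e1 K1 (y + 1) q1 (b1 x _ hy1) k1.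
have F2 := dec g e2 K2 (- y) q2 (b2 x _ hy2) k2.
apply: le_trans (ler_pM (normc_ge0 _) _ Bk (ler_pM (normc_ge0 _) (normc_ge0 _) F1 F2)) _.
  by rewrite mulr_ge0 // normc_ge0.
have E : expR `|x| * expR (- `|x|) = 1 by rewrite -expRD subrr expR0.
have -> : K * (L * expR `|x|) * (K1 * expR (- `|x|) * (K2 * expR (- `|x|))) =
  K * L * (K1 * K2) * ((expR `|x| * expR (- `|x|)) * expR (- `|x|)) by ring.
by rewrite E mul1r.
Qed.

(** At stage [n] moving the line exchanges which of [f] and [g] is evaluated at [s + i] and turns
    the kernel at [i s] into the kernel at [- i s]; the substitution [s -> - s] restores it. Both
    sides are limits of these equal integrals. *)
Lemma shift_form_swap (f g : C -> C) : domainH rho f -> domainH rho g ->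
  shift_form (fun s => f (s +i* 1) * (g (s +i* 0))^*) =
  (shift_form (fun s => g (s +i* 1) * (f (s +i* 0))^*))^*.
Proof.
move=> hf hg; have [M [N [K [ML K0 hK]]]] := weight_bound hrho.
have n1 : `|1 : R| <= 1 by rewrite normr1.
have n0 : `|0 : R| <= 1 by rewrite normr0.
have u1 := fast_decay_domainH hf hg n1 n0.
have u2 := fast_decay_domainH hg hf n1 n0.
rewrite shift_form_conj //; have u3 := fast_decay_conj (fast_decay_opp u2).
have [r1 i1] := shift_form_limit u1 ML K0 hK.
have [r2 i2] := shift_form_limit u3 ML K0 hK.
have E n : cintegral (fun s => shift_kernel a (n + N).+1 ('i%C * s%:C) * (f (s +i* 1) * (g (s +i* 0))^*)) =
   cintegral (fun s => shift_kernel a (n + N).+1 ('i%C * s%:C) * (g ((- s) +i* 1) * (f ((- s) +i* 0))^*)^*).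
  rewrite shift_kernel_contour // -[RHS]cintegral_opp.
    apply: eq_cintegral => s; rewrite opprK.
    have -> : 'i%C * (- s)%:C = - ('i%C * s%:C) :> C by rewrite rmorphN mulrN.
    congr (_ * _); rewrite mulrC.
    pose cj := @conjc R : C -> C.
    have cM (x y : C) : cj (x * y) = cj x * cj y by exact: rmorphM.
    have cK (x : C) : cj (cj x) = x by exact: conjcK.
    by rewrite -[RHS]/(cj _) cM; congr (_ * _); rewrite -[RHS]/(cj (cj _)) cK.
  have [e e0 [L L0 h]] := shift_kernel_bound u3 ML K0 hK.
  apply: (@cintegrable_dom _ _ (fun s => L * expR (- (1 + e) * lnp s) + 0 * expR (- (1 + e) * lnp s))).
  - by apply: cmeasurableM; [exact: cmeasurable_shift_kernel | exact: u3.1].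
  - by apply: integrable_lin; exact: integrable_lnp.
  - by move=> s; rewrite mul0r addr0; apply: h => //; rewrite leqW // leq_addl.
apply/eqP; rewrite eq_complex; apply/andP; split; apply/eqP.
  rewrite (_ : (fun n => complex.Re _) = (fun n => complex.Re (cintegral (fun s => shift_kernel a (n + N).+1 ('i%C * s%:C) * (g ((- s) +i* 1) * (f ((- s) +i* 0))^*)^*)))) in r1; last by apply/funext => n; rewrite E.
  exact: (cvg_unique (@Rhausdorff R) r1 r2).
rewrite (_ : (fun n => complex.Im _) = (fun n => complex.Im (cintegral (fun s => shift_kernel a (n + N).+1 ('i%C * s%:C) * (g ((- s) +i* 1) * (f ((- s) +i* 0))^*)^*)))) in i1; last by apply/funext => n; rewrite E.
exact: (cvg_unique (@Rhausdorff R) i1 i2).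
Qed.

Lemma integrable_opp (f : R -> R) : mu.-integrable setT (EFin \o f) ->
  mu.-integrable setT (EFin \o (fun s => f (- s))).
Proof.
move=> /integrableP[mf hf]; apply/integrableP; split.
  exact: (measurableT_comp mf (@oppr_measurable R setT)).
have m : measurable_fun setT (fun x => `|(EFin \o f) x|)%E by exact: measurableT_comp.
have e := @ge0_integral_opp R _ m (fun=> abse_ge0 _).
by have := hf; rewrite -e.
Qed.

Definition diff_op_form (f g : C -> C) : C :=
  shift_form (fun s => f (s +i* 1) * (g (s +i* 0))^*) - shift_form (fun s => f (s +i* 0) * (g (s +i* 0))^*).

Lemma realE (s : R) : s%:C = s +i* 0 :> C. Proof. by []. Qed.

(** The two halves of the operator contribute equally, their integrands being reflections of each
    other; hence the factor 2. *)
Lemma diff_op_form_inner (f g : C -> C) : domainH rho f -> domainH rho g ->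
  inner rho (fun s : R => diff_op rho f s%:C) (fun s : R => g s%:C) =
  ((4 * pi)^-1)%:C * (2 * diff_op_form f g).
Proof.
move=> hf hg; rewrite /inner; congr (_ * _).
have n1 : `|1 : R| <= 1 by rewrite normr1.
have n0 : `|0 : R| <= 1 by rewrite normr0.
have u1 := shift_form_integrable (fast_decay_domainH hf hg n1 n0).
have u2 := shift_form_integrable (fast_decay_domainH hf hg n0 n0).
pose p (s : R) : C := coef rho s * (W s)%:C * (f (s +i* 1) * (g (s +i* 0))^*) -
   coef rho s * (W s)%:C * (f (s +i* 0) * (g (s +i* 0))^*).
have ip : cintegrable p.
  have := cintegrableD u1 (cintegrableZ (-1) u2); congr cintegrable.
  by apply/funext => s; rewrite mulN1r.
have ipN : cintegrable (fun s => p (- s)).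
  by split; [exact: integrable_opp (proj1 ip) | exact: integrable_opp (proj2 ip)].
have pe : cintegral p = diff_op_form f g by rewrite cintegralB.
rewrite -pe mulr_natl mulr2n -{2}(cintegral_opp ip) -cintegralD //.
apply: eq_cintegral => s; rewrite (diff_op_split hf) /p /shift_part.
have eg : g ((- s) +i* 0) = g (s +i* 0) by exact: (domainH_even hg).
rewrite eg weightN // !realD_i -!realE; ring.
Qed.

(** The shifted terms are exchanged by [shift_form_swap]. The unshifted term is Hermitian by itself:
    conjugation reflects [coef], while [f], [g] and the weight are even. *)
Lemma diff_op_symmetric : symmetric_operator (@inner R rho) (diff_op_graph rho).
Proof.
move=> _ _ _ _ [f hf [-> ->]] [g hg [-> ->]].
have mh := domainH_L2 hrho hf; have mLg := diff_op_L2 hrho hg.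
rewrite [RHS](inner_conj mW mLg mh) !diff_op_form_inner //.
pose cj := @conjc R : C -> C.
have cM (x y : C) : cj (x * y) = cj x * cj y by exact: rmorphM.
have cB (x y : C) : cj (x - y) = cj x - cj y by exact: rmorphB.
have cr (x : R) : cj x%:C = x%:C by apply/eqP; rewrite eq_complex /= oppr0 !eqxx.
have c2 : cj 2 = 2 by exact: rmorph_nat.
rewrite -[RHS]/(cj _) !cM cr c2 /diff_op_form cB; congr (_ * (_ * (_ - _))).
  exact: shift_form_swap.
have n0 : `|0 : R| <= 1 by rewrite normr0.
rewrite -[RHS]/((shift_form _)^*) shift_form_conj; last exact: fast_decay_domainH.
congr shift_form; apply/funext => s.
have eg : g ((- s) +i* 0) = g (s +i* 0) by exact: (domainH_even hg).
have ef : f ((- s) +i* 0) = f (s +i* 0) by exact: (domainH_even hf).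
rewrite eg ef mulrC -[RHS]/(cj (_ * cj _)) cM; congr (_ * _).
by apply/esym; exact: conjcK.
Qed.

End Symmetric.

(** * Test functions *)

Section Hyperbolic.
Variable R : realType.
Local Notation C := R[i].

Definition csinh (z : C) : C :=
  (rsinh (complex.Re z) * cos (complex.Im z)) +i* (rcosh (complex.Re z) * sin (complex.Im z)).
Definition ccosh (z : C) : C :=
  (rcosh (complex.Re z) * cos (complex.Im z)) +i* (rsinh (complex.Re z) * sin (complex.Im z)).

Lemma csinhE z : csinh z = (cexp z + (-1) * cexp ((-1) * z + 0)) * 2^-1.
Proof.
have -> : (-1) * z + 0 = - z by ring.
have -> : (2 : C)^-1 = (2^-1 : R)%:C by rewrite (fmorphV (real_complex R)) (rmorph_nat (real_complex R)).
case: z => x y; rewrite /csinh /cexp /rsinh /rcosh /= cosN sinN.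
by apply/eqP; rewrite eq_complex /=; apply/andP; split; apply/eqP; field.
Qed.

Lemma cdiff_csinh z : cdiff csinh z.
Proof.
rewrite (_ : csinh = fun z => (cexp z + (-1) * cexp ((-1) * z + 0)) * 2^-1); last by apply/funext => w; exact: csinhE.
apply: cdiffM; last exact: cdiff_cst.
apply: cdiffD; first by exists (cexp z); exact: cderiv_cexp.
apply: cdiffM; first exact: cdiff_cst.
by apply: (@cdiff_affine _ (@cexp R)); eexists; exact: cderiv_cexp.
Qed.

Lemma ccosh_csinh x y : ccosh (x +i* y) = 'i%C * csinh (x +i* (y - pi / 2)).
Proof.
rewrite /ccosh /csinh /= cosB sinB cos_pihalf sin_pihalf.
by apply/eqP; rewrite eq_complex /=; apply/andP; split; apply/eqP; ring.
Qed.

Lemma ccoshN z : ccosh (- z) = ccosh z.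
Proof.
case: z => x y; rewrite /ccosh /= rcoshN rsinhN cosN sinN.
by apply/eqP; rewrite eq_complex /=; apply/andP; split; apply/eqP; ring.
Qed.

Lemma sqr_normc_csinh z : normc (csinh z) ^+ 2 = rsinh (complex.Re z) ^+ 2 + sin (complex.Im z) ^+ 2.
Proof.
rewrite sqr_normc_ReIm /=; have := rcosh2Dsinh2 (complex.Re z); have := cos2Dsin2 (complex.Im z).
move: (rcosh _) (rsinh _) (cos _) (sin _) => c s u v h1 h2.
rewrite !exprMn.
have -> : c ^+ 2 = 1 + s ^+ 2 by lra.
have -> : u ^+ 2 = 1 - v ^+ 2 by lra.
ring.
Qed.

Lemma sqr_normc_ccosh z : normc (ccosh z) ^+ 2 = rsinh (complex.Re z) ^+ 2 + cos (complex.Im z) ^+ 2.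
Proof.
rewrite sqr_normc_ReIm /=; have := rcosh2Dsinh2 (complex.Re z); have := cos2Dsin2 (complex.Im z).
move: (rcosh _) (rsinh _) (cos _) (sin _) => c s u v h1 h2.
rewrite !exprMn.
have -> : c ^+ 2 = 1 + s ^+ 2 by lra.
have -> : v ^+ 2 = 1 - u ^+ 2 by lra.
ring.
Qed.

Lemma rsinh_eq0 (x : R) : rsinh x = 0 -> x = 0.
Proof.
move=> h; have : expR x = expR (- x) by move: h; rewrite /rsinh; lra.
by move=> /expR_inj; lra.
Qed.

Lemma csinh_subx z : normc z <= 2^-1 -> normc (csinh z - z) <= 6 * normc z ^+ 3.
Proof.
move=> hz; have n0 := normc_ge0 z.
have hx := normc_lerRe z; have hy := normc_lerIm z.
move: hx hy hz n0; case: z => x y; set r := normc _ => hx hy hz n0.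
have -> : csinh (x +i* y) - (x +i* y) = (rsinh x * cos y - x) +i* (rcosh x * sin y - y) by [].
rewrite /= in hx hy.
have hx2 := le_trans hx hz.
have X := rsinh_subx hx2; have Y := rcosh_sub1 hx2; have Z := cos_sub1 y; have S := sin_subx y.
have sy := sin_lex y.
have c1 : `|cos y| <= 1 by rewrite ler_norml cos_geN1 cos_le1.
apply: le_trans (normc_ler_ReIm (_ +i* _)) _ => /=.
have x3 : `|x| ^+ 3 <= r ^+ 3 by rewrite lerXn2r ?nnegrE.
have y3 : `|y| ^+ 3 <= r ^+ 3 by rewrite lerXn2r ?nnegrE.
have A : `|rsinh x * cos y - x| <= 3 * r ^+ 3.
  have -> : rsinh x * cos y - x = (rsinh x - x) * cos y + x * (cos y - 1) by ring.
  apply: le_trans (ler_normD _ _) _; rewrite !normrM.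
  have a1 := ler_pM (normr_ge0 _) (normr_ge0 _) X c1.
  have a2 := ler_pM (normr_ge0 _) (normr_ge0 _) hx Z.
  have a3 : r * y ^+ 2 <= r ^+ 3.
    by rewrite (exprS r 2) ler_wpM2l // -(sqr_absr y) lerXn2r ?nnegrE.
  lra.
have B : `|rcosh x * sin y - y| <= 3 * r ^+ 3.
  have -> : rcosh x * sin y - y = (rcosh x - 1) * sin y + (sin y - y) by ring.
  apply: le_trans (ler_normD _ _) _; rewrite !normrM.
  have a1 := ler_pM (normr_ge0 _) (normr_ge0 _) Y (le_trans sy hy).
  have a3 : x ^+ 2 * r <= r ^+ 3.
    by rewrite (exprSr r 2) ler_wpM2r // -(sqr_absr x) lerXn2r ?nnegrE.
  lra.
lra.
Qed.

Definition sinhc (w : C) : C := if w == 0 then pi%:C else csinh (pi%:C * w) / w.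

Lemma cdiff_ext (f g : C -> C) z (d : R) : 0 < d -> (forall h, normc h < d -> f (z + h) = g (z + h)) ->
  cdiff f z -> cdiff g z.
Proof. by move=> d0 h [D hD]; exists D; exact: cderiv_ext d0 h hD. Qed.

Lemma normc_gt0 (z : C) : z != 0 -> 0 < normc z.
Proof.
move=> z0; rewrite lt_def normc_ge0 andbT; apply/eqP => h; move: z0.
by rewrite (eq0_normc h) eqxx.
Qed.

Lemma cdiff_sinhc w : cdiff sinhc w.
Proof.
have [->|w0] := eqVneq w 0; last first.
  apply: (@cdiff_ext (fun w => csinh (pi%:C * w + 0) * w^-1) _ w (normc w)).
  - exact: normc_gt0.
  - move=> h hw; rewrite /sinhc addr0 ifF //; apply/eqP => e.
    by move: hw; rewrite -normcN (_ : - h = w) ?ltxx //; move/eqP: e; rewrite addr_eq0 => /eqP.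
  apply: cdiffM; first by apply: (@cdiff_affine _ csinh); exact: cdiff_csinh.
  by apply: (@cdiffV _ id) => //; exact: cdiff_id.
exists 0 => e e0.
have p0 := @pi_gt0 R.
have q0 : 0 < 6 * pi ^+ 3 :> R by rewrite mulr_gt0 // exprn_gt0.
exists (Num.min (2 * pi)^-1 (e / (6 * pi ^+ 3))).
  by rewrite lt_min invr_gt0 mulr_gt0 //= divr_gt0.
move=> h; rewrite lt_min => /andP[h1 h2]; rewrite add0r mul0r subr0.
have [->|h0] := eqVneq h 0; first by rewrite subrr normc0 mulr0.
have n0 := normc_gt0 h0.
rewrite /sinhc eqxx (negbTE h0).
have -> : csinh (pi%:C * h) / h - pi%:C = (csinh (pi%:C * h) - pi%:C * h) / h by field.
rewrite normcM normcV ler_pdivrMr //.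
have np : normc (pi%:C * h) = pi * normc h by rewrite normcM normc_real gtr0_norm.
have hs : normc (pi%:C * h) <= 2^-1.
  rewrite np; have := ltW h1; rewrite invfM mulrC => /(ler_wpM2l (ltW p0)).
  by rewrite mulrA mulrV ?mul1r // unitfE gt_eqF.
apply: le_trans (csinh_subx hs) _; rewrite np.
have -> : 6 * (pi * normc h) ^+ 3 = (6 * pi ^+ 3 * normc h) * normc h * normc h by ring.
have n1 := ltW n0; apply: (ler_wpM2r n1); apply: (ler_wpM2r n1).
by have := ltW h2; rewrite ler_pdivlMr // mulrC.
Qed.

(** By [|sinh (x + i y)|^2 = sinh(x)^2 + sin(y)^2] the zeros of [csinh] are the multiples of [i pi];
    in this strip only the removed one occurs. *)
Lemma sinhc_neq0 w : `|complex.Im w| < 1 -> sinhc w != 0.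
Proof.
rewrite /sinhc; case: ifPn => [/eqP _ _|w0 hw].
  by rewrite eq_complex /= negb_and (gt_eqF (@pi_gt0 R)).
rewrite mulf_neq0 ?invr_eq0 //; apply/eqP => h.
have := sqr_normc_csinh (pi%:C * w); rewrite h normc0 expr0n /=.
move: w0 hw {h}; case: w => x y w0 /= hw.
have -> : pi * x - 0 * y = pi * x by ring.
have -> : pi * y + 0 * x = pi * y by ring.
move=> /esym/eqP; rewrite paddr_eq0 ?sqr_ge0 // !sqrf_eq0 => /andP[/eqP/rsinh_eq0/eqP].
rewrite mulf_eq0 (gt_eqF (@pi_gt0 R)) /= => /eqP x0.
have y0 : y != 0 by apply: contra w0 => /eqP ->; rewrite x0.
have p0 := @pi_gt0 R.
have sy : 0 < sin (pi * `|y|).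
  by apply: sin_gt0_pi; rewrite mulr_gt0 ?normr_gt0 //= gtr_pMr.
have : `|sin (pi * y)| = sin (pi * `|y|).
  case: (ger0P y) sy => hy sy; first by rewrite gtr0_norm.
  by move: sy; rewrite mulrN sinN oppr_gt0 => sy; rewrite ltr0_norm.
by move=> e /eqP z; move: sy; rewrite -e z normr0 ltxx.
Qed.

Definition halfi : C := 0 +i* 2^-1.

Lemma halfi_mul : 2 * halfi = 'i%C.
Proof. by apply/eqP; rewrite eq_complex /=; apply/andP; split; apply/eqP; field. Qed.

Lemma halfi_sqr : halfi * halfi = - 4^-1.
Proof.
rewrite -[4^-1]/((4 : C)^-1) -(rmorph_nat (real_complex R)) -(fmorphV (real_complex R)).
by apply/eqP; rewrite eq_complex /=; apply/andP; split; apply/eqP; field.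
Qed.

(* [(z ^+ 2 + 1/4) / cosh (pi z)] with its singularities at [z = +- i/2] removed. *)
Definition ktest (z : C) : C :=
  if z == - halfi then (pi^-1)%:C else (z + halfi) / ('i%C * sinhc (z - halfi)).

Lemma i_neq0 : 'i%C != 0 :> C.
Proof. by rewrite eq_complex /= oner_eq0 andbF. Qed.

Lemma ktestE z : z != halfi -> z != - halfi -> ktest z = (z ^+ 2 + 4^-1) / ccosh (pi%:C * z).
Proof.
move=> h1 h2; rewrite /ktest (negbTE h2) /sinhc subr_eq0 (negbTE h1).
have -> : z ^+ 2 + 4^-1 = (z + halfi) * (z - halfi).
  have -> : (z + halfi) * (z - halfi) = z ^+ 2 - halfi * halfi by ring.
  by rewrite halfi_sqr opprK.
have -> : ccosh (pi%:C * z) = 'i%C * csinh (pi%:C * (z - halfi)).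
  case: (z) => x y.
  have -> : pi%:C * (x +i* y) = (pi * x) +i* (pi * y).
    by apply/eqP; rewrite eq_complex /=; apply/andP; split; apply/eqP; ring.
  rewrite ccosh_csinh; congr (_ * csinh _).
  by apply/eqP; rewrite eq_complex /=; apply/andP; split; apply/eqP; field.
by rewrite !invfM invrK; ring.
Qed.

Lemma ktest_half : ktest halfi = (pi^-1)%:C.
Proof.
rewrite /ktest ifF; last first.
  by rewrite eq_complex /= oppr0 eqxx /=; apply/negbTE; rewrite gt_eqF // (@lt_trans _ _ 0) // oppr_lt0 invr_gt0.
rewrite subrr /sinhc eqxx -mulr2n -mulr_natl halfi_mul invfM mulrA mulfV ?i_neq0 // mul1r.
by rewrite (fmorphV (real_complex R)).
Qed.

Lemma ktestN z : ktest (- z) = ktest z.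
Proof.
have k1 : ktest (- halfi) = (pi^-1)%:C by rewrite /ktest eqxx.
have [->|h1] := eqVneq z halfi; first by rewrite k1 ktest_half.
have [->|h2] := eqVneq z (- halfi); first by rewrite opprK k1 ktest_half.
rewrite !ktestE //; last 2 first.
- by rewrite eqr_oppLR.
- by rewrite eqr_opp.
by rewrite sqrrN mulrN ccoshN.
Qed.

(** In the upper half of the strip [z - halfi] stays where [sinhc] has no zero, so the quotient
    formula is regular, even at [halfi]. The lower half follows by evenness; there
    [sinhc (z - halfi)] vanishes at [- halfi], whence the prescribed value at that point. *)
Lemma cdiff_ktest z : `|complex.Im z| < 3 / 2 -> cdiff ktest z.
Proof.
have pos w : 0 <= complex.Im w < 3 / 2 -> cdiff ktest w.
  move=> /andP[w0 w1].
  apply: (@cdiff_ext (fun z => (z + halfi) / ('i%C * sinhc (1 * z + (- halfi)))) _ w 2^-1) => //.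
    move=> h hh; rewrite /ktest mul1r ifF //; apply/eqP => e.
    have := normc_lerIm h; rewrite (_ : h = - halfi - w); last by rewrite -e addrC addKr.
    rewrite Im_sub /= ltr0_norm; last by lra.
    move: hh; rewrite (_ : h = - halfi - w); last by rewrite -e addrC addKr.
    by lra.
  apply: cdiffM.
    by apply: cdiffD; [exact: cdiff_id | exact: cdiff_cst].
  apply: cdiffV.
    rewrite mulf_neq0 ?i_neq0 // sinhc_neq0 // mul1r Im_add /=.
    by rewrite ltr_norml; apply/andP; split; lra.
  apply: cdiffM; first exact: cdiff_cst.
  by apply: cdiff_affine; exact: cdiff_sinhc.
rewrite ltr_norml => /andP[z1 z2].
have [z0|z0] := leP 0 (complex.Im z); first by apply: pos; rewrite z0.
rewrite (_ : ktest = fun w => ktest ((-1) * w + 0)); last first.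
  by apply/funext => w; rewrite addr0 mulN1r ktestN.
apply: cdiff_affine; apply: pos; rewrite addr0 mulN1r; case: (z) z0 z1 => x y /= z0 z1.
by apply/andP; split; lra.
Qed.

Lemma rsinh_ge (u : R) : 1 <= u -> expR u / 4 <= rsinh u.
Proof.
move=> u1; rewrite /rsinh.
have h1 := expR_ge1Dx u; have h2 := expRxMexpNx_1 u; have h3 := expR_gt0 u; have h4 := expR_gt0 (- u).
have : expR (- u) <= expR u / 2 by nra.
lra.
Qed.

Lemma ccosh_ge (x y : R) : 1 <= `|x| -> expR (pi * `|x|) / 4 <= normc (ccosh (pi%:C * (x +i* y))).
Proof.
move=> x1; have p2 := @pi_ge2 R.
have u1 : 1 <= pi * `|x| by nra.
apply: le_trans (rsinh_ge u1) _.
have -> : pi%:C * (x +i* y) = (pi * x) +i* (pi * y).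
  by apply/eqP; rewrite eq_complex /=; apply/andP; split; apply/eqP; ring.
have s0 : 0 <= rsinh (pi * `|x|).
  by apply: le_trans (rsinh_ge u1); rewrite divr_ge0 // expR_ge0.
rewrite -(@ler_pXn2r _ 2) ?nnegrE ?normc_ge0 // sqr_normc_ccosh /=.
have -> : rsinh (pi * x) ^+ 2 = rsinh (pi * `|x|) ^+ 2.
  by case: (ger0P x) => // _; rewrite mulrN rsinhN sqrrN.
by rewrite lerDl sqr_ge0.
Qed.

End Hyperbolic.

(** * The functions [h_n], their extensions, and the action of the operator *)

Section TestFunctions.
Variables (R : realType) (rho : R).
Hypothesis hrho : rho < 2^-1.
Local Notation C := R[i].
Local Notation a := (2^-1 - rho).

Let a0 : 0 < a. Proof. by rewrite subr_gt0. Qed.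

Definition qpoly (n : nat) (z : C) : C := \prod_(k < n) ((k%:R + 2^-1) ^+ 2 + z ^+ 2).
Definition qpolyr (n : nat) (s : R) : R := \prod_(k < n) ((k%:R + 2^-1) ^+ 2 + s ^+ 2).
Definition cnorm (n : nat) : R := \prod_(k < n) (a + k%:R + 2^-1).

Lemma cnorm_gt0 n : 0 < cnorm n.
Proof.
apply: prodr_gt0 => k _; have k0 : (0 : R) <= k%:R by [].
by have := a0; lra.
Qed.

Lemma qpoly_real n (s : R) : qpoly n s%:C = (qpolyr n s)%:C.
Proof.
rewrite /qpoly /qpolyr rmorph_prod; apply: eq_bigr => k _.
rewrite (rmorphD (real_complex R)) !(rmorphXn (real_complex R)) (rmorphD (real_complex R)).
by rewrite (rmorph_nat (real_complex R)) (fmorphV (real_complex R)) (rmorph_nat (real_complex R)).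
Qed.

Lemma qpolyN n z : qpoly n (- z) = qpoly n z.
Proof. by rewrite /qpoly; under eq_bigr do rewrite sqrrN. Qed.

Lemma sqr_i : 'i%C * 'i%C = -1 :> C.
Proof. by apply/eqP; rewrite eq_complex /=; apply/andP; split; apply/eqP; ring. Qed.

(** With each factor written as [(k + 1/2 - i z) (k + 1/2 + i z)], the shift moves the first kind up
    and the second kind down by one. Two factors are gained at the top, and the sign comes from the
    lowest one, [-1/2 + i z]. *)
Lemma qpoly_shift n z : qpoly n.+1 (z + 'i%C) =
  - (qpoly n z * (n%:R + 2^-1 - 'i%C * z) * (n%:R + 3 / 2 - 'i%C * z)).
Proof.
have fac (k : nat) : (k%:R + 2^-1) ^+ 2 + z ^+ 2 = (k%:R + 2^-1 - 'i%C * z) * (k%:R + 2^-1 + 'i%C * z).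
  rewrite (_ : _ * _ = (k%:R + 2^-1) ^+ 2 - ('i%C * 'i%C) * z ^+ 2); last by ring.
  by rewrite sqr_i; ring.
elim: n => [|n IH].
  rewrite /qpoly big_ord_recl !big_ord0 !mulr1 mul1r !add0r.
  have -> : (z + 'i%C) ^+ 2 = z ^+ 2 + 2 * 'i%C * z + 'i%C * 'i%C by ring.
  have -> : - ((2^-1 - 'i%C * z) * (3 / 2 - 'i%C * z)) = - (3 / 4) + 2 * 'i%C * z - ('i%C * 'i%C) * z ^+ 2 by field.
  by rewrite sqr_i; field.
rewrite {1}/qpoly big_ord_recr -/(qpoly n.+1 _) IH {2}/qpoly big_ord_recr -/(qpoly n _) /= fac -(natr1 n).
have -> : (n%:R + 1 + 2^-1) ^+ 2 + (z + 'i%C) ^+ 2 = (n%:R + 2^-1 + 'i%C * z) * (n%:R + 1 + 3 / 2 - 'i%C * z).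
  rewrite (_ : _ * _ = (n%:R + 2^-1) * (n%:R + 1 + 3 / 2) + 2 * 'i%C * z - ('i%C * 'i%C) * z ^+ 2); last by field.
  rewrite (_ : (z + 'i%C) ^+ 2 = z ^+ 2 + 2 * 'i%C * z + 'i%C * 'i%C); last by ring.
  by rewrite sqr_i; field.
by field.
Qed.

Definition htest (n : nat) (s : R) : R := qpolyr n s / cnorm n / rcosh (pi * s).

Lemma htest_complex n s : (htest n s)%:C = qpoly n s%:C / (cnorm n)%:C / (rcosh (pi * s))%:C.
Proof.
have h (x y z : R) : (x / y / z)%:C = x%:C / y%:C / z%:C.
  by rewrite !(rmorphM (real_complex R)) !(fmorphV (real_complex R)).
by rewrite /htest h qpoly_real.
Qed.

(** The extension of [htest n.+1], not of [htest n]: [htest 0] has poles at [+- i/2], inside the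
    strip, and the first factor of [qpoly n.+1] is what cancels them. *)
Definition htest_ext (n : nat) (z : C) : C :=
  ktest z * \prod_(k < n) ((k.+1%:R + 2^-1) ^+ 2 + z ^+ 2) / (cnorm n.+1)%:C.

Lemma htest_extE n z : z != halfi R -> z != - halfi R ->
  htest_ext n z = qpoly n.+1 z / ccosh (pi%:C * z) / (cnorm n.+1)%:C.
Proof.
move=> h1 h2; rewrite /htest_ext ktestE // /qpoly big_ord_recl /=.
rewrite (_ : (0%:R + 2^-1) ^+ 2 + z ^+ 2 = z ^+ 2 + 4^-1); last by field.
congr (_ / _); rewrite mulrAC; congr (_ * _ / _).
Qed.

Lemma htest_ext_real n (s : R) : htest_ext n s%:C = (htest n.+1 s)%:C.
Proof.
rewrite htest_extE; last 2 first.
- by rewrite eq_complex /= negb_and; apply/orP; right; apply/eqP; lra.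
- by rewrite eq_complex /= negb_and; apply/orP; right; apply/eqP; lra.
have -> : ccosh (pi%:C * s%:C) = (rcosh (pi * s))%:C.
  rewrite -(rmorphM (real_complex R)) /ccosh /= cos0 sin0.
  by apply/eqP; rewrite eq_complex /= mulr1 mulr0 !eqxx.
by rewrite htest_complex mulrAC.
Qed.

Lemma htest_ext_i n (s : R) : htest_ext n (s%:C + 'i%C) =
  qpoly n s%:C * (n%:R + 2^-1 - 'i%C * s%:C) * (n%:R + 3 / 2 - 'i%C * s%:C) / (rcosh (pi * s))%:C / (cnorm n.+1)%:C.
Proof.
rewrite htest_extE; last 2 first.
- rewrite eq_complex /= negb_and; apply/orP; right; apply/eqP; lra.
- rewrite eq_complex /= negb_and; apply/orP; right; apply/eqP; lra.
(* The antiperiodicity of [cosh] cancels the sign in [qpoly_shift]. *)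
have -> : ccosh (pi%:C * (s%:C + 'i%C)) = - (rcosh (pi * s))%:C.
  have -> : pi%:C * (s%:C + 'i%C) = (pi * s) +i* pi.
    by apply/eqP; rewrite eq_complex /=; apply/andP; split; apply/eqP; ring.
  rewrite /ccosh /= cospi sinpi.
  by apply/eqP; rewrite eq_complex /= mulrN1 mulr0 oppr0 !eqxx.
by rewrite qpoly_shift invrN mulrNN.
Qed.

Lemma htest_extN n z : htest_ext n (- z) = htest_ext n z.
Proof. by rewrite /htest_ext ktestN sqrrN. Qed.

Lemma htestN n s : htest n (- s) = htest n s.
Proof. by rewrite /htest /qpolyr sqrrN mulrN rcoshN. Qed.

Lemma rcosh_gt0 (x : R) : 0 < rcosh x.
Proof. exact: lt_le_trans ltr01 (rcosh_ge1 x). Qed.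

Lemma htest_recr n s : htest n.+1 s = htest n s * (((n%:R + 2^-1) ^+ 2 + s ^+ 2) / (a + n%:R + 2^-1)).
Proof.
rewrite /htest /qpolyr /cnorm !big_ord_recr /= -/(cnorm n) -/(qpolyr n s).
have := cnorm_gt0 n; have := cnorm_gt0 n.+1; rewrite {1}/cnorm big_ord_recr /= -/(cnorm n) => h1 h2.
have c0 := rcosh_gt0 (pi * s).
move: h1; rewrite pmulr_rgt0 // => h1.
move: (a + n%:R + 2^-1) h1 => d h1.
by field; rewrite !gt_eqF.
Qed.

Lemma cnormS n : (cnorm n.+1)%:C = (cnorm n)%:C * (a%:C + n%:R + 2^-1).
Proof.
rewrite /cnorm big_ord_recr /= (rmorphM (real_complex R)) !(rmorphD (real_complex R)).
by rewrite (rmorph_nat (real_complex R)) (fmorphV (real_complex R)) (rmorph_nat (real_complex R)).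
Qed.

(** With [t = i s], the increment at [s + i] is [h_n (n + 1/2 - t) (1 - 2 t) / d], where
    [d = a + n + 1/2], and [1 - 2 t] cancels against the coefficient. The two terms then add up to
    [h_n ((a + t) (n + 1/2 + t) - (a - t) (n + 1/2 - t)) / (2 t d) = h_n], which explains the
    normalization [cnorm]. *)
Lemma diff_op_htest n (s : R) : s != 0 -> diff_op rho (htest_ext n) s%:C = (htest n s)%:C.
Proof.
move=> s0; pose t := 'i%C * s%:C.
have t2 : (s%:C) ^+ 2 = - (t * t).
  by rewrite /t mulrACA sqr_i mulN1r opprK.
have hN : htest_ext n (s%:C - 'i%C) = htest_ext n ((- s)%:C + 'i%C).
  by rewrite -htest_extN; congr htest_ext; rewrite (rmorphN (real_complex R)); ring.
have sN : 'i%C * (- s)%:C = - t by rewrite (rmorphN (real_complex R)) mulrN.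
have t0 : t != 0.
  by rewrite mulf_neq0 ?i_neq0 // eq_complex /= negb_and s0.
have t1 : 1 - 2 * t != 0.
  by rewrite eq_complex /= negb_and; apply/orP; left; apply/eqP; lra.
have t3 : 1 + 2 * t != 0.
  by rewrite eq_complex /= negb_and; apply/orP; left; apply/eqP; lra.
pose H := (htest n s)%:C; pose d := a%:C + n%:R + 2^-1.
have HE : H = qpoly n s%:C / (cnorm n)%:C / (rcosh (pi * s))%:C.
  exact: htest_complex.
have nat2 : (2 : C) = (2 : R)%:C by rewrite (rmorph_nat (real_complex R)).
have d0 : d != 0.
  apply: neq0_Re; rewrite /d nat2 -(fmorphV (real_complex R)) -(rmorph_nat (real_complex R)) /=.
  by have := a0; have : (0 : R) <= n%:R by []; lra.
have Ep : htest_ext n (s%:C + 'i%C) = H * (n%:R + 2^-1 - t) * (n%:R + 3 / 2 - t) / d.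
  by rewrite htest_ext_i -/t cnormS -/d HE invfM; ring.
have Em : htest_ext n (s%:C - 'i%C) = H * (n%:R + 2^-1 + t) * (n%:R + 3 / 2 + t) / d.
  rewrite hN htest_ext_i sN !opprK cnormS -/d HE invfM mulrN rcoshN (rmorphN (real_complex R)) qpolyN; ring.
have E0 : htest_ext n s%:C = H * (n%:R + 2^-1 - t) * (n%:R + 2^-1 + t) / d.
  rewrite htest_ext_real htest_complex.
  rewrite cnormS -/d HE /qpoly big_ord_recr /= -/(qpoly n _) t2 invfM; ring.
rewrite /diff_op Ep Em E0.
have -> : - 2 * 'i%C * s%:C = - 2 * t by rewrite mulrA.
have -> : 2 * 'i%C * s%:C = 2 * t by rewrite mulrA.
rewrite -/t -/H; have nE : n%:R = d - a%:C - 2^-1 by rewrite /d; ring.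
rewrite nE; move: (a%:C) => A; move: H d t d0 t0 t1 t3 {HE Ep Em E0 hN sN t2 nE} => H d t d0 t0 t1 t3.
by field; rewrite d0 t0 t1 t3.
Qed.

Lemma normc_qpoly m : exists2 K : R, 0 <= K & forall x y : R, `|y| <= 1 ->
  normc (qpoly m (x +i* y)) <= K * (1 + `|x|) ^+ (2 * m).
Proof.
elim: m => [|m [K K0 IH]].
  by exists 1 => // x y _; rewrite /qpoly big_ord0 normc1 expr0 mulr1.
exists (K * ((m%:R + 2^-1) ^+ 2 + 1)); first by rewrite mulr_ge0 // addr_ge0 // sqr_ge0.
move=> x y hy; rewrite /qpoly big_ord_recr /= -/(qpoly m _) normcM.
have x0 := normr_ge0 x.
have nz : normc (x +i* y) <= 1 + `|x|.
  by apply: le_trans (normc_ler_ReIm _) _; rewrite /= addrC lerD2r.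
have h : normc ((m%:R + 2^-1) ^+ 2 + (x +i* y) ^+ 2) <= ((m%:R + 2^-1) ^+ 2 + 1) * (1 + `|x|) ^+ 2.
  apply: le_trans (le_normcD _ _) _.
  have -> : (m%:R + 2^-1 : C) = (m%:R + 2^-1)%:C.
    by rewrite (rmorphD (real_complex R)) (rmorph_nat (real_complex R)) (fmorphV (real_complex R)) (rmorph_nat (real_complex R)).
  rewrite -(rmorphXn (real_complex R)) normc_real ger0_norm ?sqr_ge0 //.
  rewrite [(x +i* y) ^+ 2]expr2 normcM -expr2 mulrDl mul1r lerD //.
    by rewrite ler_peMr ?sqr_ge0 // expr_ge1 // ?addr_ge0 // lerDl.
  by rewrite lerXn2r ?nnegrE ?normc_ge0 ?addr_ge0.
apply: le_trans (ler_pM (normc_ge0 _) (normc_ge0 _) (IH x y hy) h) _.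
by rewrite mulnS exprD le_eqVlt; apply/orP; left; apply/eqP; ring.
Qed.

(** The decay [expR (- pi |x|)] of [1 / ccosh] is twice what the domain asks; the spare half absorbs
    the polynomial and the required negative power. *)
Lemma htest_ext_domainH n : domainH rho (htest_ext n).
Proof.
exists 4^-1 => //; split.
- by move=> z _; exact: htest_extN.
- move=> z hz; have [D hD] : cdiff (htest_ext n) z; last exact: cderiv_derivable hD.
  apply: cdiffM; last exact: cdiff_cst.
  apply: cdiffM; first by apply: cdiff_ktest; apply: lt_trans hz _; lra.
  apply: (@cdiff_prod _ _ (fun k z => (k.+1%:R + 2^-1) ^+ 2 + z ^+ 2)) => k.
  by apply: cdiffD; [exact: cdiff_cst | apply: cdiffM; exact: cdiff_id].
(* With [eps = M - (2 - rho)] the exponent [rho - 2 - eps] is the integer [- M]. *)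
pose M := (Num.truncn (2 - rho)).+1.
have hM : 2 - rho < M%:R by exact: truncnS_gt.
exists (M%:R - (2 - rho)); first by rewrite subr_gt0.
have [K K0 hK] := normc_qpoly n.+1.
have [L L0 hL] := @pow_le_exp R (2 * n.+1 + M).
have c0 := cnorm_gt0 n.+1.
exists 1, (K * 4 / cnorm n.+1 * L) => -[x y] /= hy hx.
have -> : rho - 2 - (M%:R - (2 - rho)) = - M%:R by ring.
have x0 : 0 < `|x| by lra.
have z1 : `|x| <= normc (x +i* y) := normc_lerRe (x +i* y).
have z0 : 0 < normc (x +i* y) by lra.
have z2 : normc (x +i* y) <= 1 + `|x|.
  by apply: le_trans (normc_ler_ReIm _) _; rewrite /= addrC lerD2r.
have xn0 : x != 0 by rewrite -normr_gt0.
rewrite -[Num.ExtraDef.sqrtr _]/(normc (x +i* y)).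
have nh : forall z : C, complex.Re z = 0 -> x +i* y != z.
  by move=> z hz; rewrite eq_complex /= hz (negbTE xn0).
rewrite htest_extE; [|exact: nh|by apply: nh; rewrite /= oppr0].
rewrite normcM (normcM (qpoly _ _)) !normcV normc_real (gtr0_norm c0).
have C1 := @ccosh_ge R x y hx; have Cp : 0 < normc (ccosh (pi%:C * (x +i* y))).
  by apply: lt_le_trans C1; rewrite divr_gt0 // expR_gt0.
rewrite ler_pdivrMr // ler_pdivrMr //.
apply: le_trans (hK x y hy) _.
rewrite powRN powR_mulrn ?(ltW z0) //.
have E := expR_gt0 (pi * `|x| / 2).
have E2 : expR (pi * `|x|) = expR (pi * `|x| / 2) * expR (pi * `|x| / 2) by rewrite -expRD; congr expR; field.
have zM : 0 < normc (x +i* y) ^+ M by rewrite exprn_gt0.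
rewrite expRN.
set N := normc (x +i* y) in z0 z1 z2 zM *.
apply: (@le_trans _ _ (K * 4 / cnorm n.+1 * L / N ^+ M / expR (pi * `|x| / 2) * cnorm n.+1 * (expR (pi * `|x|) / 4))); last first.
  have p : 0 <= K * 4 / cnorm n.+1 * L / N ^+ M / expR (pi * `|x| / 2) * cnorm n.+1.
    rewrite mulr_ge0 ?(ltW c0) // divr_ge0 ?(ltW E) // divr_ge0 ?(ltW zM) // mulr_ge0 // divr_ge0 ?(ltW c0) //.
    by rewrite mulr_ge0.
  exact: ler_wpM2l p _ _ C1.
rewrite E2.
have -> : K * 4 / cnorm n.+1 * L / N ^+ M / expR (pi * `|x| / 2) * cnorm n.+1 *
   (expR (pi * `|x| / 2) * expR (pi * `|x| / 2) / 4) = K * (L * expR (pi * `|x| / 2) / N ^+ M).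
  by field; rewrite !gt_eqF.
rewrite ler_wpM2l // ler_pdivlMr //.
apply: (@le_trans _ _ ((1 + `|x|) ^+ (2 * n.+1 + M))).
  rewrite exprD ler_wpM2l ?exprn_ge0 ?addr_ge0 //.
  by rewrite lerXn2r ?nnegrE ?addr_ge0 // ltW.
apply: le_trans (hL `|x| (normr_ge0 x)) _.
rewrite ler_wpM2l // ler_expR; have := @pi_ge2 R; nra.
Qed.

End TestFunctions.

(** * Density of polynomials *)

Lemma bernoulli (R : realDomainType) (x : R) n : -1 <= x -> 1 + n%:R * x <= (1 + x) ^+ n.
Proof.
move=> x1; elim: n => [|n IH]; first by rewrite mul0r addr0 expr0.
have h : 0 <= 1 + x by lra.
rewrite exprS; apply: le_trans (ler_wpM2l h IH).
rewrite -subr_ge0 -natr1.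
have -> : (1 + x) * (1 + n%:R * x) - (1 + (n%:R + 1) * x) = n%:R * x ^+ 2 by ring.
by rewrite mulr_ge0 // sqr_ge0.
Qed.

Section PolynomialDensity.
Variable R : realType.
Local Notation mu := (@lebesgue_measure R).
Variables (D : R -> R) (K : R).
Hypothesis mD : measurable_fun setT D.
Hypothesis D0 : forall s, 0 <= D s.
Hypothesis DK : forall s, D s <= K * expR (- `|s|).

Lemma pow_le_exp4 (m : nat) : exists2 L : R, 0 <= L & forall s : R,
  (1 + `|s|) ^+ m <= L * expR (`|s| / 4).
Proof.
have [L L0 h] := @pow_le_exp R m; exists (4 ^+ m * L); first by rewrite mulr_ge0 // exprn_ge0.
move=> s; have s0 := normr_ge0 s.
apply: (@le_trans _ _ ((4 * (1 + `|s| / 4)) ^+ m)).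
  by rewrite lerXn2r ?nnegrE ?mulr_ge0 ?addr_ge0 ?divr_ge0 //; lra.
by rewrite exprMn -mulrA ler_wpM2l ?exprn_ge0 // h // divr_ge0.
Qed.

Lemma integrable_exp4 : mu.-integrable setT (EFin \o (fun s : R => expR (- (`|s| / 4)))).
Proof.
have [L L0 h] := pow_le_exp4 2.
have mn : measurable_fun setT (fun s : R => `|s|).
  by apply: continuous_measurable_fun; exact: continuous_normr.
apply: (@integrable_dom _ _ (fun s => L * expR (- (1 + 1) * lnp s) + 0 * expR (- (1 + 1) * lnp s))).
- apply: (measurableT_comp (@measurable_expR R)); apply: measurableT_comp => //.
  by apply: measurable_funM => //; exact: measurable_cst.
- by apply: integrable_lin; exact: integrable_lnp.
- move=> s; rewrite mul0r addr0 ger0_norm ?expR_ge0 // mulNr !expRN.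
  have E1 := expR_gt0 (`|s| / 4).
  have -> : expR ((1 + 1) * lnp s) = (1 + `|s|) ^+ 2 by exact: (expR_lnpX 2 s).
  have s2 : 0 < (1 + `|s|) ^+ 2 by rewrite exprn_gt0 // ltr_wpDr.
  by rewrite -[leLHS]mul1r ler_pdivrMr // mulrAC ler_pdivlMr // mul1r.
Qed.

Lemma poly_growth (p : {poly R}) : exists (N : nat) (L : R), 0 <= L /\ forall s : R,
  `|p.[s ^+ 2]| <= L * (1 + `|s|) ^+ N.
Proof.
elim/poly_ind: p => [|p c [N [L [L0 h]]]].
  by exists 0%N, 0; split=> // s; rewrite horner0 normr0 mul0r.
exists (2 + N)%N, (L + `|c|); split; first by rewrite addr_ge0.
move=> s; rewrite hornerMXaddC mulrDl; have s0 := normr_ge0 s.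
have s1 : 1 <= 1 + `|s| by rewrite lerDl.
apply: le_trans (ler_normD _ _) _; apply: lerD; last first.
  by rewrite ler_peMr // expr_ge1 // (le_trans ler01).
have s2 : `|s| ^+ 2 <= (1 + `|s|) ^+ 2 by rewrite lerXn2r ?nnegrE ?addr_ge0 // lerDr.
have s3 : 0 <= `|s| ^+ 2 by rewrite exprn_ge0.
rewrite normrM normrX exprD; apply: le_trans (ler_pM (normr_ge0 _) s3 (h s) s2) _.
by rewrite le_eqVlt; apply/orP; left; apply/eqP; ring.
Qed.

Lemma poly_growth4 (p : {poly R}) : exists2 L : R, 0 <= L & forall s : R,
  `|p.[s ^+ 2]| <= L * expR (`|s| / 4).
Proof.
have [N [L [L0 h]]] := poly_growth p; have [L' L'0 h'] := pow_le_exp4 N.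
exists (L * L'); first exact: mulr_ge0.
by move=> s; apply: le_trans (h s) _; rewrite -mulrA ler_wpM2l.
Qed.

Lemma measurable_poly2 (p : {poly R}) : measurable_fun setT (fun s : R => p.[s ^+ 2]).
Proof.
elim/poly_ind: p => [|p c h].
  by under eq_fun do rewrite horner0; exact: measurable_cst.
under eq_fun do rewrite hornerMXaddC; apply: measurable_funD; last exact: measurable_cst.
by apply: measurable_funM => //; exact: exprn_measurable.
Qed.

Definition approx_by (f : R -> R) (p : {poly R}) (s : R) := (f s - p.[s ^+ 2]) ^+ 2 * D s.

(** Membership in the closure of the polynomials in [s^2] for the squared norm with density [D]. The
    class is enlarged step by step to all even square-integrable functions. *)
Definition poly_approx (f : R -> R) := measurable_fun setT f /\
  forall e : R, 0 < e -> exists p : {poly R},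
    mu.-integrable setT (EFin \o approx_by f p) /\ \int[mu]_s approx_by f p s < e.

Lemma measurable_approx_by f p : measurable_fun setT f -> measurable_fun setT (approx_by f p).
Proof.
move=> mf; apply: measurable_funM => //; apply: measurable_funX; apply: measurable_funB => //.
exact: measurable_poly2.
Qed.

Lemma approx_by_ge0 f p s : 0 <= approx_by f p s.
Proof. by rewrite mulr_ge0 // sqr_ge0. Qed.

Lemma Rintegral_le (f g : R -> R) : measurable_fun setT f -> (forall s, 0 <= f s <= g s) ->
  mu.-integrable setT (EFin \o g) ->
  mu.-integrable setT (EFin \o f) /\ \int[mu]_s f s <= \int[mu]_s g s.
Proof.
move=> mf fg ig.
have i : mu.-integrable setT (EFin \o f).
  by apply: integrable_dom ig _ => // s; have /andP[h1 h2] := fg s; rewrite ger0_norm.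
by split=> //; apply: le_Rintegral => // s _; have /andP[] := fg s.
Qed.

Lemma poly_approx_poly p : poly_approx (fun s => p.[s ^+ 2]).
Proof.
split; first exact: measurable_poly2.
move=> e e0; exists p.
have -> : approx_by (fun s => p.[s ^+ 2]) p = fun=> 0.
  by apply/funext => s; rewrite /approx_by subrr expr0n mul0r.
split; first by rewrite (_ : _ \o _ = cst 0%E) //; exact: integrable0.
by rewrite /Rintegral integral0.
Qed.

Lemma poly_approx_lin (a : R) f g : poly_approx f -> poly_approx g ->
  poly_approx (fun s => a * f s + g s).
Proof.
move=> [mf hf] [mg hg].
have m : measurable_fun setT (fun s => a * f s + g s).
  by apply: measurable_funD => //; apply: measurable_funM => //; exact: measurable_cst.
split=> // e e0; pose d := e / (2 * a ^+ 2 + 3).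
have c0 : 0 < 2 * a ^+ 2 + 3 by have := sqr_ge0 a; lra.
have d0 : 0 < d by rewrite divr_gt0.
have [p [ip hp]] := hf d d0; have [q [iq hq]] := hg d d0.
exists (a *: p + q).
have ig := integrable_lin (2 * a ^+ 2) 2 ip iq.
have [] := @Rintegral_le (approx_by (fun s => a * f s + g s) (a *: p + q)) _ (measurable_approx_by _ m) _ ig.
  move=> s; rewrite approx_by_ge0 /= /approx_by hornerD hornerZ (mulrA (2 * a ^+ 2)) (mulrA 2 (_ ^+ 2)) -mulrDl ler_wpM2r //.
  rewrite -subr_ge0.
  have -> : 2 * a ^+ 2 * (f s - p.[s ^+ 2]) ^+ 2 + 2 * (g s - q.[s ^+ 2]) ^+ 2 -
    (a * f s + g s - (a * p.[s ^+ 2] + q.[s ^+ 2])) ^+ 2 =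
    (a * (f s - p.[s ^+ 2]) - (g s - q.[s ^+ 2])) ^+ 2 by ring.
  exact: sqr_ge0.
move=> i h; split=> //; apply: le_lt_trans h _; rewrite Rintegral_lin //.
apply: (@lt_le_trans _ _ ((2 * a ^+ 2 + 3) * d)); last by rewrite /d mulrC divfK // gt_eqF.
have h1 : 2 * a ^+ 2 * \int[mu]_s approx_by f p s <= 2 * a ^+ 2 * d.
  by apply: ler_wpM2l (ltW hp); rewrite mulr_ge0 // sqr_ge0.
lra.
Qed.

Lemma poly_approx0 : poly_approx (fun=> 0).
Proof. by have := poly_approx_poly 0; under eq_fun do rewrite horner0. Qed.

Lemma poly_approxZ a f : poly_approx f -> poly_approx (fun s => a * f s).
Proof. by move=> hf; have := poly_approx_lin a hf poly_approx0; under eq_fun do rewrite addr0. Qed.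

Lemma poly_approxD f g : poly_approx f -> poly_approx g -> poly_approx (fun s => f s + g s).
Proof. by move=> hf hg; have := poly_approx_lin 1 hf hg; under eq_fun do rewrite mul1r. Qed.

Lemma poly_approx_sum n (f : nat -> R -> R) : (forall k, (k < n)%N -> poly_approx (f k)) ->
  poly_approx (fun s => \sum_(k < n) f k s).
Proof.
elim: n => [|n IH] h.
  by under eq_fun do rewrite big_ord0; exact: poly_approx0.
under eq_fun do rewrite big_ord_recr /=; apply: poly_approxD; last exact: h.
by apply: IH => k kn; apply: h; rewrite ltnS ltnW.
Qed.

(** Dominated convergence makes [f_ n] tend to [f] in the weighted norm, with majorant [4 g]; one
    term of the sequence is then approximated. *)
Lemma poly_approx_lim (f_ : nat -> R -> R) f (g : R -> R) : (forall n, poly_approx (f_ n)) ->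
  (forall s, f_ n s @[n --> \oo] --> f s) -> mu.-integrable setT (EFin \o g) ->
  (forall n s, f_ n s ^+ 2 * D s <= g s) -> poly_approx f.
Proof.
move=> hf lf ig hg.
have mf : measurable_fun setT f.
  by apply: (measurable_fun_cvg (fun n => (hf n).1)) => s _; exact: lf.
have gf s : f s ^+ 2 * D s <= g s.
  have h : f_ n s ^+ 2 * D s @[n --> \oo] --> f s ^+ 2 * D s.
    by apply: cvgM; [apply: cvgM; exact: lf | exact: cvg_cst].
  by apply: (cvgr_to_le h); exact: nearW.
split=> // e e0.
have mfn n : measurable_fun setT (fun s => (f s - f_ n s) ^+ 2 * D s).
  by apply: measurable_funM => //; apply: measurable_funX; apply: measurable_funB => //; exact: (hf n).1.
have lim0 s : (f s - f_ n s) ^+ 2 * D s @[n --> \oo] --> (0 : R).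
  have h : (f s - f_ n s) ^+ 2 * D s @[n --> \oo] --> (f s - f s) ^+ 2 * D s.
    by apply: cvgM; [apply: cvgM; apply: cvgB => //; exact: cvg_cst | exact: cvg_cst].
  by rewrite subrr expr0n mul0r in h.
have ig4 := integrable_lin 4 0 ig ig.
have bnd n s : (f s - f_ n s) ^+ 2 * D s <= 4 * g s + 0 * g s.
  rewrite mul0r addr0; have h1 := gf s; have h2 := hg n s; have h3 := D0 s.
  have h4 : (f s - f_ n s) ^+ 2 * D s <= 2 * (f s ^+ 2 * D s) + 2 * (f_ n s ^+ 2 * D s).
    rewrite -subr_ge0.
    have -> : 2 * (f s ^+ 2 * D s) + 2 * (f_ n s ^+ 2 * D s) - (f s - f_ n s) ^+ 2 * D s =
      (f s + f_ n s) ^+ 2 * D s by ring.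
    by rewrite mulr_ge0 // sqr_ge0.
  lra.
have pos n s : 0 <= (f s - f_ n s) ^+ 2 * D s by rewrite mulr_ge0 // sqr_ge0.
have bndn n s : `|(f s - f_ n s) ^+ 2 * D s| <= 4 * g s + 0 * g s by rewrite ger0_norm.
have [_ lim] := Rintegral_dct mfn lim0 ig4 bndn.
rewrite [X in _ --> X](_ : _ = 0) in lim; last by rewrite /Rintegral integral0.
have e4 : 0 < e / 4 by rewrite divr_gt0.
move/cvgrPdist_lt: lim => /(_ _ e4)[n _ /(_ n (leqnn n))] /=.
rewrite sub0r normrN => /(le_lt_trans (ler_norm _)) h1.
have [_ h] := hf n; have [p [ip hp]] := h _ e4; exists p.
have ifn : mu.-integrable setT (EFin \o (fun s => (f s - f_ n s) ^+ 2 * D s)).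
  exact: integrable_dom (mfn n) ig4 (bndn n).
have i2 := integrable_lin 2 2 ifn ip.
have [] := Rintegral_le (measurable_approx_by p mf) _ i2.
  move=> s; rewrite approx_by_ge0 /= /approx_by.
  rewrite -subr_ge0.
  have -> : 2 * ((f s - f_ n s) ^+ 2 * D s) + 2 * ((f_ n s - p.[s ^+ 2]) ^+ 2 * D s) -
     (f s - p.[s ^+ 2]) ^+ 2 * D s = (f s - f_ n s - (f_ n s - p.[s ^+ 2])) ^+ 2 * D s by ring.
  by rewrite mulr_ge0 // sqr_ge0.
move=> i hi; split=> //; apply: le_lt_trans hi _; rewrite Rintegral_lin //.
lra.
Qed.

Lemma cos_partial_bound (x : R) m : `|series (cos_coeff x) m| <= expR `|x|.
Proof.
apply: (@le_trans _ _ (series (exp_coeff `|x|) m)).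
  rewrite /series /=; apply: le_trans (ler_norm_sum _ _ _) _; apply: ler_sum => n _.
  rewrite /exp_coeff /cos_coeff /=.
  rewrite !normrM normfV !normr_nat !normrX normrN normr1 expr1n mulr1.
  by case: odd; [rewrite !mul0r divr_ge0 // exprn_ge0 | rewrite mul1r].
rewrite /expR; apply: nondecreasing_cvgn_le; last exact: is_cvg_series_exp_coeff.
by apply: nondecreasing_series => n _ _; rewrite /exp_coeff /= divr_ge0 // exprn_ge0.
Qed.

Lemma cos_partial_cvg (x : R) : series (cos_coeff x) m @[m --> \oo] --> cos x.
Proof. by rewrite unlock; exact: is_cvg_series_cos_coeff. Qed.

Lemma cos_partial_poly (c : R) m : exists q : {poly R}, forall s, series (cos_coeff (c * s)) m = q.[s ^+ 2].
Proof.
elim: m => [|m [q hq]].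
  by exists 0 => s; rewrite horner0 /series /= big_geq.
exists (q + ((~~ odd m)%:R * (-1) ^+ m./2 * c ^+ m / m`!%:R) *: 'X^(m./2)) => s.
rewrite hornerD hornerZ hornerXn -hq /series /= big_nat_recr //=; congr (_ + _).
rewrite /cos_coeff /=; case: (boolP (odd m)) => hm; first by rewrite !mul0r.
have -> : (c * s) ^+ m = c ^+ m * (s ^+ 2) ^+ m./2.
  rewrite exprMn -exprM mul2n; congr (_ * s ^+ _).
  by rewrite -[in LHS](odd_double_half m) (negbTE hm) add0n.
by rewrite -exprnP; ring.
Qed.

(* Small frequencies, so that the partial sums of the cosine series stay
   dominated after multiplication by [D]. *)
Lemma poly_approx_poly_cos (c : R) : 0 <= c <= 8^-1 -> forall n (p : {poly R}),
  poly_approx (fun s => p.[s ^+ 2] * cos (c * s) ^+ n).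
Proof.
move=> /andP[c0 c8]; elim=> [|n IH] p.
  by under eq_fun do rewrite expr0 mulr1; exact: poly_approx_poly.
have [L L0 hL] := poly_growth4 p.
have K0 : 0 <= K by have := le_trans (D0 0) (DK 0); rewrite normr0 oppr0 expR0 mulr1.
apply: (@poly_approx_lim (fun m s => series (cos_coeff (c * s)) m * (p.[s ^+ 2] * cos (c * s) ^+ n)) _
  (fun s => L ^+ 2 * K * expR (- (`|s| / 4)) + 0 * expR (- (`|s| / 4)))).
(* The partial sum is itself a polynomial in [s^2], so it joins [p] and the induction hypothesis
   applies with one cosine less; this is why the statement carries a polynomial factor. *)
- move=> m; have [q hq] := cos_partial_poly c m.
  have := IH (q * p); congr poly_approx.
  by apply/funext => s; rewrite hq hornerM mulrA.
- move=> s; have -> : p.[s ^+ 2] * cos (c * s) ^+ n.+1 = cos (c * s) * (p.[s ^+ 2] * cos (c * s) ^+ n).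
    by rewrite mulrCA -exprS.
  by apply: cvgM; [exact: cos_partial_cvg | exact: cvg_cst].
- by apply: integrable_lin; exact: integrable_exp4.
move=> m s; rewrite mul0r addr0.
have s0 := normr_ge0 s.
have h1 : series (cos_coeff (c * s)) m ^+ 2 <= expR (`|s| / 4).
  rewrite -sqr_absr; apply: (@le_trans _ _ (expR `|c * s| ^+ 2)).
    by rewrite lerXn2r ?nnegrE ?expR_ge0 // cos_partial_bound.
  rewrite -expRM_natl ler_expR normrM (ger0_norm c0); nra.
have h2 : p.[s ^+ 2] ^+ 2 <= L ^+ 2 * expR (`|s| / 2).
  rewrite -(sqr_absr p.[_]); apply: (@le_trans _ _ ((L * expR (`|s| / 4)) ^+ 2)).
    by rewrite lerXn2r ?nnegrE ?mulr_ge0 ?expR_ge0.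
  rewrite exprMn -expRM_natl; have -> : 2%:R * (`|s| / 4) = `|s| / 2 by field.
  by [].
have h3 : (cos (c * s) ^+ n) ^+ 2 <= 1.
  rewrite -exprM mulnC exprM; apply: exprn_ile1; first exact: sqr_ge0.
  have := cos2Dsin2 (c * s); have := sqr_ge0 (sin (c * s)); lra.
(* The budget of exponents: [1/4] for the squared partial sum, as [2 c <= 1/4], and [1/2] for [p^2],
   against [-1] for [D]. *)
have E : expR (`|s| / 4) * expR (`|s| / 2) * expR (- `|s|) = expR (- (`|s| / 4)).
  by rewrite -!expRD; congr expR; field.
rewrite !exprMn.
apply: (@le_trans _ _ (expR (`|s| / 4) * (L ^+ 2 * expR (`|s| / 2) * 1) * (K * expR (- `|s|)))); last first.
  rewrite -E le_eqVlt; apply/orP; left; apply/eqP; ring.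
have q1 := sqr_ge0 (series (cos_coeff (c * s)) m); have q2 := sqr_ge0 p.[s ^+ 2].
have q3 := sqr_ge0 (cos (c * s) ^+ n).
apply: ler_pM (DK s) => //; first by rewrite mulr_ge0 // mulr_ge0.
by apply: ler_pM h1 _ => //; [rewrite mulr_ge0 | apply: ler_pM h2 h3].
Qed.

Lemma poly_approx_cos (c : R) (P : {poly R}) : 0 <= c <= 8^-1 ->
  poly_approx (fun s => P.[cos (c * s)]).
Proof.
move=> hc; under eq_fun do rewrite horner_coef.
apply: (@poly_approx_sum _ (fun k s => P`_k * cos (c * s) ^+ k)) => k _.
have := poly_approx_poly_cos hc k (P`_k)%:P.
by under eq_fun do rewrite hornerC.
Qed.

(* At [x = sin (s / (t k))] this is [(1 - y)^N] with [N y = k (k x)^(2k)], which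
   tends to [0] if [|s| < t] and to infinity if [|s| >= t]; hence the limit is the
   indicator of [|s| < t] at every point, boundary included. *)
Definition ball_bump (k : nat) (x : R) : R := (1 - (x ^+ 2) ^+ k) ^+ (k ^ (2 * k).+1).

Lemma bump_itv k x : `|x| <= 1 -> 0 <= ball_bump k x <= 1.
Proof.
move=> x1; have x2 : x ^+ 2 <= 1 by rewrite -sqr_absr exprn_ile1.
have x0 := sqr_ge0 x.
have y1 : (x ^+ 2) ^+ k <= 1 by rewrite exprn_ile1.
have y0 : 0 <= (x ^+ 2) ^+ k by rewrite exprn_ge0.
by rewrite exprn_ge0 ?subr_ge0 // exprn_ile1 ?subr_ge0 // gerBl.
Qed.

Lemma bump_mul k (x : R) : (k ^ (2 * k).+1)%:R * (x ^+ 2) ^+ k = k%:R * ((k%:R * x) ^+ 2) ^+ k.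
Proof.
rewrite natrX exprS -mulrA; congr (_ * _).
by rewrite exprM -exprMn -exprMn.
Qed.

Lemma bump_ge k x : `|x| <= 1 -> 1 - k%:R * ((k%:R * x) ^+ 2) ^+ k <= ball_bump k x.
Proof.
move=> x1; have x2 : x ^+ 2 <= 1 by rewrite -sqr_absr exprn_ile1.
have x0 := sqr_ge0 x.
have y1 : (x ^+ 2) ^+ k <= 1 by rewrite exprn_ile1.
have := @bernoulli R (- (x ^+ 2) ^+ k) (k ^ (2 * k).+1).
by rewrite lerN2 mulrN bump_mul; apply.
Qed.

Lemma bump_le k x : `|x| <= 1 -> ball_bump k x * (1 + k%:R * ((k%:R * x) ^+ 2) ^+ k) <= 1.
Proof.
move=> x1; have x2 : x ^+ 2 <= 1 by rewrite -sqr_absr exprn_ile1.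
have x0 := sqr_ge0 x.
have y1 : (x ^+ 2) ^+ k <= 1 by rewrite exprn_ile1.
have y0 : 0 <= (x ^+ 2) ^+ k by rewrite exprn_ge0.
have := @bernoulli R ((x ^+ 2) ^+ k) (k ^ (2 * k).+1).
rewrite bump_mul => /(_ (le_trans (lerN10 R) y0)) h.
have /andP[b0 _] := bump_itv k x1.
apply: le_trans (ler_wpM2l b0 h) _; rewrite /ball_bump -exprMn.
set y := (x ^+ 2) ^+ k in y0 y1 *.
have -> : (1 - y) * (1 + y) = 1 - y ^+ 2 by ring.
have y2 : y ^+ 2 <= 1 by rewrite exprn_ile1.
by apply: exprn_ile1; [rewrite subr_ge0 | have := sqr_ge0 y; lra].
Qed.

Lemma abs_sin_le1 (x : R) : `|sin x| <= 1.
Proof. by rewrite ler_norml sin_geN1 sin_le1. Qed.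

Lemma bump_sin_bound (t s : R) : 0 < t -> exists C : R, forall k, (0 < k)%N ->
  `|ball_bump k (sin ((t * k%:R)^-1 * s)) - (`|s| < t)%R%:R| <= C / k%:R.
Proof.
move=> t0; pose r := `|s| / t.
have r0 : 0 <= r by rewrite divr_ge0 // ltW.
have ku k : (0 < k)%N -> k%:R * `|(t * k%:R)^-1 * s| = r.
  move=> k0; have kR : (0 : R) < k%:R by rewrite ltr0n.
  rewrite normrM normfV normrM (gtr0_norm t0) (gtr0_norm kR) /r; field.
  by rewrite !gt_eqF.
have [st|ts] := ltP `|s| t.
  have r1 : r < 1 by rewrite ltr_pdivrMr // mul1r.
  (* The floor [1/2] keeps [q] invertible at [s = 0]. Bernoulli's inequality for [q^-1 = 1 + h]
     gives [q^k <= 1 / (k h)], hence [k q^(2k) <= h^-2 / k]. *)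
  pose q := Num.max r 2^-1; have q0 : 0 < q by rewrite lt_max [X in _ || X]invr_gt0 ltr0n orbT.
  have q1 : q < 1 by rewrite gt_max r1 /=; lra.
  have rq : r <= q by rewrite le_max lexx.
  pose h := q^-1 - 1; have h0 : 0 < h by rewrite subr_gt0 invf_gt1.
  exists (h ^- 2) => k k0; have kR : (0 : R) < k%:R by rewrite ltr0n.
  set x := sin _; have x1 : `|x| <= 1 by exact: abs_sin_le1.
  have /andP[b0 b1] := bump_itv k x1; have b2 := bump_ge k x1.
  rewrite /= ler0_norm ?subr_le0 // opprB.
  apply: (@le_trans _ _ (k%:R * ((k%:R * x) ^+ 2) ^+ k)); first by lra.
  have y : (k%:R * x) ^+ 2 <= q ^+ 2.
    rewrite -sqr_absr lerXn2r ?nnegrE ?(ltW q0) // (le_trans _ rq) // -(ku k k0).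
    by rewrite normrM (gtr0_norm kR) ler_wpM2l ?(ltW kR) // sin_lex.
  have y2 : ((k%:R * x) ^+ 2) ^+ k <= (q ^+ k) ^+ 2.
    rewrite (exprAC q) lerXn2r ?nnegrE ?sqr_ge0 //.
  have hk : k%:R * h <= (q ^+ k)^-1.
    have := @bernoulli R h k; rewrite -exprVn (_ : 1 + h = q^-1); last by rewrite /h; ring.
    have h1 : -1 <= h by lra.
    by move=> /(_ h1); lra.
  have qk : 0 < q ^+ k by rewrite exprn_gt0.
  have kh : 0 < k%:R * h by rewrite mulr_gt0.
  have qh : q ^+ k <= (k%:R * h)^-1 by rewrite -[leLHS]invrK lef_pV2 ?posrE ?invr_gt0.
  have q2 : (q ^+ k) ^+ 2 <= ((k%:R * h)^-1) ^+ 2 by rewrite lerXn2r ?nnegrE ?invr_ge0 ?(ltW qk) ?(ltW kh).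
  apply: le_trans (ler_wpM2l (ltW kR) (le_trans y2 q2)) _.
  by rewrite le_eqVlt; apply/orP; left; apply/eqP; field; rewrite !gt_eqF.
have r1 : 1 <= r by rewrite ler_pdivlMr // mul1r.
exists (1 + 2 * r ^+ 2) => k k0; have kR : (0 : R) < k%:R by rewrite ltr0n.
set x := sin _; have x1 : `|x| <= 1 by exact: abs_sin_le1.
have /andP[b0 b1] := bump_itv k x1; have b2 := bump_le k x1.
rewrite subr0 ger0_norm // ler_pdivlMr //.
have r2 : 1 <= r ^+ 2 by rewrite expr_ge1.
(* For small [k] the bound exceeds 1 and is trivial. *)
have [kr|rk] := ltP k%:R (2 * r ^+ 2).
  apply: (@le_trans _ _ (1 * k%:R)); first by rewrite ler_wpM2r // ltW.
  lra.
(* From [|sin u| >= |u| - |u|^3] with [k |u| = r >= 1]. Even at [r = 1], raising to the power [2k]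
   loses only [2 r^2 / k], so the factor [k] in [bump_le] still sends the bump to [0] on the
   boundary. *)
have y : 1 - r ^+ 2 / k%:R ^+ 2 <= k%:R * `|x|.
  have S := sin_subx ((t * k%:R)^-1 * s); rewrite -/x in S.
  have := ku k k0; set u := (t * k%:R)^-1 * s in S * => E.
  have xu : `|u| - `|u| ^+ 3 <= `|x|.
    by have := ler_distD x u 0; rewrite !subr0 distrC; lra.
  have uE : `|u| = r / k%:R by rewrite -E; field; rewrite gt_eqF.
  apply: le_trans (ler_wpM2l (ltW kR) xu); rewrite uE.
  have -> : k%:R * (r / k%:R - (r / k%:R) ^+ 3) = r * (1 - r ^+ 2 / k%:R ^+ 2).
    by field; rewrite gt_eqF.
  rewrite ler_peMl // subr_ge0 ler_pdivrMr ?exprn_gt0 // mul1r lerXn2r ?nnegrE ?(ltW kR) //.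
  by apply: le_trans rk; nra.
have k2 : r ^+ 2 / k%:R ^+ 2 <= 1.
  rewrite ler_pdivrMr ?exprn_gt0 // mul1r lerXn2r ?nnegrE ?(ltW kR) //.
  by apply: le_trans rk; nra.
have y2 : 1 - 2 * r ^+ 2 / k%:R <= ((k%:R * x) ^+ 2) ^+ k.
  have := @bernoulli R (- (r ^+ 2 / k%:R ^+ 2)) (2 * k); rewrite lerN2 => /(_ k2).
  rewrite natrM mulrN => B.
  have -> : 2 * r ^+ 2 / k%:R = 2 * k%:R * (r ^+ 2 / k%:R ^+ 2) by field; rewrite gt_eqF.
  apply: le_trans B _; rewrite exprM -sqr_absr normrM (gtr0_norm kR).
  by rewrite lerXn2r ?nnegrE ?sqr_ge0 // lerXn2r ?nnegrE ?subr_ge0 // mulr_ge0 // ltW.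
have y3 : k%:R - 2 * r ^+ 2 <= k%:R * ((k%:R * x) ^+ 2) ^+ k.
  have -> : k%:R - 2 * r ^+ 2 = k%:R * (1 - 2 * r ^+ 2 / k%:R) by field; rewrite gt_eqF.
  by rewrite ler_wpM2l // ltW.
move: b2 y3; move: (k%:R * _ ^+ k) (ball_bump k x) b0 b1 => z b b0 b1 b2 y3.
nra.
Qed.

Lemma poly_approx_bdd (f_ : nat -> R -> R) f : (forall n, poly_approx (f_ n)) ->
  (forall s, f_ n s @[n --> \oo] --> f s) -> (forall n s, `|f_ n s| <= 1) -> poly_approx f.
Proof.
move=> hf lf b; apply: (poly_approx_lim hf lf (integrable_lin K 0 (@integrable_exp_norm R) (@integrable_exp_norm R))).
move=> n s; rewrite mul0r addr0; apply: le_trans (DK s).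
by rewrite ler_piMl // -sqr_absr exprn_ile1.
Qed.

Lemma poly_approx_ball (t : R) : poly_approx (fun s => (`|s| < t)%R%:R).
Proof.
have [t0|t0] := leP t 0.
  have -> : (fun s : R => (`|s| < t)%R%:R) = (fun=> 0 : R).
    by apply/funext => s; rewrite ltNge (le_trans t0).
  exact: poly_approx0.
(* From [k = N] on the frequency [1 / (t k)] is at most [1/8]. *)
pose N := (Num.truncn (8 / t)).+1; have hN : 8 / t < N%:R by exact: truncnS_gt.
apply: (@poly_approx_bdd (fun n s => ball_bump (n + N) (sin ((t * (n + N)%:R)^-1 * s)))).
- move=> n; set k := (n + N)%N.
  have kN : 8 / t <= k%:R by apply: le_trans (ltW hN) _; rewrite ler_nat leq_addl.
  have k0 : (0 : R) < k%:R by apply: lt_le_trans kN; rewrite divr_gt0.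
  have hc : 0 <= (t * k%:R)^-1 <= 8^-1.
    rewrite invr_ge0 (ltW (mulr_gt0 t0 k0)) /= lef_pV2 ?posrE ?mulr_gt0 //.
    by move: kN; rewrite ler_pdivrMr // mulrC.
  (* The bump involves only the square of the sine, [1 - 'X^2] in the cosine. *)
  have := poly_approx_cos ((1 - (1 - 'X^2) ^+ k) ^+ (k ^ (2 * k).+1)) hc.
  congr poly_approx; apply/funext => s; rewrite /ball_bump.
  rewrite horner_exp hornerD hornerN horner_exp hornerD hornerN hornerXn !hornerC.
  have := cos2Dsin2 ((t * k%:R)^-1 * s); move: (cos _) (sin _) => u v uv.
  by have -> : 1 - u ^+ 2 = v ^+ 2 by lra.
- move=> s; have [C hC] := bump_sin_bound s t0.
  apply/cvgrPdist_le => e e0.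
  have lim : `|C| * n.+1%:R^-1 @[n --> \oo] --> (0 : R).
    by rewrite -[X in _ --> X](mulr0 `|C|); apply: cvgM; [exact: cvg_cst | exact: cvg_harmonic].
  move/cvgrPdist_le: lim => /(_ _ e0); apply: filterS => n.
  rewrite sub0r normrN ger0_norm ?mulr_ge0 // => h; rewrite distrC.
  apply: le_trans (hC (n + N)%N _) _; first by rewrite addnS.
  apply: le_trans h; apply: (@le_trans _ _ (`|C| / (n + N)%:R)).
    by rewrite ler_wpM2r ?invr_ge0 ?ler_norm.
  by rewrite ler_wpM2l // lef_pV2 ?posrE ?ltr0n // ?addnS // ler_nat ltnS leq_addr.
- move=> n s; have /andP[b0 b1] := bump_itv (n + N) (abs_sin_le1 ((t * (n + N)%:R)^-1 * s)).
  by rewrite ger0_norm.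
Qed.

(** Dynkin's lemma, starting from the rays unbounded below, for which the function is the indicator
    of a ball. Evaluation at [|s|] builds in the evenness. *)
Lemma poly_approx_indic (A : set R) : measurable (A : set (measurableTypeR R)) ->
  poly_approx (fun s => \1_A `|s|).
Proof.
move=> mA.
pose P (A : set (measurableTypeR R)) := poly_approx (fun s => \1_A `|s|).
have mG : @measurable _ (measurableTypeR R) = <<s @RGenInftyO.G R >>.
  exact: RGenInftyO.measurableE.
apply: (@dynkin_induction _ (measurableTypeR R) (@RGenInftyO.G R) P mG); last by rewrite -mG.
- move=> _ _ [x ->] [y ->]; exists (Num.min x y).
  by apply/seteqP; split => z /=; rewrite !in_itv /= lt_min; [move=> [-> ->]|move=> /andP[]].
- rewrite /P; have := poly_approx_poly 1; congr poly_approx.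
  by apply/funext => s; rewrite hornerC indicE in_setT.
- move=> _ [t ->]; rewrite /P; have := poly_approx_ball t; congr poly_approx.
  by apply/funext => s; rewrite indicE mem_setE in_itv.
- move=> S mS hS; rewrite /P.
  have := poly_approx_lin (-1) hS (poly_approx_poly 1); congr poly_approx.
  by apply/funext => s; rewrite hornerC !indicE in_setC; case: (_ \in S); rewrite /=; ring.
- move=> F mF tF hF; rewrite /P.
  have E (x : R) (n : nat) : \sum_(k < n) \1_(F k) x = (\1_(\bigcup_(k < n) F k) x : R).
    elim: n => [|n IH]; first by rewrite big_ord0 indicE memNset // => -[].
    have bS : \bigcup_(k < n.+1) F k = \bigcup_(k < n) F k `|` F n.
      apply/seteqP; split => z.
        move=> [k /=]; rewrite ltnS leq_eqVlt => /orP[/eqP -> ?|kn Fk]; first by right.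
        by left; exists k.
      by move=> [[k /= kn Fk]|Fn]; [exists k => //=; exact: ltnW | exists n => /=].
    rewrite big_ord_recr /= IH bS !indicE in_setU.
    case: (boolP (x \in F n)) => hx; rewrite ?orbT ?orbF ?addr0 //=.
    rewrite memNset ?add0r // => -[k /= kn Fk].
    have := tF k n I I; move/set_mem in hx => /(_ (ex_intro _ x (conj Fk hx))) e.
    by rewrite e ltnn in kn.
  apply: (@poly_approx_bdd (fun n s => \sum_(k < n) \1_(F k) `|s|)).
  + by move=> n; apply: (@poly_approx_sum n (fun k s => \1_(F k) `|s|)) => k _; exact: hF.
  + move=> s; under eq_fun do rewrite E.
    have [[k _ Fk]|nF] := pselect ((\bigcup_k F k) `|s|).
      apply: cvg_near_cst; exists k.+1 => // n /= kn.
      by rewrite !indicE !mem_set //; exists k.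
    apply: cvg_near_cst; apply: nearW => n.
    by rewrite !indicE !memNset // => -[k /= _ Fk]; apply: nF; exists k.
  + by move=> n s; rewrite E indicE; case: (_ \in _); rewrite ?normr1 ?normr0.
Qed.

(** The increasing simple approximations of [f], evaluated at [|s|], are combinations of the
    indicators already treated, and [f^2 D] dominates their squares. *)
Lemma poly_approx_nonneg (f : R -> R) : measurable_fun setT f -> (forall s, 0 <= f s) ->
  (forall s, f (- s) = f s) -> mu.-integrable setT (EFin \o (fun s => f s ^+ 2 * D s)) ->
  poly_approx f.
Proof.
move=> mf f0 ef fi.
have mf' : measurable_fun (setT : set (measurableTypeR R)) (EFin \o f) by exact/measurable_EFinP.
pose g := nnsfun_approx measurableT mf'.
have lim x : g n x @[n --> \oo] --> f x.
  have h := @cvg_nnsfun_approx _ _ _ _ measurableT _ mf' (fun x _ => f0 x : (0 <= (EFin \o f) x)%E) x I.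
  by move/fine_cvgP: h => [].
have gle n x : g n x <= f x.
  have nd : nondecreasing_seq (fun n => g n x).
    by move=> i j ij; have /lefP := @nd_nnsfun_approx _ _ _ _ measurableT _ mf' i j ij; exact.
  rewrite -(cvg_lim (@Rhausdorff R) (lim x)); apply: nondecreasing_cvgn_le => //.
  by apply/cvg_ex; exists (f x); exact: lim.
have fe x : f `|x| = f x by case: (ger0P x) => // _; rewrite ef.
apply: (@poly_approx_lim (fun n s => g n `|s|) f (fun s => f s ^+ 2 * D s)) => //.
- move=> n; under eq_fun do rewrite fimfunEord.
  apply: (@poly_approx_sum _ (fun i s => _`_i * \1_(g n @^-1` [set _`_i]) `|s|)) => k _.
  by apply: poly_approxZ; apply: poly_approx_indic; exact: measurable_funPTI.
- by move=> s; rewrite -fe; exact: lim.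
- move=> n s; rewrite ler_wpM2r // lerXn2r ?nnegrE // -(fe s) //.
Qed.

Lemma poly_approx_even (f : R -> R) : measurable_fun setT f ->
  (forall s, f (- s) = f s) -> mu.-integrable setT (EFin \o (fun s => f s ^+ 2 * D s)) ->
  poly_approx f.
Proof.
move=> mf ef fi.
have key (h : R -> R) : measurable_fun setT h -> (forall s, h (- s) = h s) -> (forall s, 0 <= h s) ->
    (forall s, h s ^+ 2 <= f s ^+ 2) -> poly_approx h.
  move=> mh eh h0 hf; apply: poly_approx_nonneg => //.
  apply: integrable_dom fi _; first by apply: measurable_funM => //; exact: measurable_funX.
  by move=> s; rewrite ger0_norm ?mulr_ge0 ?sqr_ge0 // ler_wpM2r.
have mN : measurable_fun setT (fun s : R => `|f s|) by exact: measurableT_comp.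
have p1 : poly_approx (fun s => `|f s|).
  by apply: key => // [s|s]; rewrite ?ef // sqr_absr.
have p2 : poly_approx (fun s => `|f s| + f s).
  have p : poly_approx (fun s => 2^-1 * `|f s| + 2^-1 * f s).
    apply: key => [|s|s|s].
    - by apply: measurable_funD; apply: measurable_funM => //; exact: measurable_cst.
    - by rewrite ef.
    - by rewrite -mulrDr mulr_ge0 // -lerBlDr sub0r -normrN ler_norm.
    - have := sqr_absr (f s); have := normr_ge0 (f s); have := ler_norm (f s).
      have := ler_norm (- f s); rewrite normrN; nra.
  have := poly_approxZ 2 p; congr poly_approx.
  by apply/funext => s; field.
have := poly_approx_lin (-1) p1 p2; congr poly_approx.
by apply/funext => s; ring.
Qed.

End PolynomialDensity.

(** * Binomial identities *)

Section Binomials.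
Variable F : numClosedFieldType.

Lemma sum_ord_widen (n m : nat) (f : nat -> F) : (n <= m)%N -> (forall k, (n <= k)%N -> f k = 0) ->
  \sum_(k < m) f k = \sum_(k < n) f k.
Proof.
move=> nm f0; rewrite -(subnKC nm) big_split_ord /= [X in _ + X]big1 ?addr0 // => k _.
by rewrite f0 // leq_addr.
Qed.

(** Vandermonde's identity for ['C(i + j + 1, j + 1)]. The left side is the Gram matrix of the
    powers [x^i] for [x e^(-x) dx]; the right side is its diagonalization by the Laguerre
    polynomials of parameter 1, which makes positivity visible. *)
Lemma fact_binomial_sum n i j : (i < n)%N -> (j < n)%N ->
  (i + j).+1`!%:R = \sum_(k < n) (i.+1`!%:R * 'C(i, k)%:R) * (j.+1`!%:R * 'C(j, k)%:R) / k.+1%:R :> F.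
Proof.
move=> ni nj.
have E (k : nat) : (i.+1`!%:R * 'C(i, k)%:R) * (j.+1`!%:R * 'C(j, k)%:R) / k.+1%:R =
    (i`! * j.+1`!)%:R * ('C(i.+1, k.+1) * 'C(j, k))%:R :> F.
  have h : (i.+1 * 'C(i, k) = k.+1 * 'C(i.+1, k.+1))%N by rewrite -mul_bin_diag.
  have h' : i.+1%:R * 'C(i, k)%:R = k.+1%:R * 'C(i.+1, k.+1)%:R :> F by rewrite -!natrM h.
  have f1 : i.+1`!%:R = i`!%:R * i.+1%:R :> F by rewrite factS mulnC natrM.
  have n1 : i.+1%:R != 0 :> F by rewrite pnatr_eq0.
  have n2 : k.+1%:R != 0 :> F by rewrite pnatr_eq0.
  have h2 : 'C(i, k)%:R = k.+1%:R * 'C(i.+1, k.+1)%:R / i.+1%:R :> F by rewrite -h' mulrAC mulfV ?mul1r.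
  rewrite (natrM _ i`!) (natrM _ 'C(i.+1, k.+1)) f1 h2.
  move: (i.+1%:R) (k.+1%:R) n1 n2 => x y n1 n2.
  by field; rewrite n1 n2.
under eq_bigr do rewrite E.
rewrite (@sum_ord_widen j.+1 n (fun k => (i`! * j.+1`!)%:R * ('C(i.+1, k.+1) * 'C(j, k))%:R)) //; last first.
  by move=> k jk; rewrite (@bin_small j k) // muln0 mulr0.
rewrite -mulr_sumr -natr_sum -natrM; congr _%:R.
have := binomial.Vandermonde i.+1 j j.+1; rewrite big_ord_recl /= subn0 (@bin_small j j.+1) // muln0 add0n.
under eq_bigr => k _ do rewrite /bump /= add1n subSS bin_sub ?leq_ord //.
move=> ->.
have := @bin_fact (i.+1 + j) j.+1; rewrite addSn -addnS leq_addl => /(_ isT).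
rewrite -[RHS]/((i + j.+1)`!) addnK => <-.
by rewrite [LHS]mulnC [(j.+1`! * i`!)%N]mulnC.
Qed.

Lemma fact_gram_ge0 n (c : nat -> F) :
  0 <= \sum_(i < n) \sum_(j < n) c i * (c j)^* * (i + j).+1`!%:R.
Proof.
pose s k := \sum_(i < n) c i * (i.+1`!%:R * 'C(i, k)%:R).
have -> : \sum_(i < n) \sum_(j < n) c i * (c j)^* * (i + j).+1`!%:R =
   \sum_(k < n) s k * (s k)^* / k.+1%:R.
  transitivity (\sum_(i < n) \sum_(j < n) \sum_(k < n) (c i * (i.+1`!%:R * 'C(i, k)%:R)) *
     (c j * (j.+1`!%:R * 'C(j, k)%:R))^* / k.+1%:R).
    apply: eq_bigr => i _; apply: eq_bigr => j _.
    rewrite (@fact_binomial_sum n) // mulr_sumr; apply: eq_bigr => k _.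
    by rewrite !rmorphM /= !rmorph_nat; ring.
  under eq_bigr do rewrite exchange_big /=.
  rewrite exchange_big /=; apply: eq_bigr => k _.
  rewrite /s rmorph_sum /= mulr_suml mulr_suml; apply: eq_bigr => i _.
  by rewrite mulr_sumr mulr_suml; apply: eq_bigr => j _.
apply: sumr_ge0 => k _; rewrite mulr_ge0 ?invr_ge0 //.
exact: mul_conjC_ge0.
Qed.

(** A [K]-th finite difference of the polynomial ['C(x, l)] at [m]: by Pascal's rule each difference
    lowers [l] by one. *)
Lemma binomial_difference K m l :
  \sum_(i < K.+1) (-1) ^+ i * 'C(K, i)%:R * 'C(i + m, l)%:R =
  (if (K <= l)%N then (-1) ^+ K * 'C(m, l - K)%:R else 0) :> F.
Proof.
elim: K m l => [|K IH] m l.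
  by rewrite big_ord_recl big_ord0 addr0 add0n bin0 !mul1r subn0.
have split : \sum_(i < K.+2) (-1) ^+ i * 'C(K.+1, i)%:R * 'C(i + m, l)%:R =
   \sum_(i < K.+1) (-1) ^+ i * 'C(K, i)%:R * 'C(i + m, l)%:R -
   \sum_(i < K.+1) (-1) ^+ i * 'C(K, i)%:R * 'C(i + m.+1, l)%:R :> F.
  rewrite big_ord_recl /= bin0.
  under eq_bigr => i _ do rewrite /bump /= add1n binS natrD mulrDr mulrDl addSnnS.
  rewrite big_split /= addrA; congr (_ + _).
    rewrite [in LHS]big_ord_recr /= (@bin_small K K.+1) // mulr0 mul0r addr0.
    by rewrite [RHS]big_ord_recl /= bin0; congr (_ + _); apply: eq_bigr => i _; rewrite /bump /= add1n addSnnS.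
  by rewrite -sumrN; apply: eq_bigr => i _; rewrite exprS mulN1r !mulNr.
rewrite split {split}; case: l => [|l].
  rewrite !IH leqn0 ltn0; case: K {IH} => [|K] //=; last by rewrite subrr.
  by rewrite !bin0 subrr.
have -> : \sum_(i < K.+1) (-1) ^+ i * 'C(K, i)%:R * 'C(i + m.+1, l.+1)%:R =
   \sum_(i < K.+1) (-1) ^+ i * 'C(K, i)%:R * 'C(i + m, l.+1)%:R +
   \sum_(i < K.+1) (-1) ^+ i * 'C(K, i)%:R * 'C(i + m, l)%:R :> F.
  by rewrite -big_split /=; apply: eq_bigr => i _; rewrite addnS binS natrD mulrDr.
rewrite opprD addrA subrr add0r IH ltnS subSS.
by case: ifP => _; rewrite ?oppr0 // exprS mulN1r mulNr.
Qed.

(** Vandermonde's identity turns the double sum into a sum over [l] of squared [K]-th differences of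
    ['C(x, l)] at [1]. Only [l = K] and [l = K + 1] survive, each contributing 1. *)
Lemma binomial_gram K :
  \sum_(i < K.+1) \sum_(j < K.+1) ((-1) ^+ i * 'C(K, i)%:R / i.+1`!%:R) *
     ((-1) ^+ j * 'C(K, j)%:R / j.+1`!%:R) * (i.+1 + j.+1)`!%:R = 2 :> F.
Proof.
have E (i j : nat) : (i <= K)%N -> (j <= K)%N -> (i.+1 + j.+1)`!%:R =
   (i.+1`! * j.+1`!)%:R * \sum_(l < K.+2) 'C(i + 1, l)%:R * 'C(j + 1, l)%:R :> F.
  move=> iK jK.
  rewrite (@sum_ord_widen j.+2 K.+2 (fun l => 'C(i + 1, l)%:R * 'C(j + 1, l)%:R)) //; last first.
    by move=> l jl; rewrite (@bin_small (j + 1)) ?addn1 // mulr0.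
  under eq_bigr do rewrite -natrM.
  rewrite -natr_sum -natrM; congr _%:R.
  have := binomial.Vandermonde i.+1 j.+1 j.+1.
  have -> : (\sum_(k < j.+2) 'C(i.+1, k) * 'C(j.+1, j.+1 - k) = \sum_(k < j.+2) 'C(i + 1, k) * 'C(j + 1, k))%N.
    by apply: eq_bigr => k _; rewrite !addn1 bin_sub // -ltnS.
  move=> ->.
  have := @bin_fact (i.+1 + j.+1) j.+1 (leq_addl _ _); rewrite addnK => <-.
  by rewrite mulnC [(i.+1`! * _)%N]mulnC.
have fn (i : nat) : (i`!%:R : F) != 0 by rewrite pnatr_eq0 -lt0n fact_gt0.
transitivity (\sum_(l < K.+2) (\sum_(i < K.+1) (-1) ^+ i * 'C(K, i)%:R * 'C(i + 1, l)%:R) ^+ 2 : F).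
  transitivity (\sum_(i < K.+1) \sum_(j < K.+1) \sum_(l < K.+2)
     ((-1) ^+ i * 'C(K, i)%:R * 'C(i + 1, l)%:R) * ((-1) ^+ j * 'C(K, j)%:R * 'C(j + 1, l)%:R) : F).
    apply: eq_bigr => i _; apply: eq_bigr => j _.
    rewrite (E i j (leq_ord i) (leq_ord j)) !mulr_sumr; apply: eq_bigr => l _.
    rewrite natrM; have := fn i.+1; have := fn j.+1.
    move: (i.+1`!%:R) (j.+1`!%:R) => x y y0 x0; field.
    by rewrite x0 y0.
  under eq_bigr do rewrite exchange_big /=.
  rewrite exchange_big /=; apply: eq_bigr => l _.
  rewrite expr2 mulr_suml; apply: eq_bigr => i _.
  by rewrite mulr_sumr.
under eq_bigr do rewrite binomial_difference.
rewrite !big_ord_recr /= big1 ?add0r; last first.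
  by move=> l _; rewrite leqNgt ltn_ord expr0n.
rewrite leqnn leqnSn subnn subSnn bin0 bin1 !mulr1.
by rewrite -exprM mulnC exprM sqrrN expr1n expr1n.
Qed.

End Binomials.

(** * Combinations of test functions *)

Section Domain.
Variables (R : realType) (rho : R).
Local Notation C := R[i].

Lemma domainH_lin (a : C) f g : domainH rho f -> domainH rho g ->
  domainH rho (fun z => a * f z + g z).
Proof.
move=> [d1 d10 [f1 f2 [e1 e10 [A1 [B1 f3]]]]] [d2 d20 [g1 g2 [e2 e20 [A2 [B2 g3]]]]].
pose d := Num.min d1 d2; have d0 : 0 < d by rewrite lt_min d10.
have sub1 z : strip (1 + d) z -> strip (1 + d1) z.
  by rewrite /strip /= => h; apply: lt_le_trans h _; rewrite lerD2l ge_min lexx.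
have sub2 z : strip (1 + d) z -> strip (1 + d2) z.
  by rewrite /strip /= => h; apply: lt_le_trans h _; rewrite lerD2l ge_min lexx orbT.
exists d => //; split.
- by move=> z hz; rewrite f1 ?g1 //; [exact: sub2 | exact: sub1].
- move=> z hz; have [Df hDf] := derivable_cderiv (f2 z (sub1 z hz)).
  have [Dg hDg] := derivable_cderiv (g2 z (sub2 z hz)).
  exact: cderiv_derivable (cderivD (cderivM (@cderiv_cst _ a z) hDf) hDg).
pose e := Num.min e1 e2; exists e; first by rewrite lt_min e10.
(* Beyond [1] the powers of [normc z] are monotone in the exponent, so both decay rates reduce to
   the smaller one. *)
exists (Num.max 1 (Num.max A1 A2)), (normc a * `|B1| + `|B2|) => z hy; rewrite !ge_max => /and3P[h1 h2 h3].
have F := f3 z hy h2; have G := g3 z hy h3.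
have nz : 1 <= normc z by apply: le_trans h1 _; exact: normc_lerRe.
set E := expR _ in F G *; have E0 : 0 <= E by exact: expR_ge0.
have P (b e' : R) : e <= e' -> b * normc z `^ (rho - 2 - e') * E <= `|b| * normc z `^ (rho - 2 - e) * E.
  move=> ee; apply: ler_wpM2r => //; apply: (@le_trans _ _ (`|b| * normc z `^ (rho - 2 - e'))).
    by rewrite ler_wpM2r ?powR_ge0 // ler_norm.
  by rewrite ler_wpM2l // ler_powR // lerD2l lerN2.
have F' := le_trans F (P B1 e1 _); have G' := le_trans G (P B2 e2 _).
apply: le_trans (le_normcD _ _) _; rewrite normcM !mulrDl; apply: lerD.
  by rewrite -!mulrA ler_wpM2l ?normc_ge0 // mulrA F' // ge_min lexx.
by rewrite G' // ge_min lexx orbT.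
Qed.

Lemma domainH_0 : domainH rho (fun=> 0).
Proof.
exists 1 => //; split=> [//|z _|].
  exact: cderiv_derivable (@cderiv_cst _ 0 z).
exists 1 => //; exists 0, 0 => z _ _.
by rewrite normc0 !mul0r.
Qed.

Lemma diff_op_lin (a : C) f g s :
  diff_op rho (fun z => a * f z + g z) s = a * diff_op rho f s + diff_op rho g s.
Proof. rewrite /diff_op; move: (_ / _) (_ / _) => x y; ring. Qed.

Lemma diff_op_cst0 s : diff_op rho (fun=> 0) s = 0.
Proof. by rewrite /diff_op subrr !mulr0 addr0. Qed.

End Domain.

Section Norm.
Variables (R : realType) (rho : R).
Hypothesis hrho : rho < 2^-1.
Local Notation C := R[i].
Local Notation mu := (@lebesgue_measure R).
Local Notation W := (weight rho).
Let mW := measurable_weight hrho.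

Lemma nrm2_eq (u v : R -> C^o) : (forall s, s != 0 -> u s = v s) -> nrm2 rho u = nrm2 rho v.
Proof.
move=> h; rewrite /nrm2; apply: eq_Rintegral => s _.
by have [->|s0] := eqVneq s 0; [rewrite weight0 !mulr0 | rewrite h].
Qed.

Lemma nrm2D (u v : R -> C^o) : L2even rho u -> L2even rho v ->
  nrm2 rho (u + v) <= 2 * nrm2 rho u + 2 * nrm2 rho v.
Proof.
move=> hu hv; have iu := L2_integrable mW hu; have iv := L2_integrable mW hv.
have iuv : L2even rho (u + v).
  by have := L2_lin mW 1 hu hv; rewrite scale1r.
rewrite /nrm2 -(Rintegral_lin 2 2 iu iv).
have m : measurable_fun setT (fun s => normc ((u + v) s) ^+ 2 * W s).
  by have /integrableP[/measurable_EFinP] := L2_integrable mW iuv.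
apply: (proj2 (Rintegral_le m _ (integrable_lin 2 2 iu iv))) => s.
have w0 := weight_ge0 rho s.
rewrite (mulr_ge0 (sqr_ge0 _) w0) /= (mulrA 2 (_ ^+ 2)) (mulrA 2 (normc (v s) ^+ 2)) -mulrDl ler_wpM2r //.
exact: sqr_normcD.
Qed.

Lemma nrm2Z (a : C) (u : R -> C^o) : L2even rho u -> nrm2 rho (a *: u) = normc a ^+ 2 * nrm2 rho u.
Proof.
move=> hu; have iu := L2_integrable mW hu.
rewrite /nrm2 -RintegralZl //; apply: eq_Rintegral => s _.
have -> : normc ((a *: u) s) = normc a * normc (u s) by exact: normcM.
by rewrite exprMn -mulrA.
Qed.

Lemma inner0l w : L2even rho w -> inner rho (0 : R -> C^o) w = 0.
Proof.
move=> hw; have := inner_lin mW 1 (L2_0 mW) (L2_0 mW) hw.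
by rewrite scale1r addr0 mul1r => /eqP; rewrite -subr_eq0 opprD addNKr oppr_eq0 => /eqP.
Qed.

Lemma L2_sum n (c : nat -> C) (v : nat -> R -> C^o) : (forall k, L2even rho (v k)) ->
  L2even rho (\sum_(k < n) c k *: v k).
Proof.
move=> hv; elim: n => [|n IH]; first by rewrite big_ord0; exact: L2_0.
by rewrite big_ord_recr /= addrC; exact: L2_lin.
Qed.

Lemma inner_sum n m (c d : nat -> C) (v w : nat -> R -> C^o) : (forall k, L2even rho (v k)) ->
  (forall k, L2even rho (w k)) ->
  inner rho (\sum_(i < n) c i *: v i) (\sum_(j < m) d j *: w j) =
  \sum_(i < n) \sum_(j < m) c i * (d j)^*%R * inner rho (v i) (w j).
Proof.
move=> hv hw; have hs k (e : nat -> C) : L2even rho (\sum_(i < k) e i *: w i) by exact: (@L2_sum k e w hw).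
have sl k (e : nat -> C) x (y : nat -> R -> C^o) : L2even rho x -> (forall k, L2even rho (y k)) ->
    inner rho (\sum_(i < k) e i *: y i) x = \sum_(i < k) e i * inner rho (y i) x.
  move=> hx hy; have hys l : L2even rho (\sum_(i < l) e i *: y i) by exact: (@L2_sum l e y hy).
  elim: k => [|k IH]; first by rewrite !big_ord0 inner0l.
  rewrite [RHS]big_ord_recr /= -IH [RHS]addrC -inner_lin //.
  have E : \sum_(i < k.+1) e i *: y i = e k *: y k + \sum_(i < k) e i *: y i.
    by rewrite big_ord_recr; exact: addrC.
  by rewrite E.
rewrite sl //; apply: eq_bigr => i _.
rewrite (inner_conj mW (hs _ _) (hv i)) sl // rmorph_sum mulr_sumr; apply: eq_bigr => j _.
by rewrite rmorphM /= -(inner_conj mW (hw j) (hv i)) mulrA.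
Qed.

End Norm.

(** * Polynomials as combinations of the [h_n], and density of these combinations *)

Section Combinations.
Variables (R : realType) (rho : R).
Hypothesis hrho : rho < 2^-1.
Local Notation C := R[i].
Local Notation mu := (@lebesgue_measure R).
Local Notation W := (weight rho).
Local Notation a := (2^-1 - rho).
Let mW := measurable_weight hrho.
Let a0 : 0 < a. Proof. by rewrite subr_gt0. Qed.

(* Equal to [htest n] except at [0], where [diff_op] has a junk value; this way
   [tvec n] is exactly a second component of [diff_op_graph]. *)
Definition tvec (n : nat) : R -> C^o := fun s => diff_op rho (htest_ext rho n) s%:C.

Lemma tvecE n s : s != 0 -> tvec n s = (htest rho n s)%:C.
Proof. exact: diff_op_htest. Qed.

Lemma L2_tvec n : L2even rho (tvec n).
Proof. exact: (diff_op_L2 hrho (htest_ext_domainH hrho n)). Qed.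

(** A polynomial serves as a coefficient sequence, ['X^k] standing for [h_k]. As the operator lowers
    the index, multiplication by ['X] acts as its inverse: [fcomb p] agrees with [comb ('X * p)] off
    [0] and is sent to [comb p]. The range of [1 + L] then comes from the multiples of ['X + 1], and
    reduction modulo it is evaluation at [-1]. *)
Definition comb (p : {poly C}) : R -> C^o := \sum_(k < size p) p`_k *: tvec k.

Lemma comb_wide (p : {poly C}) N : (size p <= N)%N -> comb p = \sum_(k < N) p`_k *: tvec k.
Proof.
move=> pN; rewrite /comb -(subnKC pN) big_split_ord /= [X in _ + X]big1 ?addr0 // => k _.
by rewrite nth_default ?scale0r // leq_addr.
Qed.

Lemma comb_lin (c : C) p q : comb (c *: p + q) = c *: comb p + comb q.
Proof.
pose N := maxn (size (c *: p + q)) (maxn (size p) (size q)).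
have h1 : (size (c *: p + q)%R <= N)%N by rewrite leq_maxl.
have h2 : (size p <= N)%N by rewrite leq_max leq_maxl orbT.
have h3 : (size q <= N)%N by rewrite leq_max leq_maxr orbT.
rewrite (comb_wide h1) (comb_wide h2) (comb_wide h3) scaler_sumr -big_split /=.
by apply: eq_bigr => k _; rewrite coefD coefZ scalerDl scalerA.
Qed.

Lemma comb_D p q : comb (p + q) = comb p + comb q.
Proof. by have := comb_lin 1 p q; rewrite !scale1r. Qed.

Lemma comb_0 : comb 0 = 0.
Proof. by rewrite /comb size_poly0 big_ord0. Qed.

Lemma comb_Z c p : comb (c *: p) = c *: comb p.
Proof. by have := comb_lin c p 0; rewrite comb_0 !addr0. Qed.

Lemma comb_B p q : comb (p - q) = comb p - comb q.
Proof. by rewrite -scaleN1r addrC comb_lin scaleN1r addrC. Qed.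

Lemma comb_Xn k : comb 'X^k = tvec k.
Proof.
rewrite /comb size_polyXn big_ord_recr /= coefXn eqxx scale1r big1 ?add0r // => i _.
by rewrite coefXn ltn_eqF ?scale0r.
Qed.

Lemma L2_comb p : L2even rho (comb p).
Proof. exact: (@L2_sum _ _ hrho (size p) (fun k => p`_k) tvec L2_tvec). Qed.

Lemma comb_MX_wide (p : {poly C}) N : (size p <= N)%N ->
  comb ('X * p) = \sum_(k < N) p`_k *: tvec k.+1.
Proof.
move=> pN; have h : (size ('X * p)%R <= N.+1)%N.
  by apply: leq_trans (size_polyMleq _ _) _; rewrite size_polyX.
rewrite (comb_wide h) big_ord_recl /= coefXM eqxx scale0r add0r.
by apply: eq_bigr => k _; rewrite /bump /= add1n coefXM.
Qed.

Lemma comb_MX p : comb ('X * p) = \sum_(k < size p) p`_k *: tvec k.+1.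
Proof. exact: comb_MX_wide. Qed.

Definition fcomb (p : {poly C}) (z : C) : C := \sum_(k < size p) p`_k * htest_ext rho k z.

Lemma fcomb_domainH p : domainH rho (fcomb p).
Proof.
rewrite /fcomb; elim: (size p) => [|n IH].
  by under eq_fun do rewrite big_ord0; exact: domainH_0.
under eq_fun do rewrite big_ord_recr /= addrC.
by apply: domainH_lin => //; exact: htest_ext_domainH.
Qed.

Lemma diff_op_fcomb p : (fun s : R => diff_op rho (fcomb p) s%:C) = comb p.
Proof.
apply/funext => s; rewrite /comb fct_sumE /fcomb; elim: (size p) => [|n IH].
  by rewrite big_ord0; under [X in diff_op _ X _]eq_fun do rewrite big_ord0; exact: diff_op_cst0.
under [X in diff_op _ X _]eq_fun do rewrite big_ord_recr /= addrC.
by rewrite diff_op_lin IH big_ord_recr /= addrC.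
Qed.

Lemma fcomb_comb p s : s != 0 -> fcomb p s%:C = comb ('X * p) s.
Proof.
move=> s0; rewrite comb_MX fct_sumE /fcomb; apply: eq_bigr => k _.
by rewrite htest_ext_real // -(tvecE k.+1 s0).
Qed.

(** The quotient of consecutive [h_n] read as multiplication by [s^2]. It serves twice: the span of
    the [h_n] with [n > 0] contains every even polynomial times [h_1], and, as this multiplication
    is symmetric, it yields the recursion for the Gram matrix. *)
Lemma htest_mul_sqr n s : s ^+ 2 * htest rho n s =
  (a + n%:R + 2^-1) * htest rho n.+1 s - (n%:R + 2^-1) ^+ 2 * htest rho n s.
Proof.
rewrite htest_recr //; have n0 : (0 : R) <= n%:R by [].
have d0 : 0 < a + n%:R + 2^-1 by have := a0; lra.
by move: (a + _ + _) d0 => d d0; field; rewrite gt_eqF.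
Qed.

Lemma comb_mul_sqr (q : {poly C}) : exists q' : {poly C}, forall s, s != 0 ->
  (s ^+ 2)%:C * comb ('X * q) s = comb ('X * q') s.
Proof.
rewrite comb_MX; elim: (size q) => [|n [q' hq']].
  by exists 0 => s _; rewrite big_ord0 [X in comb X]mulr0 comb_0 [LHS]mulr0.
exists (q' + q`_n *: ((a + n.+1%:R + 2^-1)%:C *: 'X^(n.+1) - ((n.+1%:R + 2^-1) ^+ 2)%:C *: 'X^n)).
move=> s s0; rewrite big_ord_recr /=.
rewrite -[(\sum_(_ < _) _ + _) s]/(_ s + _ s) mulrDr hq' // mulrDr comb_D; congr (_ + _).
rewrite -scalerAr mulrBr -!scalerAr -!exprS comb_Z comb_B !comb_Z !comb_Xn.
rewrite [LHS]mulrCA; congr (_ * _).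
rewrite -[RHS]/(_ * tvec n.+2 s - _ * tvec n.+1 s) !tvecE //.
by rewrite -!(rmorphM (real_complex R)) -(rmorphB (real_complex R)) htest_mul_sqr.
Qed.

Lemma poly_htest_comb (p : {poly R}) : exists q : {poly C}, forall s, s != 0 ->
  (p.[s ^+ 2] * htest rho 1 s)%:C = comb ('X * q) s.
Proof.
elim/poly_ind: p => [|p c [q hq]].
  by exists 0 => s _; rewrite horner0 mul0r mulr0 comb_0.
have [q' hq'] := comb_mul_sqr q; exists (c%:C *: 1 + q') => s s0.
have -> : 'X * (c%:C *: 1 + q') = c%:C *: 'X^1 + 'X * q' by rewrite mulrDr -scalerAr mulr1 expr1.
rewrite hornerMXaddC mulrDl (rmorphD (real_complex R)) comb_lin comb_Xn.
rewrite -[RHS]/(_ * tvec 1 s + comb _ s) -hq' // -hq // tvecE // addrC (rmorphM (real_complex R)); congr (_ + _).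
by rewrite -[RHS](rmorphM (real_complex R)); congr (_%:C); ring.
Qed.

Lemma htest1_gt0 s : 0 < htest rho 1 s.
Proof.
rewrite /htest divr_gt0 ?rcosh_gt0 // divr_gt0 ?cnorm_gt0 //.
by rewrite /qpolyr big_ord_recl big_ord0 mulr1 add0r ltr_wpDr ?sqr_ge0 // exprn_gt0.
Qed.

Lemma measurable_htest1 : measurable_fun setT (htest rho 1).
Proof.
have := L2_cmeasurable (domainH_L2 hrho (htest_ext_domainH hrho 0)) => -[m _].
by move: m; under eq_fun do rewrite htest_ext_real.
Qed.

(** Up to powers, [h_1^2] decays like [expR (- 2 pi |s|)] and the weight grows like [expR (pi |s|)].
    The exponent [6 + 2 M] collects [4] from [h_1^2] and [2 + 2 M] from the weight bound. *)
Lemma htest1_decay : exists K : R, forall s, htest rho 1 s ^+ 2 * W s <= K * expR (- `|s|).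
Proof.
have [M [N [Kw [MK Kw0 hKw]]]] := weight_bound hrho.
have hW := weight_le hrho hKw.
have [L L0 hL] := @pow_le_exp R (6 + 2 * M).
have c0 := cnorm_gt0 hrho 1; set c := cnorm rho 1 in c0.
exists (4 / c ^+ 2 * Kw * L) => s.
have x0 := normr_ge0 s; have xL := hL _ x0.
have h1 : htest rho 1 s <= 2 / c * (1 + `|s|) ^+ 2 / expR (pi * `|s|).
  have ch : expR (pi * `|s|) / 2 <= rcosh (pi * s).
    have -> : rcosh (pi * s) = rcosh (pi * `|s|).
      by case: (ger0P s) => // _; rewrite mulrN rcoshN.
    by rewrite /rcosh ler_wpM2r // lerDl expR_ge0.
  rewrite /htest -/c ler_pdivrMr ?rcosh_gt0 //.
  have E := expR_gt0 (pi * `|s|).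
  have nn : 0 <= 2 / c * (1 + `|s|) ^+ 2 / expR (pi * `|s|).
    by rewrite divr_ge0 ?(ltW E) // mulr_ge0 ?exprn_ge0 ?addr_ge0 // divr_ge0 // ltW.
  apply: le_trans (ler_wpM2l nn ch).
  have -> : 2 / c * (1 + `|s|) ^+ 2 / expR (pi * `|s|) * (expR (pi * `|s|) / 2) = (1 + `|s|) ^+ 2 / c.
    by field; rewrite !gt_eqF.
  rewrite ler_wpM2r ?invr_ge0 ?(ltW c0) // /qpolyr big_ord_recl big_ord0 mulr1 add0r -(sqr_absr s).
  nra.
have h2 : htest rho 1 s ^+ 2 <= (2 / c * (1 + `|s|) ^+ 2 / expR (pi * `|s|)) ^+ 2.
  by rewrite lerXn2r ?nnegrE ?(ltW (htest1_gt0 s)) // (le_trans (ltW (htest1_gt0 s))).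
apply: le_trans (ler_pM (sqr_ge0 _) (weight_ge0 _ _) h2 (hW s)) _.
have p2 := @pi_ge2 R.
have E := expR_gt0 (pi * `|s|).
have eM : expR ((2 * M)%:R * lnp s) = (1 + `|s|) ^+ (2 * M) by exact: expR_lnpX.
rewrite eM.
have s2 : s ^+ 2 <= (1 + `|s|) ^+ 2.
  by rewrite -(sqr_absr s) lerXn2r ?nnegrE ?addr_ge0 // lerDr.
apply: (@le_trans _ _ (4 / c ^+ 2 * Kw * ((1 + `|s|) ^+ (6 + 2 * M) * expR (- (pi * `|s|))))).
  rewrite exprD expRN.
  have -> : (2 / c * (1 + `|s|) ^+ 2 / expR (pi * `|s|)) ^+ 2 * (Kw * s ^+ 2 * (1 + `|s|) ^+ (2 * M) * expR (pi * `|s|)) =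
    4 / c ^+ 2 * Kw * ((1 + `|s|) ^+ 4 * s ^+ 2 * (1 + `|s|) ^+ (2 * M) / expR (pi * `|s|)).
    by field; rewrite !gt_eqF.
  rewrite ler_wpM2l ?mulr_ge0 ?invr_ge0 ?exprn_ge0 ?(ltW c0) //.
  rewrite ler_wpM2r ?invr_ge0 ?(ltW E) // ler_wpM2r ?exprn_ge0 ?addr_ge0 //.
  by rewrite (exprD _ 4 2) ler_wpM2l ?exprn_ge0 ?addr_ge0.
rewrite -(mulrA _ L) ler_wpM2l ?mulr_ge0 ?invr_ge0 ?exprn_ge0 ?(ltW c0) //.
apply: (@le_trans _ _ (L * expR `|s| * expR (- (pi * `|s|)))).
  by rewrite ler_wpM2r ?expR_ge0.
by rewrite -mulrA ler_wpM2l // -expRD ler_expR; nra.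
Qed.

(** Since [|u - p h_1|^2 W = |u / h_1 - p|^2 h_1^2 W], the task is to approximate [u / h_1] by even
    polynomials for the density [h_1^2 W]. Real and imaginary parts are treated separately, as the
    approximants are real. *)
Lemma comb_dense (u : R -> C^o) (e : R) : L2even rho u -> 0 < e ->
  exists p : {poly C}, nrm2 rho (u - comb ('X * p)) < e.
Proof.
move=> hu e0; have [K hK] := htest1_decay.
pose D s := htest rho 1 s ^+ 2 * W s.
have mh := measurable_htest1.
have mD : measurable_fun setT D by apply: measurable_funM => //; exact: measurable_funX.
have D0 s : 0 <= D s := mulr_ge0 (sqr_ge0 _) (weight_ge0 rho s).
have h0 s := htest1_gt0 s.
have mV : measurable_fun setT (fun s => (htest rho 1 s)^-1).
  by apply: measurable_funV_ge0 => // s; exact: ltW.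
have [m1 m2] := L2_cmeasurable hu; have eu : forall s, u (- s) = u s by case: hu.
have iu := L2_integrable mW hu.
have app (r : C -> R) : measurable_fun setT (fun s => r (u s)) -> (forall z, r z ^+ 2 <= normc z ^+ 2) ->
    poly_approx D (fun s => r (u s) / htest rho 1 s).
  move=> mr hr; apply: (@poly_approx_even _ _ K) => //.
  - exact: measurable_funM.
  - by move=> s; rewrite eu htestN.
  - apply: (integrable_dom _ iu).
      by apply: measurable_funM => //; apply: measurable_funX; exact: measurable_funM.
    move=> s; rewrite (ger0_norm (mulr_ge0 (sqr_ge0 _) (D0 s))).
    have -> : (r (u s) / htest rho 1 s) ^+ 2 * D s = r (u s) ^+ 2 * W s.
      by rewrite /D; field; rewrite gt_eqF.
    by rewrite ler_wpM2r ?weight_ge0.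
have nR (z : C) : complex.Re z ^+ 2 <= normc z ^+ 2 by rewrite sqr_normc_ReIm lerDl sqr_ge0.
have nI (z : C) : complex.Im z ^+ 2 <= normc z ^+ 2 by rewrite sqr_normc_ReIm lerDr sqr_ge0.
have [_ A1] := app (@complex.Re R) m1 nR; have [_ A2] := app (@complex.Im R) m2 nI.
have e2 : 0 < e / 2 by rewrite divr_gt0.
have [p1 [i1 l1]] := A1 _ e2; have [p2 [i2 l2]] := A2 _ e2.
have [q1 hq1] := poly_htest_comb p1; have [q2 hq2] := poly_htest_comb p2.
exists ('i%C *: q2 + q1).
have -> : nrm2 rho (u - comb ('X * ('i%C *: q2 + q1))) =
   \int[mu]_s (1 * approx_by D (fun s => complex.Re (u s) / htest rho 1 s) p1 s +
     1 * approx_by D (fun s => complex.Im (u s) / htest rho 1 s) p2 s).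
  apply: eq_Rintegral => s _.
  have [->|s0] := eqVneq s 0; first by rewrite /approx_by /D weight0 !mulr0 addr0.
  have -> : 'X * ('i%C *: q2 + q1) = 'i%C *: ('X * q2) + 'X * q1 by rewrite mulrDr -scalerAr.
  rewrite comb_lin.
  rewrite -[(u - _) s]/(u s - ('i%C * comb ('X * q2) s + comb ('X * q1) s)) -hq1 // -hq2 //.
  rewrite sqr_normc_ReIm /approx_by /D.
  case: (u s) => x y /=.
  have hs := h0 s; move: (htest rho 1 s) hs => h hs.
  by field; rewrite gt_eqF.
rewrite Rintegral_lin //; lra.
Qed.

End Combinations.

(** * The Gram matrix and the range *)

Section Gram.
Variables (R : realType) (rho : R).
Hypothesis hrho : rho < 2^-1.
Local Notation C := R[i].
Local Notation a := (2^-1 - rho).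
Let mW := measurable_weight hrho.
Let a0 : 0 < a. Proof. by rewrite subr_gt0. Qed.

Lemma conj_real_comb (c d : R) (x y : C) :
  (c%:C * x^*%R - d%:C * y^*%R)^*%R = c%:C * x - d%:C * y.
Proof.
case: x y => x1 x2 [y1 y2]; apply/eqP; rewrite eq_complex /=.
by apply/andP; split; apply/eqP; ring.
Qed.

Definition gram (m n : nat) : C := inner rho (tvec rho m) (tvec rho n).

Lemma tvec_graph n : diff_op_graph rho ((fun s : R => htest_ext rho n s%:C), tvec rho n).
Proof. by exists (htest_ext rho n) => //; exact: htest_ext_domainH. Qed.

Lemma htest_ext_tvec n s : s != 0 -> htest_ext rho n s%:C = tvec rho n.+1 s.
Proof. by move=> s0; rewrite htest_ext_real // tvecE. Qed.

Lemma gram_shift m n : gram m n.+1 = gram m.+1 n.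
Proof.
have := diff_op_symmetric hrho (tvec_graph m) (tvec_graph n).
have -> : inner rho (tvec rho m) (fun s : R => htest_ext rho n s%:C) = gram m n.+1.
  by apply: inner_eq => // s s0; exact: htest_ext_tvec.
have -> // : inner rho (fun s : R => htest_ext rho m s%:C) (tvec rho n) = gram m.+1 n.
by apply: inner_eq => // s s0; exact: htest_ext_tvec.
Qed.

(** Multiplication by the real function [s^2] may be moved from one argument of the inner product to
    the other; both sides are expanded by [htest_mul_sqr]. *)
Lemma gram_recr m n :
  (a + m%:R + 2^-1)%:C * gram m.+1 n - ((m%:R + 2^-1) ^+ 2)%:C * gram m n =
  (a + n%:R + 2^-1)%:C * gram m n.+1 - ((n%:R + 2^-1) ^+ 2)%:C * gram m n.
Proof.
have lin (c d : R) u v w : L2even rho u -> L2even rho v -> L2even rho w ->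
    inner rho (c%:C *: u + ((- d)%:C *: v + 0) : R -> C^o) w = c%:C * inner rho u w - d%:C * inner rho v w.
  move=> hu hv hw; have hv' := L2_lin mW (- d)%:C hv (L2_0 mW).
  by rewrite inner_lin // inner_lin ?inner0l ?addr0 //; [rewrite (rmorphN (real_complex R)) mulNr | exact: L2_0].
have hL := L2_tvec hrho.
pose U (k : nat) : R -> C^o := (a + k%:R + 2^-1)%:C *: tvec rho k.+1 + ((- (k%:R + 2^-1) ^+ 2)%:C *: tvec rho k + 0).
have hU k : L2even rho (U k).
  by apply: (L2_lin mW _ (hL _)); apply: (L2_lin mW _ (hL _)); exact: L2_0.
have UE k s : s != 0 -> U k s = (s ^+ 2 * htest rho k s)%:C.
  move=> s0; rewrite htest_mul_sqr // (rmorphB (real_complex R)).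
  rewrite -[U k s]/(_ * tvec rho k.+1 s + (_ * tvec rho k s + 0)) addr0 !tvecE //.
  by rewrite -!(rmorphM (real_complex R)) mulNr (rmorphN (real_complex R)).
have E : inner rho (U m) (tvec rho n) = inner rho (tvec rho m) (U n).
  rewrite /inner; congr (_ * _); apply: eq_cintegral => s.
  have [->|s0] := eqVneq s 0; first by rewrite weight0 !mulr0.
  rewrite !UE // !tvecE //; congr (_ * _).
  by apply/eqP; rewrite eq_complex /=; apply/andP; split; apply/eqP; ring.
transitivity (inner rho (U m) (tvec rho n)); first exact/esym/lin.
rewrite E (inner_conj mW (hU n) (hL m)) (lin _ _ _ _ _ (hL n.+1) (hL n) (hL m)).
by rewrite (inner_conj mW (hL m) (hL n.+1)) (inner_conj mW (hL m) (hL n)) conj_real_comb.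
Qed.

(** At [(k + 1, 0)] the recursion reduces to [(k + 1) (g_(k+2) - (k + 2) g_(k+1)) = 0], where
    [g_j = <h_j, h_0>]. At [(0, 0)] the factor vanishes and it says nothing, so [<h_0, h_0>] stays
    undetermined; hence the condition [0 < m + n]. *)
Lemma gram_fact m n : (0 < m + n)%N -> gram m n = (m + n)`!%:R * gram 1 0.
Proof.
have gl k l : gram k l = gram (k + l) 0.
  elim: l k => [k|l IH k]; first by rewrite addn0.
  by rewrite (gram_shift k l) (IH k.+1) addSnnS.
rewrite gl; move: (m + n)%N => {m n} [//|k _].
elim: k => [|k IH]; first by rewrite mul1r.
have := gram_recr k.+1 0; rewrite (gram_shift k.+1 0) => /eqP.
rewrite factS natrM -mulrA -IH -subr_eq0.
set g := gram k.+2 0; set g' := gram k.+1 0.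
have -> : (a + k.+1%:R + 2^-1)%:C * g - ((k.+1%:R + 2^-1) ^+ 2)%:C * g' -
  ((a + 0%:R + 2^-1)%:C * g - ((0%:R + 2^-1) ^+ 2)%:C * g') = k.+1%:R * (g - k.+2%:R * g').
  have nC (j : nat) : (j%:R : C) = (j%:R)%:C by rewrite (rmorph_nat (real_complex R)).
  transitivity ((a + k.+1%:R + 2^-1 - (a + 0%:R + 2^-1))%:C * g - ((k.+1%:R + 2^-1) ^+ 2 - (0%:R + 2^-1) ^+ 2)%:C * g').
    by rewrite !(rmorphB (real_complex R)); ring.
  have -> : a + k.+1%:R + 2^-1 - (a + 0%:R + 2^-1) = k.+1%:R by ring.
  have -> : (k.+1%:R + 2^-1) ^+ 2 - (0%:R + 2^-1) ^+ 2 = k.+1%:R * k.+2%:R :> R.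
    by rewrite -(natr1 k.+1); field.
  by rewrite (rmorphM (real_complex R)) -!nC; ring.
by rewrite mulf_eq0 pnatr_eq0 /= subr_eq0 => /eqP.
Qed.

Lemma gram10_ge0 : 0 <= gram 1 0.
Proof.
(* [gram 1 0] is not a diagonal entry; its sign is read off from [<h_1, h_1> = 2 <h_1, h_0>]. *)
have h : 0 <= gram 1 1 by exact: inner_ge0.
by move: h; rewrite gram_fact // pmulr_rge0 // ltr0n.
Qed.

Lemma comb_positive p : 0 <= inner rho (comb rho ('X * p)) (comb rho p).
Proof.
rewrite comb_MX /comb (@inner_sum _ _ hrho _ _ (fun k => p`_k) (fun k => p`_k) (fun k => tvec rho k.+1) (tvec rho)); last 2 first.
- by move=> k; exact: L2_tvec.
- exact: L2_tvec.
under eq_bigr => i _ do under eq_bigr => j _ do rewrite -/(gram i.+1 j) gram_fact // mulrA.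
under eq_bigr do rewrite -mulr_suml.
rewrite -mulr_suml mulr_ge0 ?gram10_ge0 //.
exact: (fact_gram_ge0 (size p) (fun k => p`_k)).
Qed.

(* The [K]-th difference of the vectors [tvec k.+1 / k.+1`!] has a norm
   independent of [K], whereas modulo the range of [1 + diff_op] it is a
   multiple of [tvec 1] by a factor that tends to infinity with [K]. *)
Definition diffpoly (K : nat) : {poly C} := \poly_(i < K.+1) ((-1) ^+ i * 'C(K, i)%:R / i.+1`!%:R).

Lemma diffpoly_gram K : inner rho (comb rho ('X * diffpoly K)) (comb rho ('X * diffpoly K)) = 2 * gram 1 0.
Proof.
have hs : (size (diffpoly K) <= K.+1)%N by exact: size_poly.
rewrite (comb_MX_wide _ hs) (@inner_sum _ _ hrho _ _ (fun k => (diffpoly K)`_k) (fun k => (diffpoly K)`_k) (fun k => tvec rho k.+1) (fun k => tvec rho k.+1)); last 2 first.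
- by move=> k; exact: L2_tvec.
- by move=> k; exact: L2_tvec.
rewrite -(binomial_gram _ K) mulr_suml; apply: eq_bigr => i _.
rewrite mulr_suml; apply: eq_bigr => j _.
rewrite -/(gram i.+1 j.+1) gram_fact // mulrA !coef_poly !ltn_ord.
congr (_ * _ * _ * _).
by rewrite rmorphM rmorphM fmorphV !rmorph_nat rmorphXn rmorphN1.
Qed.

Lemma nrm2_diffpoly K : nrm2 rho (comb rho ('X * diffpoly K)) = nrm2 rho (comb rho ('X * diffpoly 0)).
Proof.
have h : inner rho (comb rho ('X * diffpoly K)) (comb rho ('X * diffpoly K)) =
  inner rho (comb rho ('X * diffpoly 0)) (comb rho ('X * diffpoly 0)) by rewrite !diffpoly_gram.
move: h; rewrite !inner_nrm2 => -[] /mulfI; apply.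
by rewrite invr_eq0 gt_eqF // mulr_gt0 // pi_gt0.
Qed.

Lemma diffpoly_eval K : exists2 d : R, 1 + K%:R / 2 <= d & (diffpoly K).[-1] = d%:C.
Proof.
(* At [-1] the signs cancel, so all terms are nonnegative; the first two are [1] and [K / 2]. *)
exists (\sum_(i < K.+1) 'C(K, i)%:R / i.+1`!%:R).
  case: K => [|K]; first by rewrite big_ord_recl big_ord0 bin0 mul0r divr1.
  rewrite !big_ord_recl /= bin0 bin1 divr1 addrA lerDl sumr_ge0 // => i _; exact: divr_ge0.
rewrite horner_poly rmorph_sum; apply: eq_bigr => i _.
rewrite (fmorph_div (real_complex R)) !(rmorph_nat (real_complex R)) mulrAC; congr (_ / _).
by rewrite mulrAC -exprMn mulrNN mulr1 expr1n mul1r.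
Qed.

Lemma L2_sub (u v : R -> C^o) : L2even rho u -> L2even rho v -> L2even rho (u - v).
Proof. by move=> hu hv; have := L2_lin mW (-1) hv hu; rewrite scaleN1r addrC. Qed.

(** Approximate [u] by [comb ('X * p)] and subtract the multiple [c] of [diffpoly K] that makes the
    polynomial vanish at [-1]: the result lies in the range. The price is [|c|^2] times a norm
    independent of [K], and [c = p.[-1] / d] tends to [0] as [K] grows. *)
Lemma range_dense (u : R -> C^o) (e : R) : L2even rho u -> 0 < e ->
  exists p : {poly C}, nrm2 rho (u - comb rho ('X * p + p)) < e.
Proof.
move=> hu e0; have e4 : 0 < e / 4 by rewrite divr_gt0.
have [p hp] := comb_dense hrho hu e4.
pose B := nrm2 rho (comb rho ('X * diffpoly 0)); have B0 : 0 <= B by exact: nrm2_ge0.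
pose A := normc p.[-1] ^+ 2 * B; have A0 : 0 <= A by rewrite mulr_ge0 // sqr_ge0.
(* Even, so that [1 + K / 2] is one more than an integer above [4 A / e]. *)
pose K := (2 * (Num.truncn (4 * A / e)).+1)%N.
have [d hd dE] := diffpoly_eval K.
have hK : 4 * A / e < d.
  apply: lt_le_trans (truncnS_gt _) (le_trans _ hd).
  have -> : K%:R / 2 = (Num.truncn (4 * A / e)).+1%:R :> R by rewrite /K natrM; field.
  by rewrite lerDr.
have d1 : 1 <= d by apply: le_trans hd; rewrite lerDl divr_ge0.
have d0 : 0 < d by lra.
have dC : d%:C != 0 :> C by rewrite eq_complex /= negb_and gt_eqF.
pose c := p.[-1] / d%:C.
have rt : root (p - c *: diffpoly K) (-1).
  by rewrite rootE hornerD hornerN hornerZ dE /c divfK // subrr.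
have /factor_theorem[r hr] := rt.
(* Here [p - c *: diffpoly K = r * ('X + 1)]; the additional ['X] is present because ['X * p], not
   [p], represents the approximant of [u]. *)
exists ('X * r).
have E : 'X * ('X * r) + 'X * r = 'X * p - c *: ('X * diffpoly K).
  have -> : 'X * p - c *: ('X * diffpoly K) = 'X * (p - c *: diffpoly K) by rewrite mulrBr scalerAr.
  by rewrite hr polyCN opprK polyC1; ring.
have hQ := L2_comb hrho ('X * diffpoly K).
have hcQ : L2even rho (c *: comb rho ('X * diffpoly K)) by rewrite -comb_Z; exact: L2_comb.
have -> : u - comb rho ('X * ('X * r) + 'X * r) = (u - comb rho ('X * p)) + c *: comb rho ('X * diffpoly K).
  by rewrite E comb_B comb_Z opprB addrA addrAC.
apply: le_lt_trans (nrm2D hrho (L2_sub hu (L2_comb hrho _)) hcQ) _.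
rewrite nrm2Z // nrm2_diffpoly -/B.
have hc : normc c ^+ 2 * B <= e / 4.
  rewrite /c normcM normcV normc_real (gtr0_norm d0) exprMn mulrAC -/A exprVn.
  rewrite ler_pdivrMr ?exprn_gt0 //.
  have := hK; rewrite ltr_pdivrMr // => h.
  have d2 : d <= d ^+ 2 by rewrite expr2 ler_peMr // ltW.
  have := ler_wpM2r (ltW e0) d2; lra.
lra.
Qed.

End Gram.

Theorem lemma4p1 (R : realType) (rho : R) (hrho : rho < 2^-1) :
  essentially_self_adjoint (L2even rho) (@inner R rho) (diff_op_graph rho).
Proof.
have mW := measurable_weight hrho.
pose G0 : set ((R -> R[i]^o) * (R -> R[i]^o)) :=
  [set q | exists p, q = ((fun s : R => fcomb rho p s%:C), comb rho p)].
(* [fcomb p] and [comb ('X * p)] are known to agree only off [0], and the weight hides the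
   difference at that point. *)
have near_eq (u v w : R -> R[i]^o) (r : R) : 0 < r -> (forall s, s != 0 -> v s = w s) ->
    nrm2 rho (u - w) < r ^+ 2 -> hnorm (@inner R rho) (u - v) < r%:C.
  move=> r0 vw h; apply: hnorm_lt => //; rewrite (@nrm2_eq _ _ (u - v) (u - w)) // => s s0.
  by rewrite -[LHS]/(u s - v s) vw.
apply: (@essentially_self_adjoint_of_range _ _ _ _ _ _ _ _ _ _ G0).
- exact: L2_0.
- by move=> a u v; exact: L2_lin.
- by move=> a u v w; exact: inner_lin.
- by move=> u v; exact: inner_conj.
- by move=> u _; exact: inner_ge0.
- by move=> _ _ [f hf [-> ->]]; split; [exact: domainH_L2 | exact: diff_op_L2].
- exists (fun=> 0); first exact: domainH_0.
  by congr pair; apply/funext => s //; rewrite diff_op_cst0.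
- move=> a _ _ _ _ [f hf [-> ->]] [g hg [-> ->]].
  exists (fun z => a * f z + g z); first exact: domainH_lin.
  by congr pair; apply/funext => s //; rewrite diff_op_lin.
- move=> u hu _ /gtc0_real[r r0 ->].
  have [p hp] := comb_dense hrho hu (exprn_gt0 2 r0).
  exists (fun s : R => fcomb rho p s%:C), (comb rho p); split.
    by exists (fcomb rho p); [exact: fcomb_domainH | rewrite diff_op_fcomb].
  by apply: (near_eq _ _ (comb rho ('X * p))) => // s; exact: fcomb_comb.
- exact: diff_op_symmetric.
- by move=> _ [p ->]; exists (fcomb rho p); [exact: fcomb_domainH | rewrite diff_op_fcomb].
- move=> _ _ [p [-> ->]].
  have h : inner rho (fun s : R => fcomb rho p s%:C) (comb rho p) = inner rho (comb rho ('X * p)) (comb rho p).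
    by apply: inner_eq => // s; exact: fcomb_comb.
  have hf : L2even rho (fun s : R => fcomb rho p s%:C) by apply: domainH_L2 => //; exact: fcomb_domainH.
  have hp := comb_positive hrho p.
  rewrite (inner_conj mW hf (L2_comb hrho p)) h addr_ge0 //.
  by rewrite conjC_ge0.
- move=> u hu _ /gtc0_real[r r0 ->].
  have [p hp] := range_dense hrho hu (exprn_gt0 2 r0).
  exists (fun s : R => fcomb rho p s%:C), (comb rho p); split; first by exists p.
  apply: (near_eq _ _ (comb rho ('X * p + p))) => // s s0.
  by rewrite comb_D -[LHS]/(fcomb rho p s%:C + comb rho p s) fcomb_comb.
Qed.
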